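(* Let $k,d\ge1$ be integers, $0<t_0<T$, $\beta\in\,]0,2\wedge k[$, and let $u=\{u(t,x),\ (t,x)\in[0,T]\times\mathbb{R}^k\}$ be the $\mathbb{R}^d$-valued solution of the linear stochastic wave system driven by spatially homogeneous Gaussian noise with spectral measure $\mu(d\xi)=\|\xi\|^{-k+\beta}d\xi$ (defined in the context). Let $I$, $J$ be compact subsets of $[t_0,T]$ and $\mathbb{R}^k$, respectively, each with positive Lebesgue measure. Then: (1) there exists a positive constant $c=c(I,J,\beta,k,d)$ such that for any Borel set $A\subset\mathbb{R}^d$, $$P\{u(I\times J)\cap A\ne\varnothing\}\le c\,\mathcal{H}_{d-\frac{2(k+1)}{2-\beta}}(A);$$ (2) for any $t\in I$, there exists a positive constant $c=c(J,\beta,k,d,t)$ such that for any Borel set $A\subset\mathbb{R}^d$, $$P\{u(\{t\}\times J)\cap A\ne\varnothing\}\le c\,\mathcal{H}_{d-\frac{2k}{2-\beta}}(A);$$ (3) for any $x\in J$, there exists a positive constant $c=c(I,\beta,k,d,x)$ such that for any Borel set $A\subset\mathbb{R}^d$, $$P\{u(I\times\{x\})\cap A\ne\varnothing\}\le c\,\mathcal{H}_{d-\frac{2}{2-\beta}}(A).$$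
   Context: The process $u$. Let $\sigma=(\sigma_{i,j})$ be a fixed deterministic invertible $d\times d$ matrix (constants may depend on it). $u=(u_1,\dots,u_d)$ is the solution of $$\frac{\partial^2u_i}{\partial t^2}(t,x)-\Delta u_i(t,x)=\sum_{j=1}^d\sigma_{i,j}\dot F^j(t,x),\qquad u_i(0,x)=\frac{\partial u_i}{\partial t}(0,x)=0,$$ where $\dot F=(\dot F^1,\dots,\dot F^d)$ has i.i.d. centered Gaussian components, white in time and spatially homogeneous, with $E(F^i(\varphi)F^i(\psi))=\int_{\mathbb{R}_+}dr\int_{\mathbb{R}^k}\mu(d\xi)\,\mathcal{F}\varphi(r,\cdot)(\xi)\,\overline{\mathcal{F}\psi(r,\cdot)(\xi)}$ for test functions $\varphi,\psi\in C_0^\infty(\mathbb{R}^{k+1})$, $\mathcal{F}$ denoting the Fourier transform in space. Here $\mu(d\xi)=\|\xi\|^{-k+\beta}d\xi$ (equivalently, spatial covariance a constant multiple of $\|x\|^{-\beta}$). The solution is the stochastic convolution $u_i(t,x)=\int_0^t\int_{\mathbb{R}^k}G(t-r,x-y)\sum_j\sigma_{i,j}M^j(dr,dy)$, where $G$ is the fundamental solution of the wave equation, with $\mathcal{F}G(t)(\xi)=\sin(t\|\xi\|)/\|\xi\|$, and $M=(M^1,\dots,M^d)$ is the martingale measure derived from $\dot F$. Equivalently, $u$ is the centered Gaussian random field with $$E(u_i(t,x)u_j(s,y))=(\sigma\sigma^{\mathsf T})_{i,j}\int_0^{t\wedge s}dr\int_{\mathbb{R}^k}\mu(d\xi)\,e^{\mathrm{i}\xi\cdot(x-y)}\,\frac{\sin((t-r)\|\xi\|)\sin((s-r)\|\xi\|)}{\|\xi\|^2},$$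 taken in its version with continuous sample paths. For a set $S\subset[0,T]\times\mathbb{R}^k$, $u(S)$ is its random image. Hausdorff measure. For a Borel set $A\subset\mathbb{R}^d$, $\mathcal{H}_\gamma(A)=\infty$ if $\gamma<0$, and for $\gamma\ge0$, $$\mathcal{H}_\gamma(A)=\lim_{\varepsilon\to0^+}\inf\left\{\sum_{i=1}^\infty(2r_i)^\gamma:\ A\subset\bigcup_{i=1}^\infty B_{r_i}(x_i),\ \sup_{i\ge1}r_i\le\varepsilon\right\},$$ where $B_r(x)$ is the open Euclidean ball with center $x$ and radius $r$. *)

(* Defs.v *)
From HB Require Import structures.
From mathcomp Require Import all_boot all_order all_algebra.
From mathcomp Require Import all_classical all_reals all_analysis.
From mathcomp Require Import measurable_realfun.

Set Implicit Arguments.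
Unset Strict Implicit.
Unset Printing Implicit Defensive.

Import Order.TTheory GRing.Theory Num.Theory.
Import numFieldNormedType.Exports.

Local Open Scope classical_set_scope.
Local Open Scope ring_scope.

(* R^n is 'rV[R]_n.  The library norm on matrices is the sup norm: it induces
   the right topology, but |xi| and the balls below must be Euclidean. *)

Definition dotv (R : realType) (n : nat) (x y : 'rV[R]_n) : R :=
  \sum_(i < n) x ord0 i * y ord0 i.

Definition enorm (R : realType) (n : nat) (x : 'rV[R]_n) : R :=
  Num.sqrt (dotv x x).

Definition eball (R : realType) (n : nat) (x : 'rV[R]_n) (r : R) :
  set 'rV[R]_n := [set y | enorm (y - x) < r].

Definition borel (R : realType) (n : nat) :=
  g_sigma_algebraType (@open 'rV[R]_n).

(* n-dimensional Lebesgue measure: the n-fold product of the one-dimensional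
   one, carried from n-tuples over to the Borel sets of 'rV[R]_n. *)

Definition tcons (R : realType) (n : nat)
    (p : measurableTypeR R * n.-tuple (measurableTypeR R)) :
  n.+1.-tuple (measurableTypeR R) := [tuple of p.1 :: p.2].

Fixpoint lebesgue_tuple (R : realType) (n : nat) :
    set (n.-tuple (measurableTypeR R)) -> \bar R :=
  match n with
  | 0 => @dirac _ _ [tuple] R
  | n'.+1 => pushforward (lebesgue_measure \x @lebesgue_tuple R n')%E
               (@tcons R n')
  end.

Definition row_of_tuple (R : realType) (n : nat)
    (t : n.-tuple (measurableTypeR R)) : borel R n :=
  \row_(i < n) (tnth t i : R).

Definition lebesgue_rV (R : realType) (n : nat) : set (borel R n) -> \bar R :=
  pushforward (@lebesgue_tuple R n) (@row_of_tuple R n).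

Section lebesgue_rV_measure.
Context {R : realType}.
Local Notation RT n := (n.-tuple (measurableTypeR R)).

Lemma measurable_tcons n : measurable_fun setT (@tcons R n).
Proof. exact: measurable_cons. Qed.

Lemma lebesgue_tuple_sigma_finite_measure n :
  exists m : {sigma_finite_measure set (RT n) -> \bar R},
    (m : set (RT n) -> \bar R) = @lebesgue_tuple R n.
Proof.
elim: n => [|n [m mE]]; first by exists (@dirac _ _ [tuple] R).
rewrite /= -mE; set p := pushforward _ _.
pose M : {measure set (RT n.+1) -> \bar R} :=
  measure_function_pushforward__canonical__measure_function_Measure
   (lebesgue_measure \x m)%E (@measurable_tcons n).
have /sigma_finiteP[F [TF ndF Foo]] := sigma_finiteT (@lebesgue_measure R).
have /sigma_finiteP[G [TG ndG Goo]] := sigma_finiteT m.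
have sf : sigma_finite setT p.
  pose g (t : RT n.+1) : measurableTypeR R * RT n :=
    (thead t, [tuple of behead t]).
  have gt q : g (tcons q) = q.
    by case: q => a b; rewrite /g theadE; congr pair; exact: val_inj.
  have mg : measurable_fun setT g.
    apply/measurable_fun_pairP; split; first exact: measurable_tnth.
    exact: measurable_behead.
  exists (fun i => g @^-1` (F i `*` G i)).
    apply/esym; rewrite -subTset => t _.
    have [i _ Fi] : (\bigcup_i F i) (g t).1 by rewrite -TF.
    have [j _ Gj] : (\bigcup_i G i) (g t).2 by rewrite -TG.
    exists (maxn i j) => //; split.
    - by move: Fi; exact/subsetPset/ndF/leq_maxl.
    - by move: Gj; exact/subsetPset/ndG/leq_maxr.
  move=> i; have [? ?] := Foo i; have [? ?] := Goo i; split.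
    by rewrite -[X in measurable X]setTI; apply: mg => //; exact: measurableX.
  rewrite /p /pushforward -comp_preimage.
  rewrite (_ : g \o _ = id) ?preimage_id; last exact/funext.
  by rewrite product_measure1E// lte_mul_pinfty// ge0_fin_numE.
pose B := Measure_isSigmaFinite.Build _ _ _ M sf.
pose M' : {sigma_finite_measure set (RT n.+1) -> \bar R} :=
  HB.pack (M : set _ -> _) M B.
by exists M'.
Qed.

Lemma measurable_row_of_tuple n : measurable_fun setT (@row_of_tuple R n).
Proof.
apply: (@measurability _ _ _ _ setT (@row_of_tuple R n) (@open 'rV[R]_n)) => //.
move=> _ [U oU <-]; rewrite setTI.
pose B (q : 'rV[rat]_n * nat) : set (RT n) := [set t |
  forall i, `|ratr (q.1 ord0 i) - (tnth t i : R)| < q.2.+1%:R^-1].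
pose D := [set q | B q `<=` @row_of_tuple R n @^-1` U].
have -> : @row_of_tuple R n @^-1` U = \bigcup_(q in D) B q.
  apply/seteqP; split=> [t Ut|t [q Dq /Dq]//].
  have : nbhs (row_of_tuple t : 'rV[R]_n) U by exact: open_nbhs_nbhs.
  move=> /nbhs_ballP[e /= e0 eU].
  have [m me] : exists m, m.+1%:R^-1 < e / 2.
    have e20 : 0 < e / 2 by rewrite divr_gt0.
    exists (Num.truncn (e / 2)^-1).
    by rewrite invf_plt ?posrE// truncnS_gt.
  pose Q (i : 'I_n) (q : rat) :=
    `|ratr q - (tnth t i : R)| < m.+1%:R^-1.
  have exQ i : exists q, Q i q.
    have [q qt] : exists q : rat, ratr q \in
        `](tnth t i : R) - m.+1%:R^-1, (tnth t i : R) + m.+1%:R^-1[.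
      by apply: rat_in_itvoo; rewrite ltrD2l gtrN// invr_gt0.
    by exists q; move: qt; rewrite in_itv/= -ltr_distl.
  have [q qQ] := choice exQ.
  exists (\row_i q i, m); last by move=> i; rewrite mxE; exact: qQ.
  move=> s /= Bs; apply: eU; split=> // i j; rewrite !mxE.
  have := Bs j; have := qQ j; rewrite /Q !mxE /= => h1 h2.
  rewrite /ball /= distrC.
  rewrite (splitr e) (le_lt_trans (ler_distD (ratr (q j)) _ _))//.
  by rewrite ltrD// distrC ?(lt_trans _ me)// distrC.
rewrite bigcup_mkcond; apply: countable_bigcupT_measurable => [|q].
  exact: countableP.
case: ifPn => // _.
rewrite (_ : B q = \bigcap_(i in [set: 'I_n])
   (fun t : RT n => tnth t i : R) @^-1` ball (ratr (q.1 ord0 i) : R) q.2.+1%:R^-1).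
  apply: fin_bigcap_measurable => // i _.
  rewrite -[X in measurable X]setTI; apply: measurable_tnth => //.
  exact: measurable_ball.
by apply/seteqP; split => [t Bt i _|t Bt i]; [exact: Bt|exact: Bt].
Qed.

Let lebesgue_rV0 n : @lebesgue_rV R n set0 = 0%E.
Proof.
have [m mE] := lebesgue_tuple_sigma_finite_measure n.
by rewrite /lebesgue_rV /pushforward preimage_set0 -mE measure0.
Qed.

Let lebesgue_rV_ge0 n A : (0 <= @lebesgue_rV R n A)%E.
Proof.
have [m mE] := lebesgue_tuple_sigma_finite_measure n.
by rewrite /lebesgue_rV /pushforward -mE measure_ge0.
Qed.

Let lebesgue_rV_sigma_additive n : semi_sigma_additive (@lebesgue_rV R n).
Proof.
have [m mE] := lebesgue_tuple_sigma_finite_measure n.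
rewrite /lebesgue_rV -mE.
exact: (@measure_semi_sigma_additive _ _ _
  (measure_function_pushforward__canonical__measure_function_Measure
   m (@measurable_row_of_tuple n))).
Qed.

HB.instance Definition _ n := isMeasure.Build _ _ _ (@lebesgue_rV R n)
  (@lebesgue_rV0 n) (@lebesgue_rV_ge0 n) (@lebesgue_rV_sigma_additive n).

End lebesgue_rV_measure.

(* A zero radius contributes 0, also when gamma = 0 (powR 0 0 = 1 in the
   library): the ball is then empty, so this amounts to allowing finite covers
   and makes the 0-dimensional measure the counting measure. *)
Definition hausdorff_term (R : realType) (gamma r : R) : R :=
  if r == 0 then 0 else (2 * r) `^ gamma.

Definition hausdorff_content (R : realType) (d : nat) (gamma eps : R)
    (A : set 'rV[R]_d) : \bar R :=
  ereal_inf [set s | exists (x : nat -> 'rV[R]_d) (r : nat -> R),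
    [/\ forall i, 0 <= r i <= eps,
        A `<=` \bigcup_i eball (x i) (r i) &
        s = (\sum_(0 <= i <oo) (hausdorff_term gamma (r i))%:E)%E]].

Definition hausdorff_measure (R : realType) (d : nat) (gamma : R)
    (A : set 'rV[R]_d) : \bar R :=
  if gamma < 0 then +oo%E
  else lim (hausdorff_content gamma eps A @[eps --> 0^'+]).

Section wave_field.
Context (R : realType).

(* The point mass is the variance 0 case; normal_prob 0 0 is not. *)
Definition centered_gaussian (dO : measure_display) (Omega : measurableType dO)
    (P : probability Omega R) (X : Omega -> R) : Prop :=
  measurable_fun setT X /\
  exists s : R, 0 <= s /\
    forall B : set (measurableTypeR R), measurable B ->
      P (X @^-1` B) = if s == 0 then \d_(0 : R) B else normal_prob 0 s B.

(* Integration against mu(dxi) = |xi|^(-k+beta) dxi; as mu is symmetric, the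
   factor exp(i xi.(x - y)) contributes only its real part. *)
Definition wave_covariance (k : nat) (beta t s : R) (x y : 'rV[R]_k) : \bar R :=
  (\int[lebesgue_measure]_(r in `[0%R, Num.min t s]%classic)
   \int[@lebesgue_rV R k]_xi
     (cos (dotv xi (x - y)) *
      (sin ((t - r) * enorm xi) * sin ((s - r) * enorm xi) / enorm xi ^+ 2) *
      enorm xi `^ (- k%:R + beta))%:E)%E.

Definition is_wave_solution (k d : nat) (T beta : R) (sigma : 'M[R]_d)
    (dO : measure_display) (Omega : measurableType dO)
    (P : probability Omega R)
    (u : R -> 'rV[R]_k -> Omega -> 'rV[R]_d) : Prop :=
  [/\ forall (n : nat) (t : 'I_n -> R) (x : 'I_n -> 'rV[R]_k)
         (a : 'I_n -> 'rV[R]_d),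
        (forall l, 0 <= t l <= T) ->
        centered_gaussian P
          (fun w => \sum_(l < n) dotv (a l) (u (t l) (x l) w)),
      forall (t s : R) (x y : 'rV[R]_k) (i j : 'I_d),
        0 <= t <= T -> 0 <= s <= T ->
        ('E_P[fun w => (u t x w ord0 i * u s y w ord0 j)%R] =
         ((sigma *m sigma^T) i j)%:E * wave_covariance beta t s x y)%E &
      forall w, {within `[0, T]%classic `*` [set: 'rV[R]_k],
        continuous (fun z : R * 'rV[R]_k => u z.1 z.2 w)}].

Definition hits (k d : nat) (Omega : Type)
    (u : R -> 'rV[R]_k -> Omega -> 'rV[R]_d)
    (S : set (R * 'rV[R]_k)) (A : set 'rV[R]_d) : set Omega :=
  [set w | (fun z => u z.1 z.2 w) @` S `&` A !=set0].

End wave_field.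

(* The event [hits u S A] is analytic, hence measurable for the completion of
   P but possibly not for P, and a library measure has no meaning on a
   non-measurable set.  The outer measure agrees with the completed
   probability on such an event. *)
Definition hitting_probability (R : realType) (k d : nat)
    (dO : measure_display) (Omega : measurableType dO)
    (P : probability Omega R)
    (u : R -> 'rV[R]_k -> Omega -> 'rV[R]_d)
    (S : set (R * 'rV[R]_k)) (A : set 'rV[R]_d) : \bar R :=
  mu_ext P (hits u S A).

(* Main.v *)
From HB Require Import structures.
Require Import Defs.
From mathcomp Require Import all_boot all_order all_algebra.
From mathcomp Require Import all_classical all_reals all_analysis.
From mathcomp Require Import measurable_realfun.
From mathcomp Require Import ring lra.

(** Let [v = sigma^-1 u] and [H = (2 - beta) / 2].  The components of [v] are
    independent Gaussian fields; on [t0, T] x R^k their variances are bounded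
    below, and their increments over the distance [delta] have standard deviation
    at most a constant times [delta^H].  Each of [I x J], [{t} x J] and [I x {x}]
    is contained in the image of a cube [0, 1]^m under an affine map, with
    [m = k + 1], [k] and [1].

    The main step, [hit_ball_bound], is that [v] meets a ball of radius [r] over
    such a set with probability at most [c * r^(d - m / H)].  At the scale
    [2^-L] with [2^(- L H)] of order [r], the cube has about [r^(- m / H)] grid
    points, and at each of them [v] is near the center of the ball with
    probability of order [r^d].  What happens between the grid points has to be
    controlled together with the event of being near the ball, and this is done
    by chaining ([hit_subset]): if [v] enters the ball, then either it is
    within [2 r] of the center at a grid point of level [L], or for some [l] it is
    so at a grid point of level [L + l + 1], with an atypically large increment
    towards the parent of that point.  By [gaussian_pair_bound] the latter has
    probability at most a constant times [r^d] times any prescribed power of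
    [2^-l], which compensates the growth of the number of grid points.

    The factor [r^d], also in the presence of a correlated increment, rests on
    the independence of orthogonal jointly Gaussian variables.  It is obtained
    for sufficiently many test functions: a Gaussian bell is an average of
    cosines, so the factorization of the characteristic function passes to
    products of bells ([bellpoly_independent]).  Up to constants, bells dominate
    the indicators of intervals and powers of [1 - bell] those of tails, and
    Markov's inequality applied to the product of these functions
    ([prod_markov]) gives the probability bounds.

    Covering [A] by balls and using the subadditivity of the outer probability
    replaces the ball by [A] and the power of [r] by the Hausdorff measure of
    dimension [d - m / H] ([hitting_hausdorff]).

    For the second moments, the covariance is an integral over time and frequency
    ([wave_covarianceE]).  The integrand of the squared increment over the
    distance [delta] is at most
    [8 * min(1, delta^2 |xi|^2) * |xi|^(beta - k - 2)]
    ([spectral_increment_le]), and summing over dyadic cubes of frequencies shows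
    that the integral of this function is of order [delta^(2 - beta)]
    ([integral_riesz_le]). *)

Set Implicit Arguments.
Unset Strict Implicit.
Unset Printing Implicit Defensive.

Import Order.TTheory GRing.Theory Num.Theory.
Import numFieldNormedType.Exports.

Local Open Scope classical_set_scope.
Local Open Scope ring_scope.

(** * Gaussian weights on the line *)

Lemma ler_integrable d (T : measurableType d) (R : realType)
    (mu : {measure set T -> \bar R}) (f g : T -> R) :
  measurable_fun setT f -> (forall x, `|f x| <= g x) ->
  mu.-integrable setT (EFin \o g) -> mu.-integrable setT (EFin \o f).
Proof.
move=> mf fg ig; apply: le_integrable ig => //; first exact/measurable_EFinP.
by move=> x _; rewrite lee_fin (le_trans (fg x))// ler_norm.
Qed.

Section bell.
Context {R : realType}.
Implicit Types (m s y : R).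
Notation mu := (@lebesgue_measure R).

(** Both a Gaussian density up to its mass and a smooth substitute for the
    indicator of the interval of radius [s] about [m]. *)
Definition bell m s y : R := expR (- ((y - m) / s) ^+ 2 / 2).

Lemma bell_ge0 m s y : 0 <= bell m s y.
Proof. exact: expR_ge0. Qed.

Lemma bell_le1 m s y : bell m s y <= 1.
Proof. by rewrite -[leRHS]expR0 ler_expR mulNr oppr_le0 divr_ge0 ?sqr_ge0. Qed.

Lemma continuous_bell m s : continuous (bell m s).
Proof.
move=> y; apply: (@continuous_comp _ _ _ (fun y => - ((y - m) / s) ^+ 2 / 2) expR).
  apply: cvgMl; apply: (@cvgN _ R^o).
  apply: (@continuous_comp _ _ _ (fun y => (y - m) / s) (fun z => z ^+ 2)).
    by apply: cvgMl; apply: (@cvgB _ R^o); [exact: cvg_id|exact: cvg_cst].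
  exact: exprn_continuous.
exact: continuous_expR.
Qed.

Lemma measurable_bell m s : measurable_fun setT (bell m s).
Proof. by apply: continuous_measurable_fun; exact: continuous_bell. Qed.

Definition bell_mass s : R := Num.sqrt (s ^+ 2 * pi *+ 2).

Lemma bell_mass_gt0 s : 0 < s -> 0 < bell_mass s.
Proof. by move=> s0; rewrite sqrtr_gt0 pmulrn_lgt0// mulr_gt0 ?pi_gt0 ?exprn_gt0. Qed.

Lemma bell_massZ c s : 0 <= c -> bell_mass (c * s) = c * bell_mass s.
Proof.
move=> c0; rewrite /bell_mass exprMn -mulrA -mulrnAr sqrtrM ?sqr_ge0//.
by rewrite sqrtr_sqr ger0_norm.
Qed.

Lemma bell_massE s : 0 <= s -> bell_mass s = s * bell_mass 1.
Proof. by move=> s0; rewrite -bell_massZ// mulr1. Qed.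

Lemma normal_pdf_bell m s y : 0 < s ->
  normal_pdf m s y = (bell_mass s)^-1 * bell m s y.
Proof.
move=> s0; rewrite normal_pdfE ?gt_eqF//; congr (_ * expR _).
by rewrite mulNr -mulr_natr; field; rewrite gt_eqF.
Qed.

Lemma integrable_bell m s : 0 < s -> mu.-integrable setT (EFin \o bell m s).
Proof.
move=> s0.
have -> : EFin \o bell m s =
    (fun y => (bell_mass s)%:E * (normal_pdf m s y)%:E)%E.
  apply/funext => y /=; rewrite normal_pdf_bell// -EFinM mulVKf//.
  by rewrite gt_eqF ?bell_mass_gt0.
by apply: integrableZl => //; exact: integrable_normal_pdf.
Qed.

Lemma integral_bell m s : 0 < s ->
  (\int[mu]_y (bell m s y)%:E = (bell_mass s)%:E)%E.
Proof.
move=> s0; under eq_integral => y _.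
  rewrite (_ : bell m s y = bell_mass s * normal_pdf m s y); last first.
    by rewrite normal_pdf_bell// mulVKf// gt_eqF ?bell_mass_gt0.
  rewrite EFinM; over.
by rewrite integralZl ?integral_normal_pdf ?mule1//; exact: integrable_normal_pdf.
Qed.

Lemma Rintegral_bell m s : 0 < s -> \int[mu]_y bell m s y = bell_mass s.
Proof. by move=> s0; rewrite /Rintegral integral_bell. Qed.

Lemma pow_le_expR (n : nat) y : 0 <= y -> y ^+ n <= n`!%:R * expR y.
Proof.
move=> y0; case: n => [|n].
  by rewrite expr0 fact0 mul1r -[leLHS]expR0 ler_expR.
have := expR_ge1Dxn n y0; rewrite -ler_pdivrMl ?ltr0n ?fact_gt0// => h.
by apply: le_trans h; rewrite mulrC lerDr ler01.
Qed.

(** Half of the exponent absorbs the power, by [z ^+ n <= n! exp z] at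
    [z = y^2 / (4 s^2)]; the other half is a bell wider by the factor [sqrt 2]. *)
Lemma pow_bell_le (n : nat) s y : 0 < s ->
  y ^+ n.*2 * bell 0 s y <= n`!%:R * (4 * s ^+ 2) ^+ n * bell 0 (Num.sqrt 2 * s) y.
Proof.
move=> s0; have s20 : 0 < 4 * s ^+ 2 by rewrite mulr_gt0 ?exprn_gt0.
have h : y ^+ 2 / (4 * s ^+ 2) >= 0 by rewrite divr_ge0 ?sqr_ge0 ?ltW.
have := pow_le_expR n h; rewrite expr_div_n -exprM mul2n ler_pdivrMr ?exprn_gt0//.
have -> : bell 0 s y = expR (- (y ^+ 2 / (4 * s ^+ 2))) * bell 0 (Num.sqrt 2 * s) y.
  rewrite /bell -expRD subr0 !expr_div_n exprMn sqr_sqrtr//; congr expR.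
  by field; rewrite gt_eqF.
move=> {}h; rewrite mulrA ler_wpM2r ?bell_ge0// expRN.
by rewrite ler_pdivrMr ?expR_gt0// mulrAC.
Qed.

Lemma pow_bell_ub (n : nat) s y : 0 < s ->
  y ^+ n.*2 * bell 0 s y <= n`!%:R * (4 * s ^+ 2) ^+ n.
Proof.
move=> s0; apply: (le_trans (pow_bell_le n y s0)).
by rewrite ler_piMr ?bell_le1// mulr_ge0// exprn_ge0// mulr_ge0// sqr_ge0.
Qed.

Lemma integrable_Mbell (f : R -> R) C s : 0 < s -> measurable_fun setT f ->
  (forall y, `|f y| <= C * (1 + y ^+ 2)) ->
  mu.-integrable setT (EFin \o (fun y => f y * bell 0 s y)).
Proof.
move=> s0 mf fC.
have C0 : 0 <= C.
  by have := fC 0; rewrite expr0n addr0 mulr1; exact: le_trans.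
have s20 : 0 < Num.sqrt 2 * s by rewrite mulr_gt0 ?sqrtr_gt0.
apply: (@ler_integrable _ _ _ _ _ (fun y : measurableTypeR R =>
    C * (bell 0 s y + 4 * s ^+ 2 * bell 0 (Num.sqrt 2 * s) y))).
- by apply: measurable_funM => //; exact: measurable_bell.
- move=> y; rewrite normrM (ger0_norm (bell_ge0 _ _ _)).
  apply: (@le_trans _ _ (C * (1 + y ^+ 2) * bell 0 s y)).
    by rewrite ler_wpM2r ?bell_ge0.
  rewrite -mulrA ler_wpM2l// mulrDl mul1r lerD2l.
  by have := pow_bell_le 1 y s0; rewrite (_ : 1`! = 1%N)// mul1r expr1.
- rewrite /comp; under eq_fun do rewrite EFinM EFinD EFinM.
  apply: integrableZl => //; apply: integrableD => //; first exact: integrable_bell.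
  by apply: integrableZl => //; exact: integrable_bell.
Qed.

End bell.

(** * Integration by parts and the Gaussian Fourier transform *)

Section calculus.
Context {R : realType}.
Notation mu := (@lebesgue_measure R).

(** The fundamental theorem of calculus on [-n, n], followed by dominated
    convergence as [n] tends to infinity. *)
Lemma integral_derivative_eq0 (G g : R -> R) :
  (forall y : R, is_derive y 1 G (g y)) -> continuous g ->
  mu.-integrable setT (EFin \o g) ->
  G n%:R @[n --> \oo] --> (0 : R) -> G (- n%:R) @[n --> \oo] --> (0 : R) ->
  \int[mu]_y g y = 0.
Proof.
move=> Gg cg ig G0 GN0.
have cG : continuous G.
  by move=> y; apply: differentiable_continuous; apply/derivable1_diffP.
have mg : measurable_fun setT g by apply: continuous_measurable_fun.
pose D (n : nat) := `[- n%:R, n%:R]%classic : set R.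
have FTC n : (\int[mu]_y ((g \_ (D n.+1)) y)%:E = (G n.+1%:R - G (- n.+1%:R))%:E)%E.
  transitivity (\int[mu]_(y in D n.+1) (g y)%:E)%E.
    by rewrite [RHS]integral_mkcond restrict_EFin.
  rewrite EFinB; apply: continuous_FTC2.
  - by rewrite gtrN.
  - exact: continuous_subspaceT.
  - split; last 2 first.
      by apply: cvg_at_right_filter; exact: cG.
      by apply: cvg_at_left_filter; exact: cG.
    by move=> x _; have [] := Gg x.
  - by move=> x _; rewrite derive1E; have [_ ->] := Gg x.
have cv : (\int[mu]_y ((g \_ (D n.+1)) y)%:E)%E @[n --> \oo] -->
          (\int[mu]_y (g y)%:E)%E.
  apply: (@dominated_cvg _ _ _ mu _ measurableT _ _ (fun y => `|g y|%:E)) => //.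
  - move=> n; apply/measurable_EFinP.
    apply/(measurable_restrictT _ _).1; first exact: measurable_itv.
    exact: measurable_funTS.
  - move=> y _; apply: cvg_near_cst.
    exists (Num.truncn `|y|) => // n /= yn.
    rewrite patchE ifT// inE /D/= in_itv/= -ler_norml.
    by rewrite (le_trans (ltW (truncnS_gt _)))// ler_nat.
  - have := integrable_abse ig; apply: eq_integrable => //.
  - move=> n y _; rewrite lee_fin patchE; case: ifP => // _.
    by rewrite normr0.
have cv0 : (\int[mu]_y ((g \_ (D n.+1)) y)%:E)%E @[n --> \oo] --> 0%:E.
  under eq_cvg do rewrite FTC.
  apply: cvg_EFin; first exact: nearW.
  rewrite -(subr0 (0 : R)); apply: (@cvgB _ R^o).
    by rewrite (cvg_shiftS (fun n => G n%:R)).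
  by rewrite (cvg_shiftS (fun n => G (- n%:R))).
by rewrite /Rintegral (cvg_unique _ cv cv0).
Qed.

Lemma is_derive_bell (s y : R) : s != 0 ->
  is_derive y 1 (bell 0 s) (- (y / s ^+ 2) * bell 0 s y).
Proof.
move=> s0; have -> : bell 0 s = expR \o (fun y => - ((y / s) ^+ 2 / 2)).
  by apply/funext => z; rewrite /bell /= subr0 mulNr.
apply: is_derive_eq; rewrite /GRing.scale/=.
rewrite !mulr0 !add0r mulr1 mulrC; congr (_ * _).
by rewrite -mulr2n -mulr_natr; field.
Qed.

(** Makes the boundary terms at infinity vanish in [stein]. *)
Lemma bell_decay (s y : R) : 0 < s ->
   (1 + `|y|) * bell 0 s y <= (2 + 8 * s ^+ 2) * (1 + `|y|)^-1.
Proof.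
move=> s0; rewrite ler_pdivlMr ?ltr_wpDr//.
have h1 := pow_bell_ub 1 y s0.
rewrite (_ : 1`! = 1%N)// mul1r expr1 in h1.
have := bell_le1 0 s y; have := bell_ge0 0 s y.
set b := bell 0 s y in h1 *.
rewrite -[y ^+ _]real_normK ?num_real// in h1.
have := normr_ge0 y; set a := `|y| in h1 *; move=> a0 b0 b1.
have : 0 <= (1 - a) ^+ 2 * b by rewrite mulr_ge0// sqr_ge0.
nra.
Qed.

(** Integration by parts: [y * bell 0 s y] is [- s^2] times the derivative of
    the bell. *)
Lemma stein (g g' : R -> R) (C s : R) : 0 < s ->
  (forall y : R, is_derive y 1 g (g' y)) -> continuous g' ->
  (forall y, `|g y| <= C * (1 + `|y|)) ->
  (forall y, `|g' y| <= C) ->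
  \int[mu]_y (y * g y * bell 0 s y) = s ^+ 2 * \int[mu]_y (g' y * bell 0 s y).
Proof.
move=> s0 gg' cg' gC g'C.
have C0 : 0 <= C by have := g'C 0; exact: le_trans.
have cg : continuous g.
  by move=> y; apply: differentiable_continuous; apply/derivable1_diffP.
have mg : measurable_fun setT g by apply: continuous_measurable_fun.
have mg' : measurable_fun setT g' by apply: continuous_measurable_fun.
have i1 : mu.-integrable setT (EFin \o (fun y => g' y * bell 0 s y)).
  apply: (@integrable_Mbell _ _ C) => // y.
  by rewrite (le_trans (g'C y))// ler_peMr// lerDl sqr_ge0.
have i2 : mu.-integrable setT (EFin \o (fun y => y * g y * bell 0 s y)).
  apply: (@integrable_Mbell _ _ (2 * C)) => //.
    by apply: measurable_funM.
  move=> y; rewrite normrM.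
  apply: (@le_trans _ _ (`|y| * (C * (1 + `|y|)))); first by rewrite ler_wpM2l.
  rewrite -(real_normK (num_real y)).
  have := normr_ge0 y; set a := `|y|; move=> a0.
  have : 0 <= C * (1 - a) ^+ 2 by rewrite mulr_ge0 ?sqr_ge0.
  nra.
have vanish (z : nat -> R) : (forall n, `|z n| = n%:R) ->
    g (z n) * bell 0 s (z n) @[n --> \oo] --> (0 : R).
  move=> zn; apply: norm_cvg0.
  set K := 2 + 8 * s ^+ 2.
  apply: (@squeeze_cvgr _ _ _ _ (cst 0) (fun n => C * K * harmonic n)).
  - apply: nearW => n; rewrite normr_ge0/= normrM (ger0_norm (bell_ge0 _ _ _)).
    apply: (@le_trans _ _ (C * (1 + `|z n|) * bell 0 s (z n))).
      by rewrite ler_wpM2r ?bell_ge0.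
    rewrite -2!mulrA ler_wpM2l// (le_trans (bell_decay _ s0))//.
    by rewrite zn nat1r.
  - exact: cvg_cst.
  - rewrite -(mulr0 (C * K)); apply: cvgM; first exact: cvg_cst.
    exact: cvg_harmonic.
have s2 : s ^+ 2 != 0 by rewrite gt_eqF// exprn_gt0.
have i3 : mu.-integrable setT (EFin \o (fun y => s ^- 2 * (y * g y * bell 0 s y))).
  by rewrite /comp; under eq_fun do rewrite EFinM; apply: integrableZl.
have : \int[mu]_y (g' y * bell 0 s y - s ^- 2 * (y * g y * bell 0 s y)) = 0.
  apply: (@integral_derivative_eq0 (fun y => g y * bell 0 s y)).
  - move=> y; have := is_derive_bell y (negbT (gt_eqF s0)).
    move=> h; apply: is_derive_eq; rewrite /GRing.scale/=.
    by field; rewrite gt_eqF.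
  - move=> y; apply: (@cvgB _ R^o).
      by apply: cvgM; [exact: cg'|exact: continuous_bell].
    apply: cvgM; first exact: cvg_cst.
    apply: cvgM; last exact: continuous_bell.
    by apply: cvgM; [exact: cvg_id|exact: cg].
  - rewrite /comp; under eq_fun do rewrite EFinB; exact: integrableB.
  - exact: (vanish (fun n => n%:R) (fun n => normr_nat _ n)).
  - by apply: (vanish (fun n => - n%:R)) => n; rewrite normrN normr_nat.
rewrite RintegralB// RintegralZl// => /eqP; rewrite subr_eq0 => /eqP ->.
by rewrite mulVKf.
Qed.

Lemma Rintegral_sqr_bell (s : R) : 0 < s ->
  \int[mu]_y (y ^+ 2 * bell 0 s y) = s ^+ 2 * bell_mass s.
Proof.
move=> s0.
transitivity (\int[mu]_y (y * id y * bell 0 s y)).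
  by under eq_Rintegral do rewrite expr2.
rewrite (@stein id (cst 1) 1 s s0).
- by under eq_Rintegral do rewrite mul1r; rewrite Rintegral_bell.
- by move=> y; exact: cvg_cst.
- by move=> y; rewrite mul1r lerDr.
- by move=> y /=; rewrite normr1.
Qed.

(** As a function [F] of the frequency, the integral solves the differential
    equation [F' z = - s^2 z F z]: differentiate under the integral sign and
    apply [stein] to the sine that appears. *)
Lemma Rintegral_cos_bell (s e d : R) : 0 < s ->
  \int[mu]_y (cos (e * y + d) * bell 0 s y) =
  cos d * expR (- (s ^+ 2 * e ^+ 2) / 2) * bell_mass s.
Proof.
move=> s0.
have ccos (z : R) : continuous (fun y : R => cos (z * y + d)).
  move=> y; apply: (@continuous_comp _ _ _ (fun y => z * y + d) cos).
    apply: (@cvgD _ R^o); last exact: cvg_cst.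
    by apply: cvgM; [exact: cvg_cst|exact: cvg_id].
  exact: continuous_cos.
have csin (z : R) : continuous (fun y : R => sin (z * y + d)).
  move=> y; apply: (@continuous_comp _ _ _ (fun y => z * y + d) sin).
    apply: (@cvgD _ R^o); last exact: cvg_cst.
    by apply: cvgM; [exact: cvg_cst|exact: cvg_id].
  exact: continuous_sin.
pose F (z : R) := \int[mu]_y (cos (z * y + d) * bell 0 s y).
have dF (z : R) : is_derive z 1 F (- (s ^+ 2 * z) * F z).
  have Dcos (x y : R) : is_derive x 1 (fun x => cos (x * y + d) * bell 0 s y)
      (- (y * sin (x * y + d)) * bell 0 s y).
    by apply: is_derive_eq; rewrite /GRing.scale/=; ring.
  have int1 (x : R) : mu.-integrable setT (EFin \o (fun y => cos (x * y + d) * bell 0 s y)).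
    apply: (@integrable_Mbell _ _ 1) => //.
      by apply: continuous_measurable_fun; exact: ccos.
    move=> y; rewrite mul1r (@le_trans _ _ 1)//; last by rewrite lerDl sqr_ge0.
    by rewrite ler_norml cos_geN1 cos_le1.
  have intG : mu.-integrable setT (EFin \o (fun y => `|y| * bell 0 s y)).
    apply: (@integrable_Mbell _ _ 1) => //.
    move=> y; rewrite mul1r normr_id -(real_normK (num_real y)).
    by have := sqr_ge0 (1 - `|y|); have := normr_ge0 y; nra.
  have Gub (x y : R) : `|partial1of2 (fun x y => cos (x * y + d) * bell 0 s y) x y|
      <= `|y| * bell 0 s y.
    rewrite partial1of2E (@derive_val _ _ _ _ _ _ _ (Dcos x y)).
    rewrite normrM (ger0_norm (bell_ge0 _ _ _)) ler_wpM2r ?bell_ge0//.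
    by rewrite normrN normrM ler_piMr// ler_norml sin_geN1 sin_le1.
  have G_ge0 (y : R) : 0 <= `|y| * bell 0 s y by rewrite mulr_ge0 ?bell_ge0.
  have zI : `]z - 1, z + 1[%classic z by rewrite /= in_itv/=; lra.
  apply: DeriveDef.
    apply: (@derivable_under_integral _ _ _ mu
      (fun x y => cos (x * y + d) * bell 0 s y) _ measurableT _ _ _ zI
      _ _ (fun y => `|y| * bell 0 s y)) => //.
  rewrite -derive1E (@differentiation_under_integral _ _ _ mu
      (fun x y => cos (x * y + d) * bell 0 s y) _ measurableT _ _ _ zI
      _ _ (fun y => `|y| * bell 0 s y)) //.
  under eq_Rintegral => y _.
    rewrite partial1of2E (@derive_val _ _ _ _ _ _ _ (Dcos z y)).
    over.
  have isin : mu.-integrable setT (EFin \o (fun y => y * sin (z * y + d) * bell 0 s y)).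
    apply: ler_integrable intG.
      apply: measurable_funM; last exact: measurable_bell.
      by apply: measurable_funM => //; apply: continuous_measurable_fun; exact: csin.
    move=> y; rewrite normrM (ger0_norm (bell_ge0 _ _ _)) ler_wpM2r ?bell_ge0//.
    by rewrite normrM ler_piMr// ler_norml sin_geN1 sin_le1.
  transitivity (- \int[mu]_y (y * sin (z * y + d) * bell 0 s y)).
    rewrite -[RHS]mulN1r -RintegralZl//; apply: eq_Rintegral => y _.
    by rewrite mulNr -mulN1r.
  have Dsin (y : R) : is_derive y 1 (fun y => sin (z * y + d)) (z * cos (z * y + d)).
    apply: is_derive_eq; rewrite /GRing.scale/=.
    by rewrite addr0 mulr1 mulrC.
  rewrite (@stein (fun y => sin (z * y + d)) (fun y => z * cos (z * y + d))
     (1 + `|z|) s s0 Dsin).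
  - rewrite mulNr -[in RHS]mulrA; congr (- (_ * _)).
    rewrite /F -RintegralZl//; apply: eq_Rintegral => y _.
    by rewrite mulrA.
  - by move=> y; apply: cvgM; [exact: cvg_cst|exact: ccos].
  - move=> y; apply: (@le_trans _ _ 1); first by rewrite ler_norml sin_geN1 sin_le1.
    by rewrite -[leLHS]mulr1 ler_pM// lerDl.
  - move=> y; rewrite normrM; apply: (@le_trans _ _ `|z|); last by rewrite lerDr.
    by rewrite ler_piMr// ler_norml cos_geN1 cos_le1.
(* The quotient of [F] by the expected solution has zero derivative. *)
pose H (z : R) := F z * expR (s ^+ 2 * z ^+ 2 / 2).
have dH (z : R) : is_derive z 1 H 0.
  have dFz := dF z; apply: is_derive_eq; rewrite /GRing.scale/=.
  by rewrite !mulr0 add0r !mulr1; field.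
have := is_derive_0_is_cst e 0 dH; rewrite /H.
rewrite expr0n /= mulr0 mul0r expR0 mulr1 => FE.
have F0 : F 0 = cos d * bell_mass s.
  rewrite /F; under eq_Rintegral do rewrite mul0r add0r.
  rewrite RintegralZl ?Rintegral_bell//; exact: integrable_bell.
rewrite -/(F e) mulrAC -F0 -FE -[RHS]mulrA -expRD.
by rewrite mulNr subrr expR0 mulr1.
Qed.

End calculus.

(** * Gaussian laws *)

Section law.
Context {R : realType}.
Notation mu := (@lebesgue_measure R).

(** [normal_pdf] is a version of the Radon-Nikodym derivative of [normal_prob]
    with respect to Lebesgue measure. *)
Lemma ge0_integral_normal_prob (s : R) (f : R -> R) :
  measurable_fun setT f -> (forall y, 0 <= f y) ->
  (\int[normal_prob 0 s]_y (f y)%:E = \int[mu]_y (f y * normal_pdf 0 s y)%:E)%E.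
Proof.
move=> mf f0.
have dom := normal_prob_dominates (0 : R) s.
rewrite -(Radon_Nikodym_SigmaFinite.change_of_variables dom)//; last exact/measurable_EFinP.
have mf' : measurable_fun setT (fun y : measurableTypeR R => (f y)%:E) by exact/measurable_EFinP.
apply: ae_eq_integral => //.
- apply: emeasurable_funM => //.
  exact: measurable_int (Radon_Nikodym_SigmaFinite.f_integrable dom).
- apply/measurable_EFinP; apply: measurable_funM => //.
  exact: measurable_normal_pdf.
apply: (@ae_eqe_mul2l _ _ _ _ _ _ (fun y : measurableTypeR R => (normal_pdf 0 s y)%:E) (fun y : measurableTypeR R => (f y)%:E)).
apply: integral_ae_eq => //.
- exact: Radon_Nikodym_SigmaFinite.f_integrable.
- by apply/measurable_EFinP; exact: measurable_normal_pdf.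
- by move=> E _ mE; rewrite -Radon_Nikodym_SigmaFinite.f_integral.
Qed.

Context d (T : measurableType d) (P : probability T R).

(** The law is given through the integrals of functions of [X], with the
    variance [v] as parameter; the variance 0 is the point mass at 0. *)
Definition gaussian (X : T -> R) (v : R) := [/\ measurable_fun setT X, 0 <= v &
  forall f : R -> R, measurable_fun setT f ->
  (\int[P]_w (f (X w))%:E =
   if v == 0%R then (f 0%R)%:E
   else \int[mu]_y (f y * normal_pdf 0 (Num.sqrt v) y)%:E)%E].

Lemma ge0_integral_law (X : T -> measurableTypeR R)
    (nu : {measure set (measurableTypeR R) -> \bar R})
    (f : measurableTypeR R -> R) : measurable_fun setT X ->
  (forall B : set (measurableTypeR R), measurable B -> P (X @^-1` B) = nu B) ->
  measurable_fun setT f -> (forall y, 0 <= f y) ->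
  (\int[P]_w (f (X w))%:E = \int[nu]_y (f y)%:E)%E.
Proof.
move=> mX law mf f0.
pose m1 : {measure set (measurableTypeR R) -> \bar R} :=
  measure_function_pushforward__canonical__measure_function_Measure P mX.
transitivity (\int[m1]_y (f y)%:E)%E.
  rewrite (ge0_integral_pushforward mX) //.
  - exact/measurable_EFinP.
  - by move=> y _; rewrite lee_fin.
apply: (@eq_measure_integral _ _ _ setT nu m1) => B mB _.
exact: law.
Qed.

(** Both sides are differences of integrals of positive and negative parts, and
    for nonnegative functions this is transport of the measure. *)
Lemma gaussian_of_law (X : T -> R) (s : R) :
  measurable_fun setT X -> 0 <= s ->
  (forall B : set (measurableTypeR R), measurable B ->
    P (X @^-1` B) = if s == 0 then \d_(0 : R) B else normal_prob 0 s B) ->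
  gaussian X (s ^+ 2).
Proof.
move=> mX s0 law; split=> //; first exact: sqr_ge0.
move=> f mf; rewrite sqrf_eq0 sqrtr_sqr ger0_norm//.
pose fp (y : R) := Num.max (f y) 0; pose fn (y : R) := Num.max (- f y) 0.
have mfp : measurable_fun setT fp by apply: measurable_maxr.
have mfn : measurable_fun setT fn by apply: measurable_maxr => //; exact: measurableT_comp.
have fp0 y : 0 <= fp y by rewrite le_max lexx orbT.
have fn0 y : 0 <= fn y by rewrite le_max lexx orbT.
have fE y : f y = fp y - fn y.
  rewrite /fp /fn; case: (leP (f y) 0) => h.
    by rewrite max_l ?oppr_ge0// sub0r opprK.
  by rewrite max_r ?oppr_le0 ?ltW// subr0.
rewrite integralE.
have posE (g : T -> R) : ((fun w => (g w)%:E)^\+ = (fun w => (Num.max (g w) 0)%:E))%E.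
  by apply/funext => w; rewrite funeposE -EFin_max.
have negE (g : T -> R) : ((fun w => (g w)%:E)^\- = (fun w => (Num.max (- g w) 0)%:E))%E.
  by apply/funext => w; rewrite funenegE -EFinN -EFin_max.
rewrite posE negE.
case: eqVneq => [s00|sn0].
  have law0 B : measurable B -> P (X @^-1` B) = \d_(0 : measurableTypeR R) B.
    by move=> mB; rewrite law// s00 eqxx.
  rewrite (ge0_integral_law mX law0 mfp fp0) (ge0_integral_law mX law0 mfn fn0).
  rewrite !integral_dirac ?diracT ?mul1e//; last 2 first.
    exact/measurable_EFinP.
    exact/measurable_EFinP.
  by rewrite -EFinB -fE.
have law1 B : measurable B -> P (X @^-1` B) = normal_prob 0 s B.
  by move=> mB; rewrite law// (negbTE sn0).
rewrite (ge0_integral_law mX law1 mfp fp0) (ge0_integral_law mX law1 mfn fn0).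
rewrite !ge0_integral_normal_prob//.
rewrite [RHS]integralE; congr (_ - _)%E; apply: eq_integral => y _.
  by rewrite funeposE -EFin_max; congr EFin; rewrite /fp maxr_pMl ?normal_pdf_ge0// mul0r.
rewrite funenegE -EFinN -EFin_max; congr EFin.
by rewrite /fn maxr_pMl ?normal_pdf_ge0// mul0r mulNr.
Qed.

Lemma centered_gaussian_gaussian (X : T -> R) :
  centered_gaussian P X -> exists v, gaussian X v.
Proof.
by move=> [mX [s [s0 law]]]; exists (s ^+ 2); exact: gaussian_of_law.
Qed.

End law.

(** * Bounded functions on probability spaces *)

Section bounded.
Context {R : realType} d (T : measurableType d) (P : probability T R).

Lemma bounded_integrable (f : T -> R) (M : R) :
  measurable_fun setT f -> (forall x, `|f x| <= M) ->
  P.-integrable setT (EFin \o f).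
Proof.
move=> mf fM; apply: (@ler_integrable _ _ _ _ _ (cst M)) => //.
exact: finite_measure_integrable_cst.
Qed.

End bounded.

Section fubini_bounded.
Context {R : realType} d d' (T : measurableType d) (T' : measurableType d')
  (P : probability T R) (Q : probability T' R).

Lemma bounded_product_integrable (f : T * T' -> R) (M : R) :
  measurable_fun setT f -> (forall x, `|f x| <= M) ->
  (P \x Q)%E.-integrable setT (EFin \o f).
Proof.
move=> mf fM; have mf' : measurable_fun setT (EFin \o f) by exact/measurable_EFinP.
apply/integrable12ltyP => //.
apply: (@le_lt_trans _ _ (\int[P]_x \int[Q]_y M%:E)%E); last first.
  under eq_integral do rewrite integral_cst//= probability_setT mule1.
  by rewrite integral_cst//= probability_setT mule1 ltry.
have M0 : 0 <= M by have := fM point; exact: le_trans.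
apply: ge0_le_integral => //.
- by move=> x _; apply: integral_ge0.
- apply: (@measurable_fun_fubini_tonelli_F _ _ _ _ _ Q (fun z => `|(f z)%:E|)%E) => //.
  exact: measurableT_comp.
- move=> x _; apply: ge0_le_integral => //.
    apply: measurableT_comp => //; apply/measurable_EFinP.
    exact: measurableT_comp.
  by move=> y _; rewrite lee_fin.
Qed.

Lemma integrable_Rintegral_section (f : T * T' -> R) (M : R) :
  measurable_fun setT f -> (forall x, `|f x| <= M) ->
  P.-integrable setT (EFin \o (fun x => \int[Q]_y f (x, y))).
Proof.
move=> mf fM; have := integrable_fubini_F (bounded_product_integrable mf fM).
apply: eq_integrable => // x _; rewrite /fubini_F/= /Rintegral fineK//.
apply: integrable_fin_num => //; apply: (@bounded_integrable _ _ _ _ _ M) => //.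
exact: measurableT_comp.
Qed.

End fubini_bounded.

Lemma Fubini_bounded {R : realType} d d' (T : measurableType d) (T' : measurableType d')
    (P : probability T R) (Q : probability T' R) (f : T * T' -> R) (M : R) :
  measurable_fun setT f -> (forall x, `|f x| <= M) ->
  \int[P]_x \int[Q]_y f (x, y) = \int[Q]_y \int[P]_x f (x, y).
Proof.
move=> mf fM.
have if1 x : Q.-integrable setT (EFin \o (fun y => f (x, y))).
  by apply: (@bounded_integrable _ _ _ _ _ M) => //; exact: measurableT_comp.
have if2 y : P.-integrable setT (EFin \o (fun x => f (x, y))).
  by apply: (@bounded_integrable _ _ _ _ _ M) => //; exact: measurableT_comp.
have := Fubini (bounded_product_integrable P Q mf fM) => /= F.
rewrite /Rintegral; congr fine.
under eq_integral => x _ do rewrite fineK ?(integrable_fin_num _ (if1 x))//.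
rewrite F; apply: eq_integral => y _.
by rewrite fineK ?(integrable_fin_num _ (if2 y)).
Qed.

(** * Moments and characteristic function of a Gaussian variable *)

Section gaussian_facts.
Context {R : realType}.
Notation mu := (@lebesgue_measure R).

Section facts.
Context d (T : measurableType d) (P : probability T R).
Variables (X : T -> R) (v : R).
Hypothesis gX : gaussian P X v.

Let pdfE y : v != 0 -> normal_pdf 0 (Num.sqrt v) y = (bell_mass (Num.sqrt v))^-1 * bell 0 (Num.sqrt v) y.
Proof.
by move=> v0; have [_ v_ge0 _] := gX; rewrite normal_pdf_bell// sqrtr_gt0 lt0r v0.
Qed.

Lemma gaussian_Rintegral (f : R -> R) : measurable_fun setT f -> v != 0 ->
  \int[P]_w f (X w) = \int[mu]_y (f y * normal_pdf 0 (Num.sqrt v) y).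
Proof.
by move=> mf v0; have [_ _ XE] := gX; rewrite /Rintegral (XE f)// (negbTE v0).
Qed.

Lemma gaussian_variance : (\int[P]_w (X w ^+ 2)%:E = v%:E)%E.
Proof.
have [mX v_ge0 XE] := gX.
rewrite (XE (fun y => y ^+ 2)); last first.
  by have := @exprn_continuous R 2; exact: continuous_measurable_fun.
case: eqVneq => [->|v0]; first by rewrite expr0n.
have s0 : 0 < Num.sqrt v by rewrite sqrtr_gt0 lt0r v0.
have i2 : mu.-integrable setT (EFin \o (fun y => y ^+ 2 * bell 0 (Num.sqrt v) y)).
  apply: (@integrable_Mbell _ _ 1) => //.
  by move=> y; rewrite mul1r ger0_norm ?sqr_ge0// lerDr.
transitivity (\int[mu]_y ((bell_mass (Num.sqrt v))^-1%:E * (y ^+ 2 * bell 0 (Num.sqrt v) y)%:E))%E.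
  by apply: eq_integral => y _; rewrite pdfE// -EFinM mulrCA.
rewrite integralZl// -[X in (_ * X)%E]fineK; last exact: integrable_fin_num.
have := Rintegral_sqr_bell s0; rewrite /Rintegral => ->.
by rewrite -EFinM mulrCA mulVf ?gt_eqF ?bell_mass_gt0// mulr1 sqr_sqrtr.
Qed.

Lemma gaussian_cos (e c : R) :
  \int[P]_w cos (e * X w + c) = cos c * expR (- (v * e ^+ 2) / 2).
Proof.
have [mX v_ge0 XE] := gX.
have mcos : measurable_fun setT (fun y : R => cos (e * y + c)).
  apply: (@measurableT_comp _ _ _ _ _ _ cos).
    by apply: continuous_measurable_fun; exact: continuous_cos.
  by apply: measurable_funD => //; apply: measurable_funM.
have [v0|v0] := eqVneq v 0.
  rewrite /Rintegral (XE _ mcos) v0 eqxx mulr0 add0r /= mul0r oppr0 mul0r expR0 mulr1//.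
rewrite (gaussian_Rintegral mcos)//.
have s0 : 0 < Num.sqrt v by rewrite sqrtr_gt0 lt0r v0.
have i2 : mu.-integrable setT (EFin \o (fun y => cos (e * y + c) * bell 0 (Num.sqrt v) y)).
  apply: (@integrable_Mbell _ _ 1) => //.
  move=> y; rewrite mul1r (@le_trans _ _ 1)//; last by rewrite lerDl sqr_ge0.
  by rewrite ler_norml cos_geN1 cos_le1.
transitivity (\int[mu]_y ((bell_mass (Num.sqrt v))^-1 * (cos (e * y + c) * bell 0 (Num.sqrt v) y))).
  by apply: eq_Rintegral => y _; rewrite pdfE// mulrCA.
rewrite RintegralZl// Rintegral_cos_bell// sqr_sqrtr// mulrC mulfK//.
by rewrite gt_eqF ?bell_mass_gt0.
Qed.

Lemma gaussian_moment_le (n : nat) :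
  (\int[P]_w (X w ^+ n.*2)%:E <= (n`!%:R * (4 * v) ^+ n * 2)%:E)%E.
Proof.
have [mX v_ge0 XE] := gX.
rewrite (XE (fun y => y ^+ n.*2)); last first.
  by have := @exprn_continuous R n.*2; exact: continuous_measurable_fun.
case: eqVneq => [->|v0].
  rewrite mulr0 lee_fin; case: n => [|n]; last by rewrite doubleS !exprS !(mulr0, mul0r).
  by rewrite double0 !expr0 fact0 !mul1r ler1n.
have s0 : 0 < Num.sqrt v by rewrite sqrtr_gt0 lt0r v0.
have s20 : 0 < Num.sqrt 2 * Num.sqrt v by rewrite mulr_gt0// sqrtr_gt0.
apply: (@le_trans _ _ (\int[mu]_y (((bell_mass (Num.sqrt v))^-1 * (n`!%:R * (4 * v) ^+ n))%:E *
    (bell 0 (Num.sqrt 2 * Num.sqrt v) y)%:E))%E).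
  apply: ge0_le_integral => //.
  - move=> y _; rewrite lee_fin mulr_ge0 ?normal_pdf_ge0//.
    by rewrite -mul2n exprM exprn_ge0 ?sqr_ge0.
  - apply/measurable_EFinP; apply: measurable_funM; last exact: measurable_normal_pdf.
    by have := @exprn_continuous R n.*2; exact: continuous_measurable_fun.
  - under eq_fun do rewrite -EFinM; apply/measurable_EFinP.
    by apply: measurable_funM => //; exact: measurable_bell.
  - move=> y _; rewrite -EFinM lee_fin pdfE// mulrCA -mulrA ler_wpM2l//.
      by rewrite invr_ge0 ltW ?bell_mass_gt0.
    by have := pow_bell_le n y s0; rewrite sqr_sqrtr.
rewrite integralZl//; last exact: integrable_bell.
rewrite integral_bell// -EFinM lee_fin bell_massZ//.
rewrite [leLHS](_ : _ = n`!%:R * (4 * v) ^+ n * Num.sqrt 2); last first.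
  by field; rewrite gt_eqF ?bell_mass_gt0.
rewrite ler_wpM2l//.
  by rewrite mulr_ge0// exprn_ge0// mulr_ge0.
by rewrite -[leRHS]ger0_norm// -sqrtr_sqr ler_wsqrtr// expr2 ler_peMr// ler1n.
Qed.

(** After [pow_bell_ub] has bounded the moment against the density of [X], only
    the mass of the bell of width [r] relative to that of the density remains:
    this is the factor [r / Num.sqrt v]. *)
Lemma gaussian_bell_moment_le (n : nat) (x r : R) : v != 0 -> 0 < r ->
  (\int[P]_w (bell x r (X w) * X w ^+ n.*2)%:E <=
     (n`!%:R * (4 * v) ^+ n * (r / Num.sqrt v))%:E)%E.
Proof.
move=> v0 r0.
have [mX v_ge0 XE] := gX.
have mpow : measurable_fun setT (fun y : R => y ^+ n.*2).
  by have := @exprn_continuous R n.*2; exact: continuous_measurable_fun.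
have mf : measurable_fun setT (fun y => bell x r y * y ^+ n.*2).
  by apply: measurable_funM => //; exact: measurable_bell.
rewrite (XE _ mf) (negbTE v0).
have s0 : 0 < Num.sqrt v by rewrite sqrtr_gt0 lt0r v0.
apply: (@le_trans _ _ (\int[mu]_y (((bell_mass (Num.sqrt v))^-1 * (n`!%:R * (4 * v) ^+ n))%:E *
    (bell x r y)%:E))%E).
  apply: ge0_le_integral => //.
  - move=> y _; rewrite lee_fin mulr_ge0 ?normal_pdf_ge0// mulr_ge0 ?bell_ge0//.
    by rewrite -mul2n exprM exprn_ge0 ?sqr_ge0.
  - by apply/measurable_EFinP; apply: measurable_funM => //; exact: measurable_normal_pdf.
  - under eq_fun do rewrite -EFinM; apply/measurable_EFinP.
    by apply: measurable_funM => //; exact: measurable_bell.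
  - move=> y _; rewrite -EFinM lee_fin pdfE//.
    rewrite [leLHS](_ : _ = (bell_mass (Num.sqrt v))^-1 *
      (y ^+ n.*2 * bell 0 (Num.sqrt v) y) * bell x r y); last by ring.
    rewrite ler_wpM2r ?bell_ge0// ler_wpM2l//.
      by rewrite invr_ge0 ltW ?bell_mass_gt0.
    by have := pow_bell_ub n y s0; rewrite sqr_sqrtr.
rewrite integralZl//; last exact: integrable_bell.
rewrite integral_bell// -EFinM lee_fin.
rewrite (bell_massE (ltW r0)) (bell_massE (ltW s0)) le_eqVlt; apply/orP; left; apply/eqP.
by field; rewrite !gt_eqF ?bell_mass_gt0.
Qed.

End facts.

Lemma gaussian_std : gaussian (normal_prob (0 : R) 1) (fun z : measurableTypeR R => z : R) 1.
Proof.
rewrite -[X in gaussian _ _ X](expr1n _ 2); apply: gaussian_of_law => //.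
by move=> B mB; rewrite oner_eq0.
Qed.

(** A Gaussian is its own Fourier transform, so a bell is an average of
    cosines. *)
Lemma bell_mixture (x r y : R) :
  bell x r y = \int[normal_prob (0 : R) 1]_z cos (z * ((y - x) / r)).
Proof.
have := gaussian_cos gaussian_std ((y - x) / r) 0.
under eq_Rintegral do rewrite addr0 mulrC.
by rewrite cos0 !mul1r.
Qed.

End gaussian_facts.

Lemma integrable_add d (T : measurableType d) (R : realType)
    (m : {measure set T -> \bar R}) (f g : T -> R) :
  m.-integrable setT (EFin \o f) -> m.-integrable setT (EFin \o g) ->
  m.-integrable setT (EFin \o (fun t => f t + g t)).
Proof. by move=> fi gi; rewrite /comp; under eq_fun do rewrite EFinD; exact: integrableD. Qed.

(** * Independence from characteristic functions *)

Section bell_polynomial.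
Context {R : realType}.

Lemma normr_cos_le1 (y : R) : `|cos y| <= 1.
Proof. by rewrite ler_norml cos_geN1 cos_le1. Qed.

Lemma measurable_cosT d (T : measurableType d) (V : T -> R) : measurable_fun setT V ->
  measurable_fun setT (fun w => cos (V w)).
Proof.
move=> mV; apply: (@measurableT_comp _ _ _ _ _ _ cos) => //.
by apply: continuous_measurable_fun; exact: continuous_cos.
Qed.

(** The test functions for which independence is read off characteristic
    functions.  They include the bells, which dominate indicators of intervals,
    and the powers of [1 - bell], which dominate indicators of tails. *)
Inductive bellpoly : (R -> R) -> Prop :=
| bellpoly1 : bellpoly (cst 1)
| bellpolyM f x r : bellpoly f -> bellpoly (fun y => f y * bell x r y)
| bellpolyB f g : bellpoly f -> bellpoly g -> bellpoly (fun y => f y - g y).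

Lemma measurable_bellpoly f : bellpoly f -> measurable_fun setT f.
Proof.
elim=> [|{}f x r _ mf|{}f g _ mf _ mg].
- exact: measurable_cst.
- by apply: measurable_funM => //; exact: measurable_bell.
- exact: measurable_funB.
Qed.

Lemma bounded_bellpoly f : bellpoly f -> exists M, forall y, `|f y| <= M.
Proof.
elim=> [|{}f x r _ [M fM]|{}f g _ [M fM] _ [N gN]].
- by exists 1 => y; rewrite normr1.
- exists M => y; rewrite normrM (ger0_norm (bell_ge0 _ _ _)) (le_trans _ (fM y))//.
  by rewrite ler_piMr ?bell_le1.
- by exists (M + N) => y; rewrite (le_trans (ler_normB _ _))// lerD.
Qed.

Lemma bellpoly_onem_exp f h n : bellpoly f ->
  bellpoly (fun y => f y * (1 - bell 0 h y) ^+ n).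
Proof.
move=> bf; elim: n => [|n IH].
  by rewrite (_ : (fun y => _) = f)//; apply/funext => y; rewrite expr0 mulr1.
have := bellpolyB IH (bellpolyM 0 h IH).
by congr (bellpoly _); apply/funext => y; rewrite exprS; ring.
Qed.

Context d (T : measurableType d) (P : probability T R).

Lemma integral_bell_mixture (w U : T -> R) (M x r : R) :
  measurable_fun setT w -> (forall t, `|w t| <= M) -> measurable_fun setT U ->
  \int[P]_t (w t * bell x r (U t)) =
  \int[normal_prob (0 : R) 1]_z \int[P]_t (w t * cos (z * ((U t - x) / r))).
Proof.
move=> mw wM mU.
rewrite -(@Fubini_bounded _ _ _ _ _ _ _
  (fun p : T * measurableTypeR R => w p.1 * cos (p.2 * ((U p.1 - x) / r))) M); last 2 first.
- apply: measurable_funM; first exact: measurableT_comp.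
  apply: measurable_cosT; apply: measurable_funM; first exact: measurable_snd.
  apply: measurable_funM => //; apply: measurable_funB => //.
  exact: measurableT_comp.
- by move=> p; rewrite normrM -[leRHS]mulr1 ler_pM// normr_cos_le1.
apply: eq_Rintegral => t _; rewrite bell_mixture -RintegralZl//.
apply: (@bounded_integrable _ _ _ _ _ 1) => [|z]; last exact: normr_cos_le1.
by apply: measurable_cosT; exact: measurable_funM.
Qed.

(** By induction on [f].  A bell is an average of cosines, and the product of two
    cosines is half a sum of cosines, so multiplying by a bell only shifts the
    frequency [a] and the phase [c], for which the factorization is known. *)
Lemma bellpoly_factor (w U Z : T -> R) (M C : R) :
  measurable_fun setT w -> (forall t, `|w t| <= M) ->
  measurable_fun setT U -> measurable_fun setT Z ->
  (forall a c, \int[P]_t (w t * cos (a * U t + Z t + c)) =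
               C * \int[P]_t cos (a * U t + c)) ->
  forall f, bellpoly f -> forall a c,
  \int[P]_t (w t * f (U t) * cos (a * U t + Z t + c)) =
  C * \int[P]_t (f (U t) * cos (a * U t + c)).
Proof.
move=> mw wM mU mZ H f; elim=> {f}[|f x r bf IH|f g bf IHf bg IHg] a c.
- under eq_Rintegral do rewrite mulr1.
  by rewrite H; congr (_ * _); apply: eq_Rintegral => t _; rewrite mul1r.
- have [K fK] := bounded_bellpoly bf.
  have mf := measurable_bellpoly bf.
  have mUc (e : R) : measurable_fun setT (fun t => e * U t) by exact: measurable_funM.
  have m1 (e c' : R) : measurable_fun setT (fun t => cos (e * U t + Z t + c')).
    by apply: measurable_cosT; do 2 apply: measurable_funD => //.
  have m2 (e c' : R) : measurable_fun setT (fun t => cos (e * U t + c')).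
    by apply: measurable_cosT; apply: measurable_funD.
  have mfU : measurable_fun setT (fun t => f (U t)) by exact: measurableT_comp.
  have b1 t : `|w t * f (U t)| <= M * K by rewrite normrM ler_pM.
  have i1 (e c' : R) : P.-integrable setT (EFin \o (fun t => w t * f (U t) * cos (e * U t + Z t + c'))).
    apply: (@bounded_integrable _ _ _ _ _ (M * K)).
      by apply: measurable_funM => //; apply: measurable_funM.
    by move=> t; rewrite normrM -[leRHS]mulr1 ler_pM// normr_cos_le1.
  have i2 (e c' : R) : P.-integrable setT (EFin \o (fun t => f (U t) * cos (e * U t + c'))).
    apply: (@bounded_integrable _ _ _ _ _ K).
      by apply: measurable_funM.
    by move=> t; rewrite normrM -[leRHS]mulr1 ler_pM// normr_cos_le1.
  transitivity (\int[P]_t (w t * f (U t) * cos (a * U t + Z t + c) * bell x r (U t))).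
    by apply: eq_Rintegral => t _; ring.
  rewrite (@integral_bell_mixture _ _ (M * K)) //; last 2 first.
  - by do 2 apply: measurable_funM => //.
  - by move=> t; rewrite normrM -[leRHS]mulr1 ler_pM// normr_cos_le1.
  transitivity (C * \int[P]_t (f (U t) * cos (a * U t + c) * bell x r (U t))); last first.
    by congr (_ * _); apply: eq_Rintegral => t _; ring.
  rewrite (@integral_bell_mixture _ _ K) //; last 2 first.
  - by apply: measurable_funM => //.
  - by move=> t; rewrite normrM -[leRHS]mulr1 ler_pM// normr_cos_le1.
  rewrite -RintegralZl//; last first.
    apply: (@integrable_Rintegral_section _ _ _ (measurableTypeR R) _ _ _
      (fun p : measurableTypeR R * T => f (U p.2) * cos (a * U p.2 + c) *
         cos (p.1 * ((U p.2 - x) / r))) K).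
      apply: measurable_funM; last first.
        apply: measurable_cosT; apply: measurable_funM; first exact: measurable_fst.
        apply: measurable_funM => //; apply: measurable_funB => //.
        exact: measurableT_comp.
      by apply: measurable_funM; [exact: (measurableT_comp mfU)|exact: (measurableT_comp (m2 _ _))].
    move=> p; rewrite -[leRHS]mulr1 normrM ler_pM ?normr_cos_le1//.
    by rewrite normrM -[leRHS]mulr1 ler_pM ?normr_cos_le1.
  apply: eq_Rintegral => z _.
  have cosM (p q : R) : cos p * cos q = 2^-1 * (cos (p + q) + cos (p - q)).
    by rewrite cosD cosB; field.
  transitivity (\int[P]_t (2^-1 * (w t * f (U t) * cos ((a + z / r) * U t + Z t + (c - z * x / r)) +
                  w t * f (U t) * cos ((a - z / r) * U t + Z t + (c + z * x / r))))).
    apply: eq_Rintegral => t _; rewrite -mulrA cosM; rewrite mulrCA -mulrDr.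
    by congr (_ * (_ * (cos _ + cos _))); ring.
  rewrite RintegralZl ?RintegralD//; last exact: integrable_add.
  rewrite !IH -mulrDr mulrCA; congr (_ * _).
  transitivity (\int[P]_t (2^-1 * (f (U t) * cos ((a + z / r) * U t + (c - z * x / r)) +
                  f (U t) * cos ((a - z / r) * U t + (c + z * x / r))))).
    by rewrite RintegralZl ?RintegralD//; exact: integrable_add.
  apply: eq_Rintegral => t _; rewrite -[RHS]mulrA cosM [RHS]mulrCA -mulrDr.
  by congr (_ * (_ * (cos _ + cos _))); ring.
- have [K fK] := bounded_bellpoly bf.
  have [L gL] := bounded_bellpoly bg.
  have mU' (h : R -> R) : bellpoly h -> measurable_fun setT (fun t => h (U t)).
    by move=> bh; apply: measurableT_comp => //; exact: measurable_bellpoly.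
  have m1 : measurable_fun setT (fun t => cos (a * U t + Z t + c)).
    by apply: measurable_cosT; do 2 apply: measurable_funD => //; exact: measurable_funM.
  have m2 : measurable_fun setT (fun t => cos (a * U t + c)).
    by apply: measurable_cosT; apply: measurable_funD => //; exact: measurable_funM.
  have i1 h N : bellpoly h -> (forall y, `|h y| <= N) ->
      P.-integrable setT (EFin \o (fun t => w t * h (U t) * cos (a * U t + Z t + c))).
    move=> bh hN; apply: (@bounded_integrable _ _ _ _ _ (M * N)).
      by do 2 apply: measurable_funM => //; exact: mU'.
    by move=> t; rewrite normrM -[leRHS]mulr1 ler_pM ?normr_cos_le1// normrM ler_pM.
  have i2 h N : bellpoly h -> (forall y, `|h y| <= N) ->
      P.-integrable setT (EFin \o (fun t => h (U t) * cos (a * U t + c))).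
    move=> bh hN; apply: (@bounded_integrable _ _ _ _ _ N).
      by apply: measurable_funM => //; exact: mU'.
    by move=> t; rewrite normrM -[leRHS]mulr1 ler_pM ?normr_cos_le1.
  transitivity (\int[P]_t (w t * f (U t) * cos (a * U t + Z t + c) -
      w t * g (U t) * cos (a * U t + Z t + c))).
    by apply: eq_Rintegral => t _; rewrite /= mulrBr mulrBl.
  rewrite RintegralB//; [|exact: (i1 f K)|exact: (i1 g L)].
  rewrite IHf IHg -mulrBr -RintegralB//; [|exact: (i2 f K)|exact: (i2 g L)].
  by congr (_ * _); apply: eq_Rintegral => t _; rewrite /= mulrBl.
Qed.

End bell_polynomial.

Section independence.
Context {R : realType} d (T : measurableType d) (P : probability T R).
Variables (n : nat) (X : 'I_n -> T -> R) (v : 'I_n -> R).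
Hypothesis mX : forall i, measurable_fun setT (X i).
Hypothesis cosX : forall (a : 'I_n -> R) (c : R),
  \int[P]_t cos (\sum_(i < n) a i * X i t + c) =
  cos c * expR (- (\sum_(i < n) a i ^+ 2 * v i) / 2).

Lemma measurable_lincomb (a : 'I_n -> R) :
  measurable_fun setT (fun t => \sum_(i < n) a i * X i t).
Proof. by apply: measurable_sum => i; apply: measurable_funM. Qed.

(** The variables are detached one at a time: those of index below [m] appear
    through test functions, the others still through the characteristic
    function.  The step from [m] to [m.+1] is [bellpoly_factor], with the test
    functions already present as weight. *)
Lemma bellpoly_partial_independent (f : 'I_n -> R -> R) : (forall i, bellpoly (f i)) ->
  forall m, (m <= n)%N -> forall (a : 'I_n -> R) (c : R),
  (forall i : 'I_n, (i < m)%N -> a i = 0) ->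
  \int[P]_t (\prod_(i < n | (i < m)%N) f i (X i t) *
             cos (\sum_(i < n) a i * X i t + c)) =
  (\prod_(i < n | (i < m)%N) \int[P]_t f i (X i t)) *
  (cos c * expR (- (\sum_(i < n) a i ^+ 2 * v i) / 2)).
Proof.
move=> bf; elim=> [_ a c _|m IH mn a c a0].
  under eq_Rintegral do rewrite [X in X * _]big_pred0 ?mul1r//.
  by rewrite cosX [X in _ = X * _]big_pred0 ?mul1r//.
pose i0 := Ordinal mn.
have bigi0 (F : 'I_n -> R) : \prod_(i < n | (i < m.+1)%N) F i =
    F i0 * \prod_(i < n | (i < m)%N) F i.
  rewrite (bigD1 i0)//=; congr (_ * _); apply: eq_bigl => i.
  by rewrite ltnS ltn_neqAle andbC.
have [M wM] : exists M, forall t, `|\prod_(i < n | (i < m)%N) f i (X i t)| <= M.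
  have /choice [M fM] : forall i, exists M, forall y, `|f i y| <= M.
    by move=> i; exact: bounded_bellpoly.
  exists (\prod_(i < n | (i < m)%N) M i) => t.
  by rewrite normr_prod ler_prod// => i _; rewrite normr_ge0 fM.
have mw : measurable_fun setT (fun t => \prod_(i < n | (i < m)%N) f i (X i t)).
  under eq_fun do rewrite big_mkcond.
  apply: measurable_prod => i _; case: (i < m)%N; last exact: measurable_cst.
  by apply: measurableT_comp => //; exact: measurable_bellpoly.
(* The coefficient of the variable to be detached is free to vary. *)
pose upd b (i : 'I_n) := if i == i0 then b else a i.
have updE b t : \sum_(i < n) upd b i * X i t = b * X i0 t + \sum_(i < n) a i * X i t.
  rewrite (bigD1 i0)//= [in RHS](bigD1 i0)//= {1}/upd eqxx a0//= mul0r add0r.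
  by congr (_ + _); apply: eq_bigr => i ii0; rewrite /upd (negbTE ii0).
have updV b : \sum_(i < n) upd b i ^+ 2 * v i =
    b ^+ 2 * v i0 + \sum_(i < n) a i ^+ 2 * v i.
  rewrite (bigD1 i0)//= [in RHS](bigD1 i0)//= {1}/upd eqxx a0//= expr0n mul0r add0r.
  by congr (_ + _); apply: eq_bigr => i ii0; rewrite /upd (negbTE ii0).
have cosi0 b c' : \int[P]_t cos (b * X i0 t + c') = cos c' * expR (- (b ^+ 2 * v i0) / 2).
  have := cosX (fun i => if i == i0 then b else 0) c'.
  under eq_Rintegral => t _.
    rewrite (bigD1 i0)//= eqxx big1 ?addr0; last first.
      by move=> i /negbTE ->; rewrite mul0r.
    over.
  rewrite (bigD1 i0)//= eqxx big1 ?addr0// => i /negbTE ->.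
  by rewrite expr0n mul0r.
set W := \prod_(i < n | (i < m)%N) \int[P]_t f i (X i t).
have fac := @bellpoly_factor R _ T P
  (fun t => \prod_(i < n | (i < m)%N) f i (X i t)) (X i0)
  (fun t => \sum_(i < n) a i * X i t) M
  (W * expR (- (\sum_(i < n) a i ^+ 2 * v i) / 2)) mw wM (mX i0) (measurable_lincomb a).
have H b c' : \int[P]_t (\prod_(i < n | (i < m)%N) f i (X i t) *
      cos (b * X i0 t + \sum_(i < n) a i * X i t + c')) =
    W * expR (- (\sum_(i < n) a i ^+ 2 * v i) / 2) * \int[P]_t cos (b * X i0 t + c').
  under eq_Rintegral do rewrite -updE.
  rewrite (IH (ltnW mn)); last first.
    move=> i im; rewrite /upd; case: eqP => [ii|_]; last by rewrite a0// ltnW.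
    by rewrite ii ltnn in im.
  rewrite updV cosi0 -!mulrA; congr (_ * _).
  by rewrite [RHS]mulrCA; congr (_ * _); rewrite -expRD; congr expR; field.
have := fac H (f i0) (bf i0) 0 c.
under eq_Rintegral do rewrite mul0r add0r.
move=> E; rewrite bigi0; transitivity (\int[P]_t (\prod_(i < n | (i < m)%N) f i (X i t) *
  f i0 (X i0 t) * cos (\sum_(i < n) a i * X i t + c))).
  by apply: eq_Rintegral => t _; rewrite bigi0 (mulrC (f i0 _)).
rewrite E; under eq_Rintegral do rewrite mul0r add0r.
rewrite RintegralZr//; last first.
  have [K fK] := bounded_bellpoly (bf i0).
  apply: (@bounded_integrable _ _ _ _ _ K) => //.
  by apply: measurableT_comp => //; exact: measurable_bellpoly.
by rewrite -/W; ring.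
Qed.

Lemma bellpoly_independent (f : 'I_n -> R -> R) : (forall i, bellpoly (f i)) ->
  \int[P]_t (\prod_(i < n) f i (X i t)) = \prod_(i < n) \int[P]_t f i (X i t).
Proof.
move=> bf; have := @bellpoly_partial_independent f bf n (leqnn n) (fun=> 0) 0 (fun _ _ => erefl).
rewrite cos0 mul1r [X in expR (- X / 2)]big1 => [|i _]; last by rewrite expr0n mul0r.
rewrite oppr0 mul0r expR0 mulr1.
have bigE (F : 'I_n -> R) : \prod_(i < n | (i < n)%N) F i = \prod_(i < n) F i.
  by apply: eq_bigl => i; rewrite ltn_ord.
rewrite bigE => <-; apply: eq_Rintegral => t _.
rewrite [X in cos (X + _)]big1 => [|i _]; last by rewrite mul0r.
by rewrite addr0 cos0 mulr1 bigE.
Qed.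

End independence.

(** * Tails and a product form of Markov's inequality *)

Section gaussian_tails.
Context {R : realType} d (T : measurableType d) (P : probability T R).

Lemma onem_bell_ge0 (h y : R) : 0 <= 1 - bell 0 h y.
Proof. by rewrite subr_ge0 bell_le1. Qed.

Lemma onem_bell_le (h y : R) : 1 - bell 0 h y <= y ^+ 2 / (2 * h ^+ 2).
Proof.
rewrite lerBlDl -lerBlDr /bell subr0 (le_trans _ (expR_ge1Dx _))//.
rewrite lerD2l le_eqVlt; apply/orP; left; apply/eqP.
by rewrite mulNr expr_div_n invfM; congr (- _); rewrite mulrA mulrAC.
Qed.

Lemma onem_bell_exp_le (n : nat) (h y : R) :
  (1 - bell 0 h y) ^+ n <= (2 * h ^+ 2) ^- n * y ^+ n.*2.
Proof.
rewrite -mul2n exprM mulrC -exprVn -exprMn lerXn2r ?nnegrE ?onem_bell_ge0//.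
  by rewrite mulr_ge0 ?sqr_ge0// invr_ge0 mulr_ge0// sqr_ge0.
exact: onem_bell_le.
Qed.

Lemma ge0_Rintegral_le (f : T -> R) (g : T -> R) (B K : R) :
  measurable_fun setT f -> measurable_fun setT g -> 0 <= K ->
  (forall t, 0 <= g t) -> (forall t, 0 <= f t <= K * g t) ->
  (\int[P]_t (g t)%:E <= B%:E)%E -> \int[P]_t f t <= K * B.
Proof.
move=> mf mg K0 g0 fg gB.
have f0 t : 0 <= f t by have /andP[] := fg t.
have le : (\int[P]_t (f t)%:E <= (K * B)%:E)%E.
  apply: (@le_trans _ _ (\int[P]_t (K%:E * (g t)%:E))%E).
    apply: ge0_le_integral => //.
    - by move=> t _; rewrite lee_fin.
    - exact/measurable_EFinP.
    - by under eq_fun do rewrite -EFinM; apply/measurable_EFinP; exact: measurable_funM.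
    - by move=> t _; rewrite -EFinM lee_fin; have /andP[] := fg t.
  rewrite ge0_integralZl_EFin//; last 2 first.
  - by move=> t _; rewrite lee_fin.
  - exact/measurable_EFinP.
  by rewrite EFinM lee_wpmul2l// lee_fin.
rewrite /Rintegral -[leRHS]/(fine (K * B)%:E) fine_le//.
rewrite ge0_fin_numE; first exact: le_lt_trans le (ltry _).
by apply: integral_ge0 => t _; rewrite lee_fin.
Qed.

(** As [1 - bell 0 h y <= y^2 / (2 h^2)], this is a bound on the moment of order
    [n.*2]. *)
Lemma gaussian_tail_le (n : nat) (V : T -> R) (v h : R) : gaussian P V v ->
  \int[P]_t (1 - bell 0 h (V t)) ^+ n <= n`!%:R * (2 * v / h ^+ 2) ^+ n * 2.
Proof.
move=> gV; have [mV v0 _] := gV.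
have := gaussian_moment_le gV n => H.
rewrite (le_trans (ge0_Rintegral_le (K := (2 * h ^+ 2) ^- n) (g := fun t => V t ^+ n.*2) _ _ _ _ _ H))//.
- by apply: measurable_funX; apply: measurable_funB => //; apply: measurableT_comp => //; exact: measurable_bell.
- exact: measurable_funX.
- by rewrite invr_ge0 exprn_ge0// mulr_ge0// sqr_ge0.
- by move=> t; rewrite -mul2n exprM exprn_ge0// sqr_ge0.
- by move=> t; rewrite exprn_ge0 ?onem_bell_ge0//= onem_bell_exp_le.
rewrite le_eqVlt; apply/orP; left; apply/eqP.
rewrite (_ : 2 * v / h ^+ 2 = 4 * v * (2 * h ^+ 2)^-1) ; last first.
  have [->|h0] := eqVneq h 0; first by rewrite expr0n mulr0 invr0 !mulr0.
  by field.
by rewrite [X in _ = _ * X * _]exprMn exprVn; ring.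
Qed.

Lemma gaussian_bell_tail_le (n : nat) (X : T -> R) (v x r h : R) : gaussian P X v ->
  0 < v -> 0 < r ->
  \int[P]_t (bell x r (X t) * (1 - bell 0 h (X t)) ^+ n) <=
  n`!%:R * (2 * v / h ^+ 2) ^+ n * (r / Num.sqrt v).
Proof.
move=> gX v0 r0; have [mX _ _] := gX.
have := gaussian_bell_moment_le gX n x (negbT (gt_eqF v0)) r0 => H.
have mb y s : measurable_fun setT (fun t => bell y s (X t)).
  by apply: measurableT_comp => //; exact: measurable_bell.
rewrite (le_trans (ge0_Rintegral_le (K := (2 * h ^+ 2) ^- n)
   (g := fun t => bell x r (X t) * X t ^+ n.*2) _ _ _ _ _ H))//.
- by apply: measurable_funM => //; apply: measurable_funX; exact: measurable_funB.
- by apply: measurable_funM => //; exact: measurable_funX.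
- by rewrite invr_ge0 exprn_ge0// mulr_ge0// sqr_ge0.
- by move=> t; rewrite mulr_ge0 ?bell_ge0// -mul2n exprM exprn_ge0// sqr_ge0.
- move=> t; rewrite mulr_ge0 ?bell_ge0 ?exprn_ge0 ?onem_bell_ge0//=.
  by rewrite mulrCA ler_wpM2l ?bell_ge0// onem_bell_exp_le.
rewrite le_eqVlt; apply/orP; left; apply/eqP.
rewrite (_ : 2 * v / h ^+ 2 = 4 * v * (2 * h ^+ 2)^-1) ; last first.
  have [->|h0] := eqVneq h 0; first by rewrite expr0n mulr0 invr0 !mulr0.
  by field.
by rewrite [X in _ = _ * X * _]exprMn exprVn; ring.
Qed.

Lemma gaussian_bell_le (X : T -> R) (v x r : R) : gaussian P X v ->
  0 < v -> 0 < r -> \int[P]_t bell x r (X t) <= r / Num.sqrt v.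
Proof.
move=> gX v0 r0; have := gaussian_bell_tail_le 0 x 0 gX v0 r0.
rewrite expr0 fact0 !mul1r; apply: le_trans.
by rewrite le_eqVlt; apply/orP; left; apply/eqP; apply: eq_Rintegral => t _; rewrite expr0 mulr1.
Qed.

Lemma markov_mu_ext (E : set T) (F : T -> R) (c B : R) :
  measurable_fun setT F -> (forall t, 0 <= F t <= B) -> 0 < c ->
  (forall t, E t -> c <= F t) ->
  (mu_ext P E <= (\int[P]_t F t / c)%:E)%E.
Proof.
move=> mF FB c0 EF; pose E' := [set t | c <= F t].
have mE' : measurable E'.
  by rewrite -[E']setTI; apply: measurable_fun_le => //; exact: measurable_cst.
have iF : P.-integrable setT (EFin \o F).
  apply: (@bounded_integrable _ _ _ _ _ B) => // t.
  by have /andP[F0 FB'] := FB t; rewrite ger0_norm.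
apply: (@le_trans _ _ (mu_ext P E')); first exact: le_mu_ext.
have PE : P E' = (fine (P E'))%:E by rewrite fineK ?fin_num_measure.
rewrite measurable_mu_extE// [X in (X <= _)%E]PE mulrC.
rewrite lee_fin ler_pdivlMl//.
have -> : fine (P E') = \int[P]_t \1_E' t.
  by rewrite /Rintegral integral_indic// setIT.
rewrite -RintegralZl//; last exact: integrable_indic.
apply: le_Rintegral => //.
  apply: (@bounded_integrable _ _ _ _ _ c).
    by apply: measurable_funM => //; exact: measurable_indic.
  by move=> t; rewrite indicE normrM (gtr0_norm c0) ler_piMr ?(ltW c0)//; case: (_ \in _); rewrite ?normr0 ?normr1.
move=> t _; have /andP[F0 _] := FB t; rewrite indicE.
have [tE|tE] := boolP (t \in E'); last by rewrite mulr0.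
by rewrite mulr1; rewrite inE in tE.
Qed.

(** Markov's inequality for the product of the [f i (X i)]: orthogonality makes
    the characteristic function split, hence the expectation factors. *)
Lemma prod_markov (n : nat) (X : 'I_n -> T -> R) (v : 'I_n -> R) (f : 'I_n -> R -> R)
   (c B : 'I_n -> R) (E : set T) :
  (forall i, measurable_fun setT (X i)) ->
  (forall (a : 'I_n -> R), gaussian P (fun t => \sum_(i < n) a i * X i t)
     (\sum_(i < n) a i ^+ 2 * v i)) ->
  (forall i, bellpoly (f i)) ->
  (forall i y, 0 <= f i y) -> (forall i, 0 < c i) ->
  (forall t, E t -> forall i, c i <= f i (X i t)) ->
  (forall i, \int[P]_t f i (X i t) <= B i) ->
  (mu_ext P E <= (\prod_(i < n) (B i / c i))%:E)%E.
Proof.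
move=> mX gX bf f0 c0 Ef fB.
have /choice [M fM] : forall i, exists M, forall y, `|f i y| <= M.
  by move=> i; exact: bounded_bellpoly.
have mf i : measurable_fun setT (fun t => f i (X i t)).
  by apply: measurableT_comp => //; exact: measurable_bellpoly.
apply: (le_trans (@markov_mu_ext E (fun t => \prod_(i < n) f i (X i t))
  (\prod_(i < n) c i) (\prod_(i < n) M i) _ _ _ _)).
- exact: measurable_prod.
- move=> t; rewrite prodr_ge0//= ler_prod// => i _; rewrite f0/=.
  by rewrite (le_trans (ler_norm _)).
- by rewrite prodr_gt0.
- by move=> t Et; apply: ler_prod => i _; rewrite ltW//= Ef.
rewrite lee_fin (@bellpoly_independent _ _ _ P _ X v) //; last first.
  move=> a b; have := gaussian_cos (gX a) 1 b.
  by under eq_Rintegral do rewrite mul1r; rewrite expr1n mulr1.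
rewrite -prodf_div; apply: ler_prod => i _; apply/andP; split.
  by rewrite divr_ge0 ?Rintegral_ge0// (ltW (c0 i)).
by rewrite ler_wpM2r ?fB// invr_ge0 (ltW (c0 i)).
Qed.

End gaussian_tails.

(** * Covariances *)

Section inner_product.
Context {R : realType} d (T : measurableType d) (P : probability T R).
Implicit Types X Y Z : T -> R.

Definition sqint X := measurable_fun setT X /\
  P.-integrable setT (EFin \o (fun t => X t ^+ 2)).

Definition ip X Y := \int[P]_t (X t * Y t).

Lemma sqint_integrableM X Y : sqint X -> sqint Y ->
  P.-integrable setT (EFin \o (fun t => X t * Y t)).
Proof.
move=> [mX iX] [mY iY].
apply: (@ler_integrable _ _ _ _ _ (fun t => X t ^+ 2 + Y t ^+ 2)).
- exact: measurable_funM.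
- move=> t; rewrite ler_norml.
  have := sqr_ge0 (X t + Y t); have := sqr_ge0 (X t - Y t).
  have := sqr_ge0 (X t); have := sqr_ge0 (Y t); nra.
- exact: integrable_add.
Qed.

Lemma sqintZ a X : sqint X -> sqint (fun t => a * X t).
Proof.
move=> [mX iX]; split; first exact: measurable_funM.
rewrite /comp; under eq_fun do rewrite exprMn EFinM.
exact: integrableZl.
Qed.

Lemma sqintD X Y : sqint X -> sqint Y -> sqint (fun t => X t + Y t).
Proof.
move=> sX sY; have [mX iX] := sX; have [mY iY] := sY; split; first exact: measurable_funD.
have iXY := sqint_integrableM sX sY.
apply: (@ler_integrable _ _ _ _ _ (fun t => 2 * X t ^+ 2 + 2 * Y t ^+ 2)).
- by apply: measurable_funX; exact: measurable_funD.
- move=> t; rewrite ger0_norm ?sqr_ge0//.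
  have := sqr_ge0 (X t - Y t); nra.
- apply: integrable_add.
    by rewrite /comp; under eq_fun do rewrite EFinM; exact: integrableZl.
  by rewrite /comp; under eq_fun do rewrite EFinM; exact: integrableZl.
Qed.

Lemma sqint0 : sqint (fun=> 0).
Proof.
split; first exact: measurable_cst.
by apply: (@bounded_integrable _ _ _ _ _ 0) => // t; rewrite expr0n normr0.
Qed.

Lemma sqint_sum n (X : 'I_n -> T -> R) :
  (forall i, sqint (X i)) -> sqint (fun t => \sum_(i < n) X i t).
Proof.
elim: n X => [|n IH] X sX.
  by under eq_fun do rewrite big_ord0; exact: sqint0.
under eq_fun do rewrite big_ord_recl; apply: sqintD => //.
by apply: IH.
Qed.

Lemma ipC X Y : ip X Y = ip Y X.
Proof. by apply: eq_Rintegral => t _; rewrite mulrC. Qed.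

Lemma ipDl X Y Z : sqint X -> sqint Y -> sqint Z ->
  ip (fun t => X t + Y t) Z = ip X Z + ip Y Z.
Proof.
move=> sX sY sZ; rewrite /ip -RintegralD//; try exact: sqint_integrableM.
by apply: eq_Rintegral => t _; rewrite mulrDl.
Qed.

Lemma ipZl a X Y : sqint X -> sqint Y -> ip (fun t => a * X t) Y = a * ip X Y.
Proof.
move=> sX sY; rewrite /ip -RintegralZl//; last exact: sqint_integrableM.
by apply: eq_Rintegral => t _; rewrite mulrA.
Qed.

Lemma ipDr X Y Z : sqint X -> sqint Y -> sqint Z ->
  ip Z (fun t => X t + Y t) = ip Z X + ip Z Y.
Proof. by move=> *; rewrite !(ipC Z) ipDl. Qed.

Lemma ipZr a X Y : sqint X -> sqint Y -> ip Y (fun t => a * X t) = a * ip Y X.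
Proof. by move=> *; rewrite !(ipC Y) ipZl. Qed.

Lemma ip0l Y : ip (fun=> 0) Y = 0.
Proof.
rewrite /ip; under eq_Rintegral do rewrite mul0r.
by rewrite Rintegral_cst// mul0r.
Qed.

Lemma ip_suml n (X : 'I_n -> T -> R) Y : (forall i, sqint (X i)) -> sqint Y ->
  ip (fun t => \sum_(i < n) X i t) Y = \sum_(i < n) ip (X i) Y.
Proof.
elim: n X => [|n IH] X sX sY.
  by under [X in ip X _]eq_fun do rewrite big_ord0; rewrite big_ord0 ip0l.
under [X in ip X _]eq_fun do rewrite big_ord_recl.
by rewrite big_ord_recl ipDl// ?IH//; exact: sqint_sum.
Qed.

Lemma gaussian_sqint X v : gaussian P X v -> sqint X.
Proof.
move=> gX; have [mX v0 _] := gX; split => //.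
apply/integrableP; split; first by apply/measurable_EFinP; exact: measurable_funX.
under eq_integral do rewrite /= ger0_norm ?sqr_ge0//.
by rewrite (gaussian_variance gX) ltry.
Qed.

Lemma gaussian_ip X v : gaussian P X v -> ip X X = v.
Proof.
move=> gX; rewrite /ip; under eq_Rintegral do rewrite -expr2.
by rewrite /Rintegral (gaussian_variance gX).
Qed.

Lemma gaussian_ip_eq X v : gaussian P X v -> gaussian P X (ip X X).
Proof. by move=> gX; rewrite (gaussian_ip gX). Qed.

Lemma ip_orthogonal n (X : 'I_n -> T -> R) (v : 'I_n -> R) (a : 'I_n -> R) :
  (forall i, sqint (X i)) -> (forall i j, ip (X i) (X j) = if i == j then v i else 0) ->
  ip (fun t => \sum_(i < n) a i * X i t) (fun t => \sum_(i < n) a i * X i t) =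
  \sum_(i < n) a i ^+ 2 * v i.
Proof.
move=> sX oX; have sZ i : sqint (fun t => a i * X i t) by exact: sqintZ.
rewrite ip_suml//; last exact: sqint_sum.
apply: eq_bigr => i _; rewrite ipC ip_suml// (bigD1 i)//= big1 ?addr0.
  by rewrite ipZl// ipZr// oX eqxx expr2 mulrA.
by move=> j ji; rewrite ipZl// ipZr// oX (negbTE ji) !mulr0.
Qed.

End inner_product.

Lemma ord_cases n (Q : 'I_n.+1 -> Prop) :
  Q ord0 -> (forall j, Q (lift ord0 j)) -> forall i, Q i.
Proof. by move=> Q0 QS i; case: (unliftP ord0 i) => [j ->|->]. Qed.

(** * Being near a point while making a large increment *)

Section pair_bound.
Context {R : realType} d (T : measurableType d) (P : probability T R).

Lemma bellpoly_bell x r : bellpoly (bell x r : R -> R).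
Proof.
have := bellpolyM x r (@bellpoly1 R).
by rewrite (_ : (fun y => _) = bell x r)//; apply/funext => y; rewrite /= mul1r.
Qed.

Lemma bellpoly_onem_bell h N : bellpoly (fun y : R => (1 - bell 0 h y) ^+ N).
Proof.
have := bellpoly_onem_exp h N (@bellpoly1 R).
by rewrite (_ : (fun y => _) = (fun y : R => (1 - bell 0 h y) ^+ N))//;
  apply/funext => y; rewrite /= mul1r.
Qed.

Definition box_const (n : nat) : R := (expR (- 2^-1))^-1 ^+ n.

(** In [gaussian_pair_bound], testing the tails at [h / 2] produces
    [8 = 2 * 2^2] and adding its two cases produces [3 = 2 + 1]. *)
Definition tail_const (N : nat) : R :=
  3 * N`!%:R * 8 ^+ N * (1 - expR (- 2^-1)) ^- N.

Lemma bell_ge (x r y : R) : 0 < r -> `|y - x| <= r -> expR (- 2^-1) <= bell x r y.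
Proof.
move=> r0 yr; rewrite ler_expR mulNr lerN2 ler_pdivrMr// mulVf//.
rewrite -real_normK ?num_real// exprn_ile1// normrM normfV (gtr0_norm r0).
by rewrite ler_pdivrMr ?mul1r.
Qed.

Lemma onem_bell_ge (h y : R) : 0 < h -> h <= `|y| ->
  1 - expR (- 2^-1) <= 1 - bell 0 h y.
Proof.
move=> h0 yh; rewrite lerB// ler_expR mulNr lerN2 ler_pdivlMr// mulVf// subr0.
rewrite -real_normK ?num_real// exprn_ege1// normrM normfV (gtr0_norm h0).
by rewrite ler_pdivlMr ?mul1r.
Qed.

Lemma onem_bell_exp_ge (N : nat) (h y : R) : 0 < h -> h <= `|y| ->
  (1 - expR (- 2^-1)) ^+ N <= (1 - bell 0 h y) ^+ N.
Proof.
move=> h0 hy; apply: lerXn2r; rewrite ?nnegrE.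
- by rewrite subr_ge0 -[leRHS]expR0 ler_expR oppr_le0 invr_ge0.
- exact: onem_bell_ge0.
- exact: onem_bell_ge.
Qed.

Let q_gt0 : (0 : R) < 1 - expR (- 2^-1).
Proof. by rewrite subr_gt0 expR_lt1 oppr_lt0 invr_gt0. Qed.

Lemma sum_delta (n : nat) (X : 'I_n -> T -> R) (i : 'I_n) :
  (fun t => \sum_(j < n) (if j == i then 1 else 0) * X j t) = X i.
Proof.
apply/funext => t; rewrite (bigD1 i)//= eqxx mul1r big1 ?addr0// => j /negbTE ->.
by rewrite mul0r.
Qed.

Variables (n : nat) (X : 'I_n -> T -> R) (t2 : R) (x : 'I_n -> R) (r : R).
Hypothesis t2_gt0 : 0 < t2.
Hypothesis r_gt0 : 0 < r.

(** Each bell of width [r] is at least [exp(-1/2)] on the event, and each has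
    expectation at most [r / Num.sqrt t2]. *)
Lemma gaussian_box_bound :
  (forall a : 'I_n -> R, exists v, gaussian P (fun t => \sum_(i < n) a i * X i t) v) ->
  (forall i, sqint P (X i)) ->
  (forall i j, ip P (X i) (X j) = if i == j then t2 else 0) ->
  (mu_ext P [set t | forall i, (`|X i t - x i| <= r)%R] <=
    (box_const n * (r / Num.sqrt t2) ^+ n)%:E)%E.
Proof.
move=> gX sX oX.
have gX' (a : 'I_n -> R) : gaussian P (fun t => \sum_(i < n) a i * X i t) (\sum_(i < n) a i ^+ 2 * t2).
  have [v gv] := gX a; have := gaussian_ip_eq gv.
  by rewrite (@ip_orthogonal _ _ _ _ _ _ (fun=> t2)).
have gXi i : gaussian P (X i) t2.
  have := gX' (fun j => if j == i then 1 else 0); rewrite sum_delta.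
  rewrite (_ : \sum_(j < n) _ = t2)//.
  rewrite (bigD1 i)//= eqxx expr1n mul1r big1 ?addr0// => j /negbTE ->.
  by rewrite expr0n mul0r.
apply: (le_trans (@prod_markov _ _ _ P n X (fun=> t2) (fun i => bell (x i) r)
  (fun=> expR (- 2^-1)) (fun=> r / Num.sqrt t2) _ _ _ _ _ _ _ _)) => //.
- by move=> i; have [] := sX i.
- by move=> i; exact: bellpoly_bell.
- by move=> i y; exact: bell_ge0.
- by move=> t H i; apply: bell_ge => //; exact: H.
- by move=> i; exact: gaussian_bell_le (gXi i) t2_gt0 r_gt0.
by rewrite lee_fin prodr_const card_ord exprMn /box_const mulrC.
Qed.

Variables (Y : T -> R) (i0 : 'I_n) (s2 h : R) (N : nat).
Hypothesis h_gt0 : 0 < h.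

(** [Y] may be correlated with [X i0].  Its regression residual
    [V = Y - b * X i0] is orthogonal to all the [X i], hence independent of
    them, and a large [Y] forces a large [V] or a large [b * X i0].  In the first
    case there are [n.+1] independent factors; in the second the tail factor is
    attached to [X i0] itself, at no cost for the power of [r]. *)
Lemma gaussian_pair_bound :
  (forall (a : 'I_n -> R) (e : R),
     exists v, gaussian P (fun t => \sum_(i < n) a i * X i t + e * Y t) v) ->
  (forall i j, ip P (X i) (X j) = if i == j then t2 else 0) ->
  (forall i, i != i0 -> ip P (X i) Y = 0) ->
  ip P Y Y <= s2 ->
  (mu_ext P [set t | (forall i, `|X i t - x i| <= r)%R /\ (h <= `|Y t|)%R] <=
    (box_const n * (r / Num.sqrt t2) ^+ n * (tail_const N * (s2 / h ^+ 2) ^+ N))%:E)%E.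
Proof.
move=> gXY oX oXY Ys2.
have gXa (a : 'I_n -> R) : exists v, gaussian P (fun t => \sum_(i < n) a i * X i t) v.
  have [v gv] := gXY a 0; exists v.
  by move: gv; under eq_fun do rewrite mul0r addr0.
have sX i : sqint P (X i).
  have [v] := gXa (fun j => if j == i then 1 else 0).
  by rewrite sum_delta; exact: gaussian_sqint.
have sY : sqint P Y.
  have [v] := gXY (fun=> 0) 1.
  rewrite (_ : (fun t => _) = Y); first exact: gaussian_sqint.
  apply/funext => t; rewrite big1 ?add0r ?mul1r// => j _; exact: mul0r.
pose b := ip P (X i0) Y / t2.
pose V t := Y t + - b * X i0 t.
have sV : sqint P V by apply: sqintD => //; exact: sqintZ.
have oXV i : ip P (X i) V = 0.
  rewrite ipDr ?ipZr//; try exact: sqintZ.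
  rewrite oX; have [->|ii0] := eqVneq i i0.
    by rewrite mulNr divfK ?subrr// gt_eqF.
  by rewrite oXY// mulr0 addr0.
have VVE : ip P V V = ip P Y Y - b ^+ 2 * t2.
  have sbX := sqintZ (- b) (sX i0).
  rewrite {1}/V ipDl// ipZl// oXV mulr0 addr0 ipDr// ipZr// (ipC _ Y).
  by rewrite /b; field; rewrite gt_eqF.
have VV0 : 0 <= ip P V V by apply: Rintegral_ge0 => t _; rewrite -expr2 sqr_ge0.
have b2 : b ^+ 2 * t2 <= s2 by rewrite (le_trans _ Ys2)// -subr_ge0 -VVE.
have VVs2 : ip P V V <= s2.
  by rewrite VVE (le_trans _ Ys2)// gerBl mulr_ge0 ?sqr_ge0// ltW.
pose E1 := [set t | (forall i, `|X i t - x i| <= r) /\ h / 2 <= `|V t|].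
pose E2 := [set t | (forall i, `|X i t - x i| <= r) /\ h / 2 <= `|b * X i0 t|].
have sub : [set t | (forall i, `|X i t - x i| <= r) /\ h <= `|Y t|] `<=` E1 `|` E2.
  move=> t [Xr hY]; have [hV|hV] := leP (h / 2) `|V t|; [by left|right].
  split=> //; rewrite -(lerD2r `|V t|) (le_trans _ (ler_normD _ _))//.
  rewrite (_ : b * _ + _ = Y t); last by rewrite /V; ring.
  by rewrite (le_trans _ hY)// [leRHS]splitr lerD2l ltW.
pose c1 := expR (- 2^-1) : R; pose q := 1 - c1.
set D := box_const n * (r / Num.sqrt t2) ^+ n.
have rt0 : 0 <= r / Num.sqrt t2 by rewrite divr_ge0 ?sqrtr_ge0// ltW.
have c1V : 0 <= c1^-1 by rewrite invr_ge0 expR_ge0.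
have D0 : 0 <= D by apply: mulr_ge0; exact: exprn_ge0.
have H1 : (mu_ext P E1 <= (D * (N`!%:R * (8 * s2 / h ^+ 2) ^+ N * 2 * q ^- N))%:E)%E.
  pose F (i : 'I_n.+1) := oapp X V (unlift ord0 i).
  pose vF (i : 'I_n.+1) := oapp (fun=> t2) (ip P V V) (unlift ord0 i).
  have F0 : F ord0 = V by rewrite /F unlift_none.
  have FS j : F (lift ord0 j) = X j by rewrite /F liftK.
  have vF0 : vF ord0 = ip P V V by rewrite /vF unlift_none.
  have vFS j : vF (lift ord0 j) = t2 by rewrite /vF liftK.
  have sF : forall i, sqint P (F i).
    by apply: ord_cases => [|j]; rewrite ?F0 ?FS.
  have oF : forall i j, ip P (F i) (F j) = if i == j then vF i else 0.
    apply: ord_cases => [|i]; apply: ord_cases => [|j]; rewrite ?F0 ?FS ?vF0 ?vFS.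
    - by rewrite eqxx.
    - by rewrite ipC oXV.
    - by rewrite oXV.
    - by rewrite oX (inj_eq lift_inj).
  have gF (a : 'I_n.+1 -> R) : gaussian P (fun t => \sum_(i < n.+1) a i * F i t)
      (\sum_(i < n.+1) a i ^+ 2 * vF i).
    rewrite -(ip_orthogonal a sF oF).
    have [v gv] := gXY (fun j => a (lift ord0 j) - (if j == i0 then a ord0 * b else 0)) (a ord0).
    apply: (@gaussian_ip_eq _ _ _ _ _ v); move: gv; congr (gaussian P _ v).
    apply/funext => t; rewrite big_ord_recl F0 /V mulrDr.
    under eq_bigr do rewrite mulrBl.
    rewrite sumrB; under [in RHS]eq_bigr do rewrite FS.
    rewrite (_ : \sum_(j < n) (if j == i0 then _ else _) * _ = a ord0 * b * X i0 t).
      by ring.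
    rewrite (bigD1 i0)//= eqxx big1 ?addr0// => j /negbTE ->.
    by rewrite mul0r.
  have gV : gaussian P V (ip P V V).
    have := gF (fun i => if i == ord0 then 1 else 0); rewrite sum_delta F0.
    by move=> /gaussian_ip_eq.
  have gX j : gaussian P (X j) t2.
    have := gF (fun i => if i == lift ord0 j then 1 else 0); rewrite sum_delta FS.
    by move=> /gaussian_ip_eq; rewrite oX eqxx.
  apply: (le_trans (@prod_markov _ _ _ P n.+1 F vF
    (fun i => oapp (fun j => bell (x j) r) (fun y => (1 - bell 0 (h / 2) y) ^+ N) (unlift ord0 i))
    (fun i => oapp (fun=> c1) (q ^+ N) (unlift ord0 i))
    (fun i => oapp (fun=> r / Num.sqrt t2)
        (N`!%:R * (2 * ip P V V / (h / 2) ^+ 2) ^+ N * 2) (unlift ord0 i)) _ _ _ _ _ _ _ _)) => //.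
  - by move=> i; have [] := sF i.
  - apply: ord_cases => [|j]; rewrite ?unlift_none ?liftK /=.
      exact: bellpoly_onem_bell.
    exact: bellpoly_bell.
  - apply: ord_cases => [|j] y; rewrite ?unlift_none ?liftK /=.
      by rewrite exprn_ge0 ?onem_bell_ge0.
    exact: bell_ge0.
  - apply: ord_cases => [|j]; rewrite ?unlift_none ?liftK /=.
      exact: exprn_gt0.
    exact: expR_gt0.
  - move=> t [Xr hV]; apply: ord_cases => [|j]; rewrite ?unlift_none ?liftK /= ?F0 ?FS.
      by apply: onem_bell_exp_ge => //; rewrite divr_gt0.
    by apply: bell_ge => //; exact: Xr.
  - apply: ord_cases => [|j]; rewrite ?unlift_none ?liftK /= ?F0 ?FS.
      exact: gaussian_tail_le.
    exact: (gaussian_bell_le (x j) (gX j) t2_gt0 r_gt0).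
  rewrite lee_fin big_ord_recl unlift_none /=.
  under eq_bigr do rewrite liftK /=.
  rewrite prodr_const card_ord mulrC exprMn /D /box_const -/c1 (mulrC (c1^-1 ^+ n)).
  rewrite ler_wpM2l//; first by apply: mulr_ge0; exact: exprn_ge0.
  rewrite ler_wpM2r ?invr_ge0 ?exprn_ge0 ?(ltW q_gt0)// ler_wpM2r// ler_wpM2l//.
  rewrite lerXn2r ?nnegrE ?divr_ge0 ?mulr_ge0 ?exprn_ge0 ?divr_ge0 ?(ltW h_gt0)//.
    by rewrite (le_trans VV0).
  rewrite (_ : 2 * _ / _ = 8 * ip P V V / h ^+ 2); last by field; rewrite gt_eqF.
  by rewrite ler_wpM2r ?invr_ge0 ?sqr_ge0// ler_wpM2l.
have H2 : (mu_ext P E2 <= (D * (N`!%:R * (8 * s2 / h ^+ 2) ^+ N * q ^- N))%:E)%E.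
  have [b0|b0] := eqVneq b 0.
    rewrite (_ : E2 = set0) ?mu_ext0//.
      rewrite lee_fin mulr_ge0// mulr_ge0 ?invr_ge0 ?exprn_ge0 ?(ltW q_gt0)// mulr_ge0//.
      rewrite exprn_ge0// divr_ge0 ?sqr_ge0// mulr_ge0// (le_trans _ b2)//.
      by rewrite mulr_ge0 ?sqr_ge0// ltW.
    apply/seteqP; split=> // t [_ /=]; rewrite b0 mul0r normr0 leNgt.
    by rewrite divr_gt0.
  have gX (a : 'I_n -> R) : gaussian P (fun t => \sum_(i < n) a i * X i t) (\sum_(i < n) a i ^+ 2 * t2).
    have [v gv] := gXa a; have := gaussian_ip_eq gv.
    by rewrite (@ip_orthogonal _ _ _ _ _ _ (fun=> t2)).
  have gXi j : gaussian P (X j) t2.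
    have := gX (fun i => if i == j then 1 else 0); rewrite sum_delta.
    by move=> /gaussian_ip_eq; rewrite oX eqxx.
  pose h' := h / 2 / `|b|.
  have h'0 : 0 < h' by rewrite divr_gt0 ?normr_gt0// divr_gt0.
  (* The exponent of the tail factor: only [X i0] carries one. *)
  pose e (j : 'I_n) := if j == i0 then N else 0%N.
  apply: (le_trans (@prod_markov _ _ _ P n X (fun=> t2)
    (fun j y => bell (x j) r y * (1 - bell 0 h' y) ^+ e j)
    (fun j => c1 * q ^+ e j)
    (fun j => (e j)`!%:R * (2 * t2 / h' ^+ 2) ^+ e j * (r / Num.sqrt t2)) _ _ _ _ _ _ _ _)) => //.
  - by move=> i; have [] := sX i.
  - by move=> i; apply: bellpoly_onem_exp; exact: bellpoly_bell.
  - by move=> i y; rewrite mulr_ge0 ?bell_ge0// exprn_ge0 ?onem_bell_ge0.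
  - by move=> i; rewrite mulr_gt0 ?expR_gt0 ?exprn_gt0.
  - move=> t [Xr hV] i; apply: ler_pM; [exact: expR_ge0|exact/exprn_ge0/ltW/q_gt0|exact: (bell_ge _ (Xr i))|].
    rewrite /e; have [->|_] := eqVneq i i0; last by rewrite !expr0.
    apply: onem_bell_exp_ge => //.
    by rewrite /h' ler_pdivrMr ?normr_gt0// -normrM (mulrC _ b); exact: hV.
  - by move=> i; exact: (gaussian_bell_tail_le (e i) (x i) h' (gXi i) t2_gt0 r_gt0).
  rewrite lee_fin.
  rewrite (eq_bigr (fun i => ((e i)`!%:R * (2 * t2 / h' ^+ 2) ^+ e i * q ^- e i) * (r / Num.sqrt t2 / c1))); last first.
    by move=> i _; rewrite [(c1 * _)^-1]invfM [c1^-1 * _]mulrC mulrACA.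
  rewrite big_split/= prodr_const card_ord mulrC exprMn /D /box_const -/c1 (mulrC (c1^-1 ^+ n)).
  rewrite ler_wpM2l//; first by apply: mulr_ge0; exact: exprn_ge0.
  rewrite (bigD1 i0)//= {1 2 3}/e eqxx big1 => [|j /negbTE ji]; last first.
    by rewrite /e ji fact0 !expr0 invr1 !mulr1.
  rewrite mulr1 ler_wpM2r ?invr_ge0 ?exprn_ge0 ?(ltW q_gt0)// ler_wpM2l//.
  have s20 : 0 <= s2 by rewrite (le_trans _ b2)// mulr_ge0 ?sqr_ge0// ltW.
  apply: lerXn2r; rewrite ?nnegrE.
  - by rewrite divr_ge0 ?sqr_ge0// mulr_ge0// ltW.
  - by rewrite divr_ge0 ?sqr_ge0// mulr_ge0.
  rewrite (_ : 2 * t2 / _ = 8 * (b ^+ 2 * t2) / h ^+ 2); last first.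
    rewrite -(real_normK (num_real b)) /h'; field.
    by rewrite normr_eq0 b0 gt_eqF.
  by rewrite ler_wpM2r ?invr_ge0 ?sqr_ge0// ler_wpM2l.
apply: (le_trans (le_mu_ext P sub)).
apply: (le_trans (outer_measureU2 _ _ _)).
apply: (le_trans (leeD H1 H2)); rewrite -EFinD lee_fin -mulrDr ler_wpM2l//.
rewrite le_eqVlt; apply/orP; left; apply/eqP; rewrite /tail_const -/c1 -/q.
rewrite -(mulrA 8) [(8 * _) ^+ N]exprMn.
have gen (a A B C : R) : a * (A * C) * 2 * B + a * (A * C) * B = 3 * a * A * B * C by ring.
exact: gen.
Qed.

End pair_bound.

(** * Outer probability of unions *)

Section outer.
Context {R : realType} d (T : measurableType d) (P : probability T R).

Lemma mu_ext_finite_union (J : finType) (E : J -> set T) (B : R) :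
  (forall j, (mu_ext P (E j) <= B%:E)%E) ->
  (mu_ext P [set t | exists j, E j t] <= (#|J|%:R * B)%:E)%E.
Proof.
move=> EB.
have H (s : seq J) : (mu_ext P [set t | exists2 j, j \in s & E j t] <= ((size s)%:R * B)%:E)%E.
  elim: s => [|j s IH].
    rewrite mul0r (_ : [set t | _] = set0) ?mu_ext0//.
    by apply/seteqP; split => // t [].
  apply: (@le_trans _ _ (mu_ext P (E j `|` [set t | exists2 j, j \in s & E j t]))).
    apply: le_mu_ext => t [i]; rewrite inE => /predU1P[->|is_] Et; first by left.
    by right; exists i.
  apply: (le_trans (outer_measureU2 _ _ _)).
  by rewrite /= -nat1r mulrDl mul1r EFinD leeD.
rewrite cardE; apply: le_trans (H (enum J)); apply: le_mu_ext => t [j Ej].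
by exists j => //; rewrite mem_enum.
Qed.

Lemma mu_ext_geometric_union (E : nat -> set T) (B : R) : 0 <= B ->
  (forall l, (mu_ext P (E l) <= (B * 2^-1 ^+ l)%:E)%E) ->
  (mu_ext P [set t | exists l, E l t] <= (2 * B)%:E)%E.
Proof.
move=> B0 EB.
have -> : [set t | exists l, E l t] = \bigcup_l E l.
  by apply/seteqP; split => t [l]; [exists l|exists l].
apply: (le_trans (outer_measure_sigma_subadditive _ _)).
apply: (@le_trans _ _ (\sum_(l <oo) (B * 2^-1 ^+ l)%:E)%E).
  by apply: lee_nneseries => [l _ _|l _]; [exact: mu_ext_ge0|exact: EB].
apply: lime_le.
  by apply: is_cvg_nneseries => l _ _; rewrite lee_fin mulr_ge0// exprn_ge0.
apply: nearW => n; rewrite sumEFin lee_fin -mulr_sumr mulrC ler_wpM2r//.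
have -> : \sum_(0 <= i < n) 2^-1 ^+ i = 2 * (1 - 2^-1 ^+ n) :> R.
  elim: n => [|n IH]; first by rewrite big_nil expr0 subrr mulr0.
  by rewrite big_nat_recr//= IH exprS; field.
by rewrite ler_piMr// gerBl exprn_ge0.
Qed.

End outer.

(** * Dyadic grids *)

Section dyadic.
Context {R : realType} (m : nat).

Definition cube (p : 'I_m -> R) := forall k, 0 <= p k <= 1.

Definition dyadic (l : nat) (K : 'I_m -> nat) (k : 'I_m) : R := (K k)%:R / 2 ^+ l.

Definition dyadic_floor (l : nat) (p : 'I_m -> R) (k : 'I_m) : nat :=
  Num.truncn (2 ^+ l * p k).

Lemma cube_dyadic l (K : 'I_m -> nat) : (forall k, (K k <= 2 ^ l)%N) -> cube (dyadic l K).
Proof.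
move=> KL k; rewrite /dyadic divr_ge0 ?exprn_ge0//= ler_pdivrMr ?exprn_gt0// mul1r.
by rewrite -natrX ler_nat.
Qed.

Lemma dyadic_floor_le l p : cube p -> forall k, (dyadic_floor l p k <= 2 ^ l)%N.
Proof.
move=> cp k; have /andP[p0 p1] := cp k.
rewrite -(ler_nat R) natrX.
apply: (@le_trans _ _ (2 ^+ l * p k)); last by rewrite ler_piMr// exprn_ge0.
by rewrite truncn_le mulr_ge0// exprn_ge0.
Qed.

Lemma dyadic_floor_close l p : cube p -> forall k,
  `|dyadic l (dyadic_floor l p) k - p k| <= 2 ^- l.
Proof.
move=> cp k; have /andP[p0 p1] := cp k.
have h0 : 0 <= 2 ^+ l * p k by rewrite mulr_ge0// exprn_ge0.
have l0 : 0 < 2 ^+ l :> R by rewrite exprn_gt0.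
have /andP[h1 h2] := truncn_itv h0.
rewrite -/(dyadic_floor l p k) in h1 h2.
rewrite /dyadic (_ : _ - _ = ((dyadic_floor l p k)%:R - 2 ^+ l * p k) / 2 ^+ l); last first.
  by field; rewrite gt_eqF.
rewrite normrM normfV (gtr0_norm l0) ler_piMl ?invr_ge0 ?(ltW l0)//.
rewrite -natr1 in h2; rewrite ler_norml; lra.
Qed.

Lemma dyadic_floor_half l p : cube p -> forall k,
  dyadic_floor l p k = (dyadic_floor l.+1 p k)./2.
Proof.
move=> cp k; have /andP[p0 p1] := cp k.
have h0 : 0 <= 2 ^+ l * p k by rewrite mulr_ge0// exprn_ge0.
rewrite /dyadic_floor exprS -mulrA; set y := 2 ^+ l * p k in h0 *.
have y20 : 0 <= 2 * y by rewrite mulr_ge0.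
apply: truncn_def; have /andP[h1 h2] := truncn_itv y20.
move: h1 h2; set n := Num.truncn (2 * y).
rewrite -[n in n%:R <= _]odd_double_half -[n in _ < n.+1%:R]odd_double_half.
rewrite -!natr1 !natrD -!mul2n !natrM => h1 h2.
have o0 : 0 <= (odd n)%:R :> R by [].
have o1 : (odd n)%:R <= 1 :> R by case: odd.
by apply/andP; split; lra.
Qed.

Lemma dyadic_half l (K : 'I_m -> nat) k :
  `|dyadic l (fun k => (K k)./2) k - dyadic l.+1 K k| <= 2 ^- l.+1.
Proof.
have l0 : 0 < 2 ^+ l :> R by rewrite exprn_gt0.
rewrite /dyadic exprS -[K k in X in _ - X]odd_double_half.
rewrite natrD -mul2n natrM.
rewrite (_ : _ - _ = - ((odd (K k))%:R / (2 * 2 ^+ l))); last by field; rewrite gt_eqF.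
rewrite normrN ger0_norm ?divr_ge0 ?mulr_ge0 ?(ltW l0)//.
rewrite -[leRHS]mul1r ler_wpM2r ?invr_ge0 ?mulr_ge0 ?(ltW l0)//.
by case: odd.
Qed.

End dyadic.

(** * Chaining *)

Section chaining.
Context {R : realType}.

(** A Gaussian field on the cube with [n] uncorrelated components of equal
    variance at least [t2], whose increments over distance [2^-l] have standard
    deviation of order [kappa^l], and whose paths are continuous. *)
Definition regular_gaussian d (T : measurableType d) (P : probability T R) (m n : nat)
    (v : ('I_m -> R) -> 'I_n -> T -> R) (t2 C kappa : R) : Prop :=
  [/\ forall p q, cube p -> cube q -> forall a b : 'I_n -> R, exists s,
        gaussian P (fun t => \sum_(i < n) a i * v p i t + \sum_(i < n) b i * v q i t) s,
      forall p, cube p -> exists2 s, t2 <= s &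
        forall i j, ip P (v p i) (v p j) = if i == j then s else 0,
      forall p q, cube p -> cube q -> forall i j, i != j -> ip P (v p i) (v q j) = 0,
      forall l p q, cube p -> cube q -> (forall k, `|p k - q k| <= 2 ^- l) -> forall i,
        ip P (fun t => v p i t - v q i t) (fun t => v p i t - v q i t) <=
        C * (kappa ^+ 2) ^+ l &
      forall t p, cube p -> forall i e, 0 < e -> exists l0, forall l q, (l0 <= l)%N -> cube q ->
        (forall k, `|q k - p k| <= 2 ^- l) -> `|v q i t - v p i t| < e].

Lemma small_power (a b : R) : 0 <= a < 1 -> 0 < b -> exists N, a ^+ N <= b.
Proof.
move=> /andP[a0 a1] b0; have := @cvg_geometric R 1 a; rewrite ger0_norm// => /(_ a1).
move=> /cvgr0Pnorm_le /(_ _ b0) [N _ H]; exists N.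
have := H N (leqnn N); rewrite /geometric /= mul1r; apply: le_trans.
exact: ler_norm.
Qed.

Lemma tail_const_ge0 N : 0 <= tail_const N :> R.
Proof.
have q0 : (0 : R) <= 1 - expR (- 2^-1).
  by rewrite subr_ge0 -[leRHS]expR0 ler_expR oppr_le0 invr_ge0.
by rewrite mulr_ge0 ?invr_ge0 ?exprn_ge0.
Qed.

Lemma box_const_ge0 n : 0 <= box_const n :> R.
Proof. by rewrite exprn_ge0// invr_ge0 expR_ge0. Qed.

Section bound.
Variables (m n : nat) (t2 C kappa : R).
Hypothesis t2_gt0 : 0 < t2.
Hypothesis C_ge0 : 0 <= C.
Hypothesis kappa_gt0 : 0 < kappa.
Hypothesis kappa_lt1 : kappa < 1.

(* Thresholds shrink like [theta^l] while the standard deviations of the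
   increments shrink like [kappa^l = theta^(2l)]: large increments become ever
   less likely. *)
Let theta := Num.sqrt kappa.

Let theta_gt0 : 0 < theta. Proof. by rewrite sqrtr_gt0. Qed.
Let theta2 : theta ^+ 2 = kappa. Proof. by rewrite sqr_sqrtr// ltW. Qed.
Let theta_lt1 : theta < 1.
Proof. by rewrite -(@ltr_pXn2r _ 2) ?nnegrE ?(ltW theta_gt0)// theta2 expr1n. Qed.
Let theta1 : 0 < 1 - theta. Proof. by rewrite subr_gt0. Qed.

Section event.
Context d (T : measurableType d) (P : probability T R).
Variable v : ('I_m -> R) -> 'I_n -> T -> R.
Hypothesis rv : regular_gaussian P v t2 C kappa.
Variables (x : 'I_n -> R) (r : R) (L : nat).
Hypothesis r_gt0 : 0 < r.
Hypothesis Lr : kappa ^+ L <= r.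

Definition hit_event := [set t | exists2 p, cube p & forall i, `|v p i t - x i| < r].

Let grid l := {ffun 'I_m -> 'I_(2 ^ l).+1}.
Let pt l (K : grid l) := dyadic l (fun k => K k : nat) : 'I_m -> R.
Let par l (K : grid l.+1) := dyadic l (fun k => (K k : nat)./2) : 'I_m -> R.

Definition base_event (K : grid L) := [set t | forall i, `|v (pt K) i t - x i| <= 2 * r].

(** The level [r * (theta^l * (1 - theta))] is the difference of the consecutive
    thresholds [r * (1 + theta^l)] and [r * (1 + theta^(l+1))]. *)
Definition jump_event l (K : grid (L + l).+1) (i : 'I_n) :=
  [set t | (forall i, `|v (pt K) i t - x i| <= 2 * r) /\
     r * (theta ^+ l * (1 - theta)) <= `|v (par K) i t - v (pt K) i t|].

Let cube_pt l (K : grid l) : cube (pt K).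
Proof. by apply: cube_dyadic => k; rewrite -ltnS. Qed.

Let cube_par l (K : grid l.+1) : cube (par K).
Proof.
have e : ((2 ^ l.+1)./2 = 2 ^ l)%N by rewrite expnS mul2n doubleK.
apply: cube_dyadic => k; rewrite -e; apply: half_leq.
by rewrite -ltnS.
Qed.

Let floor_grid l (p : 'I_m -> R) (cp : cube p) : exists2 K : grid l,
  (forall k, (K k : nat) = dyadic_floor l p k) & pt K = dyadic l (dyadic_floor l p).
Proof.
have lt k : (dyadic_floor l p k < (2 ^ l).+1)%N by rewrite ltnS dyadic_floor_le.
exists [ffun k => Ordinal (lt k)]; first by move=> k; rewrite ffunE.
by apply/funext => k; rewrite /pt /dyadic ffunE.
Qed.

(** Follow the dyadic approximations of a point at which the field is within [r]
    of [x].  By continuity they end up within [r * (1 + theta^l)].  Either this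
    holds at the coarsest level, or some level violates its threshold while the
    next one satisfies it, and the triangle inequality gives a jump. *)
Lemma hit_subset : hit_event `<=`
  [set t | exists K, base_event K t] `|`
  [set t | exists l, exists Ki : grid (L + l).+1 * 'I_n, jump_event Ki.1 Ki.2 t].
Proof.
move=> t [p cp hp]; have [_ _ _ _ cont] := rv.
pose u l := v (dyadic (L + l) (dyadic_floor (L + l) p)).
pose Q l := forall i, `|u l i t - x i| <= r * (1 + theta ^+ l).
have Q2 l : Q l -> forall i, `|u l i t - x i| <= 2 * r.
  move=> Ql i; rewrite (le_trans (Ql i))// mulrC ler_wpM2r ?(ltW r_gt0)//.
  have th1 : theta ^+ l <= 1 by rewrite exprn_ile1 ?(ltW theta_gt0) ?(ltW theta_lt1).
  lra.
have [l0 Ql0] : exists l, Q l.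
  have /choice[f fP] : forall i, exists l0, forall l, (l0 <= l)%N -> `|u l i t - x i| < r.
    move=> i; have e0 : 0 < r - `|v p i t - x i| by rewrite subr_gt0.
    have [l0 H] := cont t p cp i _ e0; exists l0 => l l0l.
    rewrite -(subrK (v p i t) (u l i t)) -addrA (le_lt_trans (ler_normD _ _))//.
    rewrite -ltrBrDr; apply: (H (L + l)%N).
    - by rewrite (leq_trans l0l)// leq_addl.
    - by apply: cube_dyadic => k; exact: dyadic_floor_le.
    - by move=> k; exact: dyadic_floor_close.
  exists (\max_(i < n) f i)%N => i; rewrite ltW// (lt_le_trans (fP i _ _))//.
    exact: leq_bigmax.
  by rewrite ler_peMr ?(ltW r_gt0)// lerDl exprn_ge0// ltW.
have [Q0|nQ0] := pselect (Q 0%N).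
  left; have [K _ KE] := floor_grid L cp.
  exists K; rewrite /base_event /= KE.
  by have := Q2 0%N Q0; rewrite /u addn0.
right.
have [l [nQl QSl]] : exists l, ~ Q l /\ Q l.+1.
  elim: l0 Ql0 => [//|l IH] QS; have [Ql|nQl] := pselect (Q l); first exact: IH.
  by exists l.
have [K KE ptE] := floor_grid (L + l).+1 cp.
have [i nQi] : exists i, r * (1 + theta ^+ l) < `|u l i t - x i|.
  by apply: contrapT => /forallNP H; apply: nQl => i; rewrite leNgt; apply/negP; exact: H.
exists l, (K, i); split => /=.
  by move=> j; rewrite ptE -addnS; exact: Q2.
have parE : par K = dyadic (L + l) (dyadic_floor (L + l) p).
  by apply/funext => k; rewrite /par /dyadic KE -dyadic_floor_half.
rewrite parE ptE -/(u l) -addnS -/(u l.+1).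
have := QSl i; have := ler_distD (u l.+1 i t) (u l i t) (x i); move: nQi.
set A := `|_ - x i|; set B := `|_ - x i|; rewrite exprS.
move=> h1 h2 h3; rewrite -(lerD2r B) (le_trans _ h2)// (le_trans _ (ltW h1))//.
apply: (le_trans (lerD (lexx _) h3)).
rewrite le_eqVlt; apply/orP; left; apply/eqP; ring.
Qed.

Let q := 2 / Num.sqrt t2.

Let box_le s : t2 <= s -> (2 * r / Num.sqrt s) ^+ n <= q ^+ n * r ^+ n.
Proof.
move=> t2s; have s0 : 0 < s by exact: lt_le_trans t2s.
have r20 : 0 <= 2 * r by rewrite mulr_ge0// ltW.
rewrite -exprMn; apply: lerXn2r; rewrite ?nnegrE.
- by rewrite divr_ge0 ?sqrtr_ge0.
- by rewrite mulr_ge0 ?(ltW r_gt0)// divr_ge0 ?sqrtr_ge0.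
rewrite /q [leRHS]mulrAC ler_wpM2l// lef_pV2 ?posrE ?sqrtr_gt0//.
by rewrite ler_wsqrtr.
Qed.

Lemma base_event_bound (K : grid L) :
  (mu_ext P (base_event K) <= (box_const n * (q ^+ n * r ^+ n))%:E)%E.
Proof.
have [G E _ _ _] := rv.
have [s t2s Es] := E _ (cube_pt K).
have s0 : 0 < s by exact: lt_le_trans t2s.
have r20 : 0 < 2 * r by rewrite mulr_gt0.
have GX (a : 'I_n -> R) : exists w, gaussian P (fun t => \sum_(i < n) a i * v (pt K) i t) w.
  have [w gw] := G _ _ (cube_pt K) (cube_pt K) a (fun=> 0); exists w.
  move: gw; congr (gaussian P _ _); apply/funext => t.
  by rewrite [X in _ + X]big1 ?addr0// => i _; rewrite mul0r.
have SX i : sqint P (v (pt K) i).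
  have [w] := GX (fun j => if j == i then 1 else 0); rewrite sum_delta.
  exact: gaussian_sqint.
apply: (le_trans (gaussian_box_bound x s0 r20 GX SX Es)).
by rewrite lee_fin ler_wpM2l ?box_le// exprn_ge0// invr_ge0 expR_ge0.
Qed.

Let C' := C * kappa ^+ 2 / (1 - theta) ^+ 2.

(** The increment has variance at most [C * kappa^(2 * (L + l + 1))], the square of
    the jump is of order [r^2 * kappa^l], and [kappa^L <= r]. *)
Lemma jump_event_bound N l (K : grid (L + l).+1) (i : 'I_n) :
  (mu_ext P (jump_event K i) <=
   (box_const n * (q ^+ n * r ^+ n) * (tail_const N * (C' * kappa ^+ l) ^+ N))%:E)%E.
Proof.
have [G E O D _] := rv.
have cK := cube_pt K; have cpK := cube_par K.
have [s t2s Es] := E _ cK.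
have s0 : 0 < s by exact: lt_le_trans t2s.
have r20 : 0 < 2 * r by rewrite mulr_gt0.
have h0 : 0 < r * (theta ^+ l * (1 - theta)) by rewrite mulr_gt0// mulr_gt0// exprn_gt0.
pose Y t := v (par K) i t - v (pt K) i t.
have GX (a : 'I_n -> R) (e : R) : exists w,
    gaussian P (fun t => \sum_(i < n) a i * v (pt K) i t + e * Y t) w.
  have [w gw] := G _ _ cK cpK (fun j => a j - (if j == i then e else 0))
    (fun j => if j == i then e else 0).
  exists w; move: gw; congr (gaussian P _ _); apply/funext => t.
  have sumE p : \sum_(j < n) (if j == i then e else 0) * v p j t = e * v p i t.
    by rewrite (bigD1 i)//= eqxx big1 ?addr0// => j /negbTE ->; rewrite mul0r.
  under eq_bigr do rewrite mulrBl.
  by rewrite sumrB !sumE /Y; ring.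
have GX0 (a : 'I_n -> R) : exists w, gaussian P (fun t => \sum_(i < n) a i * v (pt K) i t) w.
  by have [w gw] := GX a 0; exists w; move: gw; under eq_fun do rewrite mul0r addr0.
have SX j : sqint P (v (pt K) j).
  have [w] := GX0 (fun k => if k == j then 1 else 0); rewrite sum_delta.
  exact: gaussian_sqint.
have Sp : sqint P (v (par K) i).
  have [w] := G _ _ cpK cpK (fun k => if k == i then 1 else 0) (fun=> 0).
  rewrite (_ : (fun t => _) = v (par K) i); first exact: gaussian_sqint.
  apply/funext => t; rewrite [X in _ + X]big1 ?addr0 => [|j _]; last exact: mul0r.
  rewrite (bigD1 i)//= eqxx mul1r big1 ?addr0// => j /negbTE ->.
  exact: mul0r.
have OY j : j != i -> ip P (v (pt K) j) Y = 0.
  move=> ji; rewrite /Y; under [X in ip P _ X]eq_fun do rewrite -mulN1r.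
  rewrite ipDr//; last exact: sqintZ.
  by rewrite ipZr// O// Es (negbTE ji) mulr0 addr0.
have YY : ip P Y Y <= C * (kappa ^+ 2) ^+ (L + l).+1.
  apply: D => // k; exact: dyadic_half.
apply: (le_trans (gaussian_pair_bound x s0 r20 N h0 GX Es OY YY)).
have h2 : (r * (theta ^+ l * (1 - theta))) ^+ 2 = r ^+ 2 * kappa ^+ l * (1 - theta) ^+ 2.
  by rewrite !exprMn -exprM mulnC exprM theta2 mulrA.
have ratio : C * (kappa ^+ 2) ^+ (L + l).+1 / (r * (theta ^+ l * (1 - theta))) ^+ 2 <=
    C' * kappa ^+ l.
  rewrite h2 ler_pdivrMr ?mulr_gt0 ?exprn_gt0//.
  rewrite (_ : C' * _ * _ = C * (kappa ^+ 2 * (kappa ^+ l) ^+ 2 * r ^+ 2)); last first.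
    by rewrite /C'; field; rewrite gt_eqF.
  rewrite (_ : (kappa ^+ 2) ^+ (L + l).+1 = kappa ^+ 2 * (kappa ^+ l) ^+ 2 * (kappa ^+ L) ^+ 2); last first.
    by rewrite exprS exprD -!exprM !(mulnC _ 2) -mulrA (mulrC (_ ^+ (2 * L))).
  have kk : 0 <= kappa ^+ 2 * (kappa ^+ l) ^+ 2 by apply: mulr_ge0; exact: sqr_ge0.
  rewrite ler_wpM2l// ler_wpM2l//.
  by apply: lerXn2r; rewrite ?nnegrE ?(ltW r_gt0) ?exprn_ge0 ?(ltW kappa_gt0).
have ratio0 : 0 <= C * (kappa ^+ 2) ^+ (L + l).+1 / (r * (theta ^+ l * (1 - theta))) ^+ 2.
  by rewrite divr_ge0 ?sqr_ge0// mulr_ge0// exprn_ge0// sqr_ge0.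
have bc0 : 0 <= box_const n :> R by rewrite exprn_ge0// invr_ge0 expR_ge0.
rewrite lee_fin; apply: ler_pM.
- by rewrite mulr_ge0// exprn_ge0// divr_ge0 ?sqrtr_ge0// ltW.
- by rewrite mulr_ge0 ?exprn_ge0// tail_const_ge0.
- by rewrite ler_wpM2l// box_le.
rewrite ler_wpM2l ?tail_const_ge0//.
by apply: lerXn2r; rewrite ?nnegrE// (le_trans ratio0).
Qed.

End event.

(** The order [N] of the tail estimate is chosen so large that [kappa^(l * N)]
    beats the number of grid points, of order [2^(m * l)], by the factor [2^-l]. *)
Lemma chaining_bound : exists2 c, 0 < c &
  forall d (T : measurableType d) (P : probability T R) (v : ('I_m -> R) -> 'I_n -> T -> R),
  regular_gaussian P v t2 C kappa ->
  forall (x : 'I_n -> R) (r : R) (L : nat), 0 < r -> kappa ^+ L <= r ->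
  (mu_ext P (hit_event v x r) <= (c * (2 ^+ L) ^+ m * r ^+ n)%:E)%E.
Proof.
have [N HN] : exists N, kappa ^+ N <= (2 ^+ m)^-1 * 2^-1.
  by apply: small_power; rewrite ?(ltW kappa_gt0) ?mulr_gt0 ?invr_gt0 ?exprn_gt0.
have [D D0 DE] : exists2 D : R, 0 <= D & D = box_const n * (2 / Num.sqrt t2) ^+ n.
  eexists; last by []; apply: mulr_ge0; first exact: box_const_ge0.
  by rewrite exprn_ge0// divr_ge0 ?sqrtr_ge0.
have [C' C'0 C'E] : exists2 C', 0 <= C' & C' = C * kappa ^+ 2 / (1 - theta) ^+ 2.
  by eexists; last by []; rewrite divr_ge0 ?sqr_ge0// mulr_ge0// sqr_ge0.
have tc0 := tail_const_ge0 N.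
have [A A0 AE] : exists2 A : R, 0 <= A &
    A = (4 ^+ m * n%:R) * (D * (tail_const N * C' ^+ N)).
  by eexists; last by []; rewrite !mulr_ge0// exprn_ge0.
exists (2 ^+ m * D + 2 * A + 1).
  by rewrite ltr_wpDl// addr_ge0 ?mulr_ge0// exprn_ge0.
move=> d T P v rv x r L r0 Lr.
have rn0 : 0 <= r ^+ n by rewrite exprn_ge0// ltW.
have Lm0 : 0 <= (2 ^+ L) ^+ m :> R by rewrite !exprn_ge0.
have p1 l : 1 <= 2 ^+ l :> R by rewrite exprn_ege1// ler1n.
apply: (le_trans (le_mu_ext P (hit_subset rv L r0 (x:=x)))).
apply: (le_trans (outer_measureU2 _ _ _)).
have H0 : (mu_ext P [set t | exists K : {ffun 'I_m -> 'I_(2 ^ L).+1}, base_event v x r K t] <=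
    (2 ^+ m * D * (2 ^+ L) ^+ m * r ^+ n)%:E)%E.
  apply: (le_trans (mu_ext_finite_union (fun K => base_event_bound rv x (L:=L) r0 K))).
  rewrite card_ffun !card_ord lee_fin natrX.
  rewrite (_ : 2 ^+ m * D * _ * _ = (2 * 2 ^+ L) ^+ m * (D * r ^+ n)); last first.
    by rewrite exprMn; ring.
  rewrite (_ : box_const n * _ = D * r ^+ n); last by rewrite DE mulrA.
  rewrite ler_wpM2r ?mulr_ge0//.
  apply: lerXn2r; rewrite ?nnegrE// -natr1 natrX.
  by rewrite mulr_natl mulr2n lerD2l.
have H1 : (mu_ext P [set t | exists l, exists Ki : {ffun 'I_m -> 'I_(2 ^ (L + l).+1).+1} * 'I_n,
      jump_event v x r Ki.1 Ki.2 t] <=  (2 * (A * (2 ^+ L) ^+ m * r ^+ n))%:E)%E.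
  apply: mu_ext_geometric_union; first by do 2 apply: mulr_ge0 => //.
  move=> l.
  apply: (le_trans (mu_ext_finite_union (fun Ki => jump_event_bound rv x r0 Lr N Ki.1 Ki.2))).
  rewrite card_prod card_ffun !card_ord lee_fin natrM natrX -/theta -C'E.
  rewrite (_ : box_const n * _ = D * r ^+ n); last by rewrite DE mulrA.
  rewrite [(C' * _) ^+ N]exprMn.
  apply: (@le_trans _ _ ((4 * 2 ^+ L * 2 ^+ l) ^+ m * n%:R *
     (D * r ^+ n * (tail_const N * (C' ^+ N * (kappa ^+ l) ^+ N))))).
    rewrite ler_wpM2r//.
      by rewrite !mulr_ge0// !exprn_ge0// ltW.
    rewrite ler_wpM2r//; apply: lerXn2r; rewrite ?nnegrE ?mulr_ge0 ?exprn_ge0//.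
    rewrite -natr1 natrX -mulrA -exprD; set z := 2 ^+ (L + l).
    have : 1 <= z by exact: p1.
    rewrite exprS -/z; lra.
  rewrite !exprMn.
  have gen (a b c e f g h i j k: R) : 0 <= a * b * e * f * h * g * i -> c * j <= k ->
     a * b * c * e * (f * g * (h * (i * j))) <= a * e * (f * (h * i)) * b * g * k.
    move=> H cjk; rewrite (_ : a * b * c * e * _ = a * b * e * f * h * g * i * (c * j)); last by ring.
    rewrite (_ : _ * k = a * b * e * f * h * g * i * k); last by ring.
    by rewrite ler_wpM2l.
  rewrite AE; apply: gen.
    by rewrite !mulr_ge0// !exprn_ge0// ltW.
  rewrite -!exprM (mulnC l m) (mulnC l N) !exprM -exprMn.
  apply: lerXn2r; rewrite ?nnegrE ?mulr_ge0 ?exprn_ge0 ?(ltW kappa_gt0)//.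
  rewrite -ler_pdivlMl ?exprn_gt0//.
apply: (le_trans (leeD H0 H1)); rewrite -EFinD lee_fin.
rewrite -subr_ge0 (_ : _ - _ = (2 ^+ L) ^+ m * r ^+ n); last by ring.
exact: mulr_ge0.
Qed.

End bound.
End chaining.

(** * Hitting a ball *)

Section ball_power.
Context {R : realType}.

Let powR1_fix (y : R) : 1 `^ y = 1. Proof. by rewrite powR1. Qed.

Lemma two_powRN_lt1 (H : R) : 0 < H -> 2 `^ (- H) < 1 :> R.
Proof.
move=> H0; rewrite powRN invf_lt1 ?powR_gt0// -[ltLHS](powR1_fix H).
by apply: gt0_ltr_powR; rewrite ?nnegrE// ltr1n.
Qed.

(** The dyadic scale [2^-L] at which increments have size [r]. *)
Lemma exists_scale (H r : R) : 0 < H -> 0 < r <= 1 ->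
  exists2 L, (2 `^ (- H)) ^+ L <= r & 2 ^+ L <= 2 * r `^ (- H^-1).
Proof.
move=> H0 /andP[r0 r1]; set kappa := 2 `^ (- H).
have k0 : 0 < kappa by rewrite powR_gt0.
have k1 : kappa < 1 by exact: two_powRN_lt1.
have Hi0 : 0 < H^-1 by rewrite invr_gt0.
have ex : exists L, kappa ^+ L <= r by apply: small_power; rewrite ?(ltW k0) ?k1.
have [L Lr min] := ex_minnP ex; exists L => //.
have ri : 1 <= r `^ (- H^-1).
  rewrite powRN invf_ge1 ?powR_gt0// -[leRHS](powR1_fix H^-1).
  by apply: ge0_ler_powR; rewrite ?nnegrE ?(ltW Hi0) ?(ltW r0).
case: L Lr min => [|L] Lr min; first by rewrite expr0; lra.
have {min} Lr' : r < kappa ^+ L.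
  by rewrite ltNge; apply/negP => /min; rewrite ltnn.
rewrite exprS ler_pM2l// powRN -[leLHS]invrK.
rewrite lef_pV2 ?posrE ?invr_gt0 ?exprn_gt0 ?powR_gt0//.
have -> : (2 ^+ L)^-1 = (kappa ^+ L) `^ H^-1.
  rewrite -!powR_mulrn ?(ltW k0)// -!powRrM -powRN; congr (_ `^ _).
  by field; rewrite gt_eqF.
by apply: ge0_ler_powR; rewrite ?nnegrE ?exprn_ge0 ?(ltW k0) ?(ltW Lr') ?(ltW r0) ?(ltW Hi0).
Qed.

(** With [L] from [exists_scale], the number [2^(m * L)] of grid points in
    [chaining_bound] is of order [r^(- m / H)]. *)
Lemma hit_ball_bound (m n : nat) (t2 C H : R) : 0 < t2 -> 0 <= C -> 0 < H ->
  exists2 c, 0 < c &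
  forall d (T : measurableType d) (P : probability T R) (v : ('I_m -> R) -> 'I_n -> T -> R),
  regular_gaussian P v t2 C (2 `^ (- H)) ->
  forall (x : 'I_n -> R) (r : R), 0 < r <= 1 ->
  (mu_ext P (hit_event v x r) <= (c * r `^ (n%:R - m%:R / H))%:E)%E.
Proof.
move=> t20 C0 H0.
have k0 : 0 < 2 `^ (- H) :> R by rewrite powR_gt0.
have k1 : 2 `^ (- H) < 1 :> R by exact: two_powRN_lt1.
have [c c0 Hc] := chaining_bound m n t20 C0 k0 k1.
exists (c * 2 ^+ m); first by rewrite mulr_gt0// exprn_gt0.
move=> d T P v rv x r r01; have /andP[r0 r1] := r01.
have [L Lr L2] := exists_scale H0 r01.
apply: (le_trans (Hc _ _ _ _ rv x r L r0 Lr)); rewrite lee_fin.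
have -> : r `^ (n%:R - m%:R / H) = r ^+ n * (r `^ (- H^-1)) ^+ m.
  rewrite powRD; last by rewrite (gt_eqF r0) implybT.
  rewrite powR_mulrn ?(ltW r0)// -[X in _ = _ * X]powR_mulrn ?powR_ge0// -powRrM.
  by congr (_ * _ `^ _); rewrite mulNr mulrC.
rewrite -!mulrA ler_wpM2l ?(ltW c0)// mulrCA (mulrC _ (r ^+ n)) ler_wpM2l ?exprn_ge0 ?(ltW r0)//.
rewrite -exprMn; apply: lerXn2r; rewrite ?nnegrE ?mulr_ge0 ?powR_ge0 ?exprn_ge0//.
Qed.

End ball_power.

(** * From balls to Hausdorff measure *)

Section hausdorff.
Context {R : realType} (k n : nat).

(** A cover of [A] by balls yields a cover of the event of hitting [A], so every
    content of [A] at a small scale dominates the hitting probability divided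
    by [c], and so does their limit. *)
Lemma hitting_hausdorff (dO : measure_display) (Omega : measurableType dO)
    (P : probability Omega R) (u : R -> 'rV[R]_k -> Omega -> 'rV[R]_n)
    (S : set (R * 'rV[R]_k)) (gamma c e0 : R) (A : set 'rV[R]_n) :
  0 < c -> 0 < e0 ->
  (forall y r, 0 < r <= e0 ->
    (hitting_probability P u S (eball y r) <= (c * r `^ gamma)%:E)%E) ->
  (hitting_probability P u S A <= c%:E * hausdorff_measure gamma A)%E.
Proof.
move=> c0 e00 ball; rewrite /hausdorff_measure; case: ltP => gamma0.
  by rewrite gt0_muley ?lte_fin// leey.
rewrite -lee_pdivrMl//; set M := (X in (_ <= lim X)%E).
have content e : 0 < e <= e0 ->
    ((c^-1)%:E * hitting_probability P u S A <= hausdorff_content gamma e A)%E.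
  move=> /andP[e_gt0 ee0]; apply: le_ereal_inf_tmp => _ [x [r [re Ax ->]]].
  rewrite lee_pdivrMl//.
  have sub : hits u S A `<=` \bigcup_i hits u S (eball (x i) (r i)).
    move=> w [y [[z Sz <-] Az]]; have [i _ bi] := Ax _ Az.
    by exists i => //; exists (u z.1 z.2 w); split => //; exists z.
  apply: (le_trans (le_mu_ext P sub)).
  apply: (le_trans (outer_measure_sigma_subadditive _ _)).
  have ht0 i : 0 <= hausdorff_term gamma (r i).
    by rewrite /hausdorff_term; case: ifP => // _; exact: powR_ge0.
  apply: (@le_trans _ _ (\sum_(i <oo) (c%:E * (hausdorff_term gamma (r i))%:E))%E).
    apply: lee_nneseries => [i _ _|i _]; first exact: mu_ext_ge0.
    have /andP[ri0 rie] := re i.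
    (* A ball of radius 0 is empty, in accordance with its zero contribution. *)
    rewrite /hausdorff_term; case: eqVneq => [ri|rin0].
      rewrite mule0 (_ : hits _ _ _ = set0) ?outer_measure0//.
      apply/seteqP; split => // w [y [_]]; rewrite /eball /= ri.
      by rewrite ltNge sqrtr_ge0.
    have ri_gt0 : 0 < r i by rewrite lt0r rin0.
    apply: (le_trans (ball _ _ _)); first by rewrite ri_gt0 (le_trans rie).
    rewrite -EFinM lee_fin ler_wpM2l ?(ltW c0)// ge0_ler_powR ?nnegrE ?mulr_ge0//.
    by rewrite ler_peMl// ler1n.
  rewrite nneseriesZl//; last by move=> i _; rewrite lee_fin.
apply: lime_ge.
  apply: nonincreasing_at_right_is_cvge; near=> a => e1 e2 _ _ e12.
  apply: ereal_inf_le_tmp => _ [x [r [re Ax ->]]]; exists x, r; split => // i.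
  by have /andP[-> /le_trans->] := re i.
near=> e; apply: content.
apply/andP; split; first by near: e; exact: nbhs_right_gt.
by near: e; exact: nbhs_right_le.
Unshelve. all: by end_near.
Qed.

End hausdorff.

(** * Trigonometric estimates *)

Section trig.
Context {R : realType}.
Implicit Types x y : R.

Lemma sin_lipschitz x y : `|sin x - sin y| <= `|x - y|.
Proof.
wlog xy : x y / y <= x.
  move=> H; have [/H//|/ltW/H] := leP y x.
  by rewrite distrC (distrC y).
have [c _ ->] := MVT_segment xy (fun z _ => is_derive_sin z)
  (continuous_subspaceT (@continuous_sin R)).
by rewrite normrM ler_piMl// ler_norml cos_geN1 cos_le1.
Qed.

Lemma onem_cos_le x : 1 - cos x <= x ^+ 2 / 2.
Proof.
have -> : x = (x / 2) *+ 2 by rewrite -mulr_natr; field.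
set y := x / 2; rewrite cos_mulr2n cos2sin2.
have : sin y ^+ 2 <= y ^+ 2.
  rewrite -real_normK ?num_real// -[leRHS]real_normK ?num_real//.
  apply: lerXn2r; rewrite ?nnegrE//.
  by have := sin_lipschitz y 0; rewrite sin0 !subr0.
lra.
Qed.

Lemma sin_ge_half y : 0 <= y <= 1 -> y / 2 <= sin y.
Proof.
move=> /andP[y0 y1].
have [c cy] := MVT_segment y0 (fun z _ => is_derive_sin z)
  (continuous_subspaceT (@continuous_sin R)).
rewrite sin0 !subr0 => ->.
have := onem_cos_le c; move: cy; rewrite in_itv/= => /andP[c0 cy] h.
have c2 : c ^+ 2 <= 1 by rewrite expr_le1// (le_trans cy).
have cosc : 2^-1 <= cos c by lra.
by rewrite mulrC ler_wpM2r.
Qed.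

End trig.

(** * Euclidean norm and boxes *)

Section rV.
Context {R : realType}.

Lemma measurable_coord n (i : 'I_n) : measurable_fun setT (fun x : borel R n => x ord0 i : R).
Proof.
apply: (measurability _ (RGenOpens.measurableE R)).
move=> _ [_ [a [b ->] <-]]; rewrite setTI; apply: sub_sigma_algebra.
by apply: open_comp => [x _|]; [exact: coord_continuous|exact: interval_open].
Qed.

Lemma measurable_dotv n (y : 'rV[R]_n) : measurable_fun setT (fun x : borel R n => dotv x y).
Proof.
apply: measurable_sum => i; apply: measurable_funM => //; exact: measurable_coord.
Qed.

Lemma measurable_enorm n : measurable_fun setT (fun x : borel R n => enorm x).
Proof.
apply: (@measurableT_comp _ _ _ _ _ _ (Num.sqrt : R -> R)).
  apply: continuous_measurable_fun; exact: sqrt_continuous.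
apply: measurable_sum => i; apply: measurable_funM => //; exact: measurable_coord.
Qed.

Lemma enorm_ge0 n (x : 'rV[R]_n) : 0 <= enorm x.
Proof. exact: sqrtr_ge0. Qed.

Lemma coord_le_enorm n (x : 'rV[R]_n) i : `|x ord0 i| <= enorm x.
Proof.
rewrite -sqrtr_sqr ler_wsqrtr// /dotv (bigD1 i)//= -expr2 lerDl.
by apply: sumr_ge0 => j _; rewrite -expr2 sqr_ge0.
Qed.

Lemma enorm_le_sum n (x : 'rV[R]_n) : enorm x <= \sum_(i < n) `|x ord0 i|.
Proof.
have s0 : 0 <= \sum_(i < n) `|x ord0 i| by exact: sumr_ge0.
rewrite -[leRHS]ger0_norm// -sqrtr_sqr ler_wsqrtr// /dotv expr2 mulr_suml.
apply: ler_sum => i _; rewrite -expr2 -real_normK ?num_real// expr2 ler_wpM2l//.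
by rewrite (bigD1 i)//= lerDl sumr_ge0.
Qed.

Lemma normr_dotv_le n (x y : 'rV[R]_n) :
  `|dotv x y| <= enorm x * \sum_(i < n) `|y ord0 i|.
Proof.
rewrite (le_trans (ler_norm_sum _ _ _))// mulr_sumr ler_sum// => i _.
by rewrite normrM ler_wpM2r// coord_le_enorm.
Qed.

Definition rbox n (a b : R) : set 'rV[R]_n := [set x | forall i, a <= x ord0 i <= b].

Lemma measurable_rbox n a b : measurable (@rbox n a b : set (borel R n)).
Proof.
rewrite (_ : @rbox n a b = \bigcap_(i in [set: 'I_n])
   ((fun x : borel R n => x ord0 i : R) @^-1` `[a, b]%classic)).
  apply: fin_bigcap_measurable => // i _.
  rewrite -[X in measurable X]setTI; exact: (@measurable_coord _ i).
by apply/seteqP; split => [x bx i _|x bx i]; have := bx i; rewrite /= in_itv/=; [apply|apply].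
Qed.

Let tbox n (a b : R) : set (n.-tuple (measurableTypeR R)) :=
  [set t | forall i, a <= (tnth t i : R) <= b].

Let measurable_tbox n a b : measurable (@tbox n a b).
Proof.
rewrite (_ : @tbox n a b = \bigcap_(i in [set: 'I_n])
   ((fun t : n.-tuple (measurableTypeR R) => tnth t i) @^-1` `[a, b]%classic)).
  apply: fin_bigcap_measurable => // i _.
  rewrite -[X in measurable X]setTI; exact: measurable_tnth.
by apply/seteqP; split => [x bx i _|x bx i]; have := bx i; rewrite /= in_itv/=; [apply|apply].
Qed.

Let lebesgue_tbox n (a b : R) : a <= b ->
  (@lebesgue_tuple R n (@tbox n a b) = ((b - a) ^+ n)%:E)%E.
Proof.
move=> ab; elim: n => [|n IH].
  rewrite /= /dirac indicE mem_set//; by case.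
have [m mE] := @lebesgue_tuple_sigma_finite_measure R n.
rewrite /= -mE /pushforward.
rewrite (_ : _ @^-1` _ = `[a, b]%classic `*` @tbox n a b); last first.
  apply/seteqP; split => -[y s] /= H.
    split=> [|i]; first by have := H ord0; rewrite tnth0 /= in_itv.
    by have := H (lift ord0 i); rewrite tnthS.
  move: H => [ys Hs] i; case: (unliftP ord0 i) => [j ->|->].
    by rewrite tnthS; exact: Hs.
  by rewrite tnth0; rewrite /= in_itv in ys.
rewrite product_measure1E//; last exact: measurable_tbox.
have L : (lebesgue_measure `[a, b]%classic = (b - a)%:E :> \bar R)%E.
  rewrite lebesgue_measure_itv/= lte_fin.
  case: ltP => [_|ba]; first by rewrite -EFinB.
  by congr EFin; apply/esym/eqP; rewrite subr_eq0 eq_le ab ba.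
transitivity ((b - a)%:E * ((b - a) ^+ n)%:E)%E; last by rewrite -EFinM exprS.
by congr (_ * _)%E; [exact: L|rewrite mE IH].
Qed.

Lemma lebesgue_rV_rbox n (a b : R) : a <= b ->
  (@lebesgue_rV R n (@rbox n a b) = ((b - a) ^+ n)%:E)%E.
Proof.
move=> ab; rewrite -lebesgue_tbox//; congr (lebesgue_tuple _).
by apply/seteqP; split => t bt i; have := bt i; rewrite mxE.
Qed.

Lemma lebesgue_rV_sigma_finite n : sigma_finite setT (@lebesgue_rV R n).
Proof.
exists (fun N => @rbox n (- N%:R) N%:R).
  apply/esym; rewrite -subTset => x _.
  exists (Num.truncn (enorm x)).+1 => // i.
  rewrite -ler_norml (le_trans (coord_le_enorm x i))//.
  by rewrite ltW// truncnS_gt.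
move=> N; split; first exact: measurable_rbox.
by rewrite lebesgue_rV_rbox ?ltry// ge0_cp.
Qed.

End rV.

HB.instance Definition _ (R : realType) (n : nat) := @Measure_isSigmaFinite.Build _ _ _
  (@lebesgue_rV R n) (lebesgue_rV_sigma_finite n).

(** * Integrals against the spectral density *)

Section powR_extra.
Context {R : realType}.

Lemma powR_le_neg (a b e : R) : 0 < a -> a <= b -> e <= 0 -> b `^ e <= a `^ e.
Proof.
move=> a0 ab e0; have b0 : 0 < b by exact: lt_le_trans ab.
rewrite -[e]opprK !(powRN _ (- e)) lef_pV2 ?posrE ?powR_gt0//.
by apply: ge0_ler_powR; rewrite ?nnegrE ?oppr_ge0// ltW.
Qed.

Lemma powR_exp (a e : R) n : 0 <= a -> (a ^+ n) `^ e = (a `^ e) ^+ n.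
Proof. by move=> a0; rewrite -powR_mulrn// -powRrM mulrC powRrM powR_mulrn// powR_ge0. Qed.

Lemma powR_addX (a e : R) n : 0 < a -> a `^ (e + n%:R) = a `^ e * a ^+ n.
Proof.
move=> a0; rewrite powRD; last by rewrite (gt_eqF a0) implybT.
by rewrite powR_mulrn// ltW.
Qed.

Lemma powR_divr (a b e : R) : 0 < a -> 0 < b -> (a / b) `^ e = a `^ e * b `^ (- e).
Proof.
move=> a0 b0; rewrite powRM ?invr_ge0 ?(ltW a0) ?(ltW b0)//; congr (_ * _).
by rewrite -[b^-1]powR_inv1 ?(ltW b0)// -powRrM mulN1r.
Qed.

Lemma exists_shell (y : R) : 1 <= y -> exists n : nat, 2 ^+ n <= y < 2 ^+ n.+1.
Proof.
move=> y1; have ex : exists n, y < 2 ^+ n.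
  exists (Num.truncn y).+1; rewrite (lt_trans (truncnS_gt _))//.
  by rewrite -natrX ltr_nat ltn_expl.
have [[|n] yn min] := ex_minnP ex; first by rewrite expr0 ltNge y1 in yn.
exists n; rewrite yn andbT leNgt; apply/negP => /min.
by rewrite ltnn.
Qed.

End powR_extra.

Section series_bound.
Context {R : realType} d (T : measurableType d) (mu : {measure set T -> \bar R}).

(** The index [n] may depend on [x]: [g] is then at most the sum of the series. *)
Lemma integral_le_geometric (g : T -> R) (F : nat -> T -> R) (K q : R) :
  measurable_fun setT g -> (forall x, 0 <= g x) ->
  (forall n, measurable_fun setT (F n)) -> (forall n x, 0 <= F n x) ->
  (forall x, exists n, g x <= F n x) -> 0 <= q < 1 -> 0 <= K ->
  (forall n, (\int[mu]_x (F n x)%:E <= (K * q ^+ n)%:E)%E) ->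
  (\int[mu]_x (g x)%:E <= (K / (1 - q))%:E)%E.
Proof.
move=> mg g0 mF F0 gF /andP[q0 q1] K0 FK.
apply: (@le_trans _ _ (\int[mu]_x \sum_(n <oo) (F n x)%:E)%E).
  apply: ge0_le_integral => //.
  - by move=> x _; rewrite lee_fin.
  - exact/measurable_EFinP.
  - apply: ge0_emeasurable_sum => //.
      by move=> n x _ _; rewrite lee_fin.
    by move=> n _; apply/measurable_EFinP.
  - move=> x _; have [n gn] := gF x.
    apply: (@le_trans _ _ (F n x)%:E); first by rewrite lee_fin.
    apply: (le_trans _ (nneseries_lim_ge n.+1 _)); last by move=> i _ _; rewrite lee_fin.
    rewrite big_nat_recr//= leeDr// sume_ge0// => i _.
    by rewrite lee_fin.
rewrite integral_nneseries//; last 2 first.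
- by move=> n; apply/measurable_EFinP.
- by move=> n x _; rewrite lee_fin.
apply: (@le_trans _ _ (\sum_(n <oo) (K * q ^+ n)%:E)%E).
  apply: lee_nneseries => [n _ _|n _]; last exact: FK.
  by apply: integral_ge0 => x _; rewrite lee_fin.
apply: lime_le.
  by apply: is_cvg_nneseries => n _ _; rewrite lee_fin mulr_ge0// exprn_ge0.
apply: nearW => n; rewrite sumEFin lee_fin -mulr_sumr ler_wpM2l//.
have q10 : 0 < 1 - q by rewrite subr_gt0.
rewrite -[leRHS]div1r ler_pdivlMr//.
have -> : \sum_(0 <= i < n) q ^+ i = (1 - q ^+ n) / (1 - q).
  elim: n => [|n IH]; first by rewrite big_nil expr0 subrr mul0r.
  by rewrite big_nat_recr//= IH exprS; field; rewrite gt_eqF.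
by rewrite divfK ?gt_eqF// gerBl exprn_ge0.
Qed.

End series_bound.

Section riesz.
Context {R : realType} (k : nat) (beta : R).
Hypothesis beta_gt0 : 0 < beta.
Hypothesis beta_lt2 : beta < 2.
Hypothesis beta_ltk : beta < k%:R.
Notation nu := (@lebesgue_rV R k).

(** The density of the spectral measure of the noise. *)
Definition weight (xi : 'rV[R]_k) : R := enorm xi `^ (- k%:R + beta).

(** Up to a constant, a bound for the spectral density of a squared increment of
    the solution over the distance [delta]. *)
Definition riesz (delta : R) (xi : 'rV[R]_k) : R :=
  Num.min 1 (delta ^+ 2 * enorm xi ^+ 2) / enorm xi ^+ 2 * weight xi.

(* The larger of the ratios of the two geometric series in [integral_riesz_le]. *)
Let rk : R := Num.max (2 `^ (beta - 2)) (2 `^ (- beta)).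
Definition riesz_const : R := 2 * 4 ^+ k / (1 - rk).

Let rk01 : 0 <= rk < 1.
Proof.
rewrite le_max powR_ge0/= gt_max -opprB !two_powRN_lt1//.
by rewrite subr_gt0.
Qed.

Lemma measurable_weight : measurable_fun setT (weight : borel R k -> R).
Proof.
apply: (@measurableT_comp _ _ _ _ _ _ (fun y => y `^ (- k%:R + beta))).
  exact: measurable_powR.
exact: measurable_enorm.
Qed.

Lemma measurable_enorm_sqrV : measurable_fun setT (fun x : borel R k => (enorm x ^+ 2)^-1).
Proof.
under eq_fun do rewrite -powR_inv1 ?sqr_ge0//.
apply: (@measurableT_comp _ _ _ _ _ _ (fun y : R => y `^ (-1))).
  exact: measurable_powR.
by apply: measurable_funX; exact: measurable_enorm.
Qed.

Lemma measurable_riesz delta : measurable_fun setT (riesz delta : borel R k -> R).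
Proof.
have me2 : measurable_fun setT (fun x : borel R k => enorm x ^+ 2).
  by apply: measurable_funX; exact: measurable_enorm.
apply: measurable_funM; last exact: measurable_weight.
apply: measurable_funM.
  by apply: measurable_minr => //; exact: measurable_funM.
exact: measurable_enorm_sqrV.
Qed.

Lemma riesz_ge0 delta xi : 0 <= riesz delta xi.
Proof.
rewrite mulr_ge0 ?powR_ge0// divr_ge0 ?sqr_ge0// le_min ler01/=.
by rewrite mulr_ge0 ?sqr_ge0.
Qed.

Lemma riesz_const_ge0 : 0 <= riesz_const.
Proof.
have /andP[_ r1] := rk01.
by rewrite divr_ge0 ?mulr_ge0 ?exprn_ge0// subr_ge0 ltW.
Qed.

(** The shells [2^n <= delta * |xi| < 2^(n+1)] and
    [2^-(n+1) < delta * |xi| <= 2^-n] cover the nonzero frequencies.  On each of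
    them the integrand is bounded by a constant and the shell is enclosed in a
    cube; constant times volume decays like [2^((beta - 2) * n)] for the first
    family and like [2^(- beta * n)] for the second. *)
Lemma integral_riesz_le delta : 0 < delta ->
  (\int[nu]_xi (riesz delta xi)%:E <= (riesz_const * delta `^ (2 - beta))%:E)%E.
Proof.
move=> d0; pose p := - k%:R + beta.
have p0 : p < 0 by rewrite /p addrC subr_lt0.
pose a n : R := (2 ^+ n / delta) `^ (p - 2).
pose A n : R := 2 * (2 ^+ n / delta).
pose B n : R := 2 * (2 ^- n.+1 / delta).
pose b n : R := delta ^+ 2 * (2 ^- n.+1 / delta) `^ p.
pose F n (xi : borel R k) : R := a n * \1_(rbox (- A n) (A n)) xi + b n * \1_(rbox (- B n) (B n)) xi.
have A0 n : 0 < A n by rewrite mulr_gt0// divr_gt0// exprn_gt0.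
have B0 n : 0 < B n by rewrite mulr_gt0// divr_gt0// invr_gt0 exprn_gt0.
have a0 n : 0 <= a n by exact: powR_ge0.
have b0 n : 0 <= b n by apply: mulr_ge0; [exact: sqr_ge0|exact: powR_ge0].
have F0 n x : 0 <= F n x by apply: addr_ge0; apply: mulr_ge0.
have mbox r : measurable (rbox (- r) r : set (borel R k)) by exact: measurable_rbox.
have /andP[r0 r1] := rk01.
have -> : riesz_const * delta `^ (2 - beta) = (2 * 4 ^+ k * delta `^ (2 - beta)) / (1 - rk).
  by rewrite /riesz_const mulrAC.
apply: (@integral_le_geometric _ _ _ _ _ F) => //.
- exact: measurable_riesz.
- exact: riesz_ge0.
- move=> n; apply: measurable_funD; apply: measurable_funM => //; exact: measurable_indic.
- move=> x; have en0 := enorm_ge0 x.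
  have mem r : enorm x <= r -> x \in (rbox (- r) r : set (borel R k)).
    by move=> xr; rewrite inE => i; rewrite -ler_norml (le_trans (coord_le_enorm x i)).
  have [x0|xn0] := eqVneq (enorm x) 0.
    by exists 0%N; rewrite /riesz x0 expr0n invr0 mulr0 mul0r.
  have x_gt0 : 0 < enorm x by rewrite lt0r xn0.
  have x2 : 0 < enorm x ^+ 2 by rewrite exprn_gt0.
  have y0 : 0 < delta * enorm x by rewrite mulr_gt0.
  have [y1|y1] := leP 1 (delta * enorm x).
    have [n /andP[n1 n2]] := exists_shell y1; exists n.
    apply: (@le_trans _ _ (a n * \1_(rbox (- A n) (A n)) (x : borel R k))); last first.
      by rewrite lerDl mulr_ge0.
    rewrite indicE mem; last first.
      by rewrite /A mulrA -exprS ler_pdivlMr// mulrC ltW.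
    rewrite mulr1 (@le_trans _ _ (enorm x `^ (p - 2)))//; last first.
      apply: powR_le_neg; rewrite ?divr_gt0 ?exprn_gt0//.
        by rewrite ler_pdivrMr// mulrC.
      by rewrite subr_le0 (le_trans (ltW p0)).
    have e : weight x = enorm x `^ (p - 2) * enorm x ^+ 2 by rewrite -powR_addX// subrK.
    rewrite /riesz e (_ : _ * (_ * _) = Num.min 1 (delta ^+ 2 * enorm x ^+ 2) * enorm x `^ (p - 2)).
      by rewrite ler_piMl ?powR_ge0// ge_min lexx.
    by field; rewrite gt_eqF.
  have [n /andP[n1 n2]] : exists n : nat, 2 ^+ n <= (delta * enorm x)^-1 < 2 ^+ n.+1.
    by apply: exists_shell; rewrite invf_ge1// ltW.
  exists n; apply: (@le_trans _ _ (b n * \1_(rbox (- B n) (B n)) (x : borel R k))); last first.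
    by rewrite lerDr mulr_ge0.
  rewrite indicE mem; last first.
    rewrite /B exprS invfM mulrA mulrA mulfV// mul1r ler_pdivlMr// mulrC.
    by rewrite -[leLHS]invrK lef_pV2 ?posrE ?invr_gt0 ?exprn_gt0.
  rewrite mulr1 (@le_trans _ _ (delta ^+ 2 * enorm x `^ p))//.
    rewrite /riesz /weight -/p ler_wpM2r ?powR_ge0// ler_pdivrMr//.
    by rewrite ge_min lexx orbT.
  rewrite ler_wpM2l ?sqr_ge0//; apply: powR_le_neg; last exact: ltW.
    by rewrite divr_gt0// invr_gt0 exprn_gt0.
  rewrite ler_pdivrMr// mulrC -[leRHS]invrK lef_pV2 ?posrE ?invr_gt0 ?exprn_gt0//.
  exact: ltW.
- by rewrite !mulr_ge0 ?powR_ge0// exprn_ge0.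
- move=> n; have K0 : 0 <= 4 ^+ k * delta `^ (2 - beta) by rewrite mulr_ge0 ?powR_ge0 ?exprn_ge0.
  have vol r c : 0 <= r -> 0 <= c ->
      (\int[nu]_x (c * \1_(rbox (- r) r) x)%:E = (c * (2 * r) ^+ k)%:E)%E.
    move=> r_ge0 c0; under eq_integral do rewrite EFinM.
    have V : lebesgue_rV (rbox (- r) r : set (borel R k)) = ((2 * r) ^+ k)%:E.
      by rewrite lebesgue_rV_rbox ?ge0_cp// opprK mulr2n mulrDl mul1r.
    rewrite ge0_integralZl//.
    - rewrite EFinM; congr (_ * _)%E.
      by rewrite integral_indic// setIT; exact: V.
    - by apply/measurable_EFinP; exact: measurable_indic.
  have quad (s : R) : 2 * (2 * s) = 4 * s by ring.
  have s1 : 0 < 2 ^+ n / delta by rewrite divr_gt0// exprn_gt0.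
  have s2 : 0 < 2 ^- n.+1 / delta by rewrite divr_gt0// invr_gt0 exprn_gt0.
  under eq_integral do rewrite /F EFinD.
  rewrite ge0_integralD//; last 4 first.
  - by move=> x _; rewrite lee_fin mulr_ge0.
  - by apply/measurable_EFinP; apply: measurable_funM => //; exact: measurable_indic.
  - by move=> x _; rewrite lee_fin mulr_ge0.
  - by apply/measurable_EFinP; apply: measurable_funM => //; exact: measurable_indic.
  rewrite !vol ?(ltW (A0 n)) ?(ltW (B0 n))//.
  rewrite -EFinD lee_fin.
  have -> : a n * (2 * A n) ^+ k = 4 ^+ k * delta `^ (2 - beta) * (2 `^ (beta - 2)) ^+ n.
    rewrite /a /A quad exprMn mulrCA -powR_addX//.
    rewrite (_ : p - 2 + k%:R = beta - 2); last by rewrite /p; ring.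
    rewrite powR_divr ?exprn_gt0// powR_exp// opprB (mulrC (_ ^+ n)) mulrA.
    by [].
  have -> : b n * (2 * B n) ^+ k = 4 ^+ k * delta `^ (2 - beta) * (2 `^ (- beta)) ^+ n.+1.
    rewrite /b /B quad exprMn; set s := 2 ^- n.+1 / delta in s2 *.
    rewrite (_ : delta ^+ 2 * s `^ p * _ = delta ^+ 2 * 4 ^+ k * (s `^ p * s ^+ k)); last by ring.
    rewrite -powR_addX// (_ : p + k%:R = beta); last by rewrite /p addrAC addNr add0r.
    rewrite /s powR_divr ?invr_gt0 ?exprn_gt0//.
    have -> : (2 ^- n.+1 : R) `^ beta = (2 `^ (- beta)) ^+ n.+1.
      by rewrite -exprVn powR_exp ?invr_ge0// -powR_inv1// -powRrM mulN1r.
    rewrite (_ : delta `^ (2 - beta) = delta ^+ 2 * delta `^ (- beta)); last first.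
      by rewrite mulrC -powR_addX// addrC.
    by ring.
  set D := 4 ^+ k * _ in K0 *.
  rewrite (_ : 2 * 4 ^+ k * _ * _ = D * rk ^+ n + D * rk ^+ n); last by rewrite /D; ring.
  rewrite lerD// ler_wpM2l//.
    by apply: lerXn2r; rewrite ?nnegrE ?powR_ge0// le_max lexx.
  apply: (@le_trans _ _ ((2 `^ (- beta)) ^+ n)).
    by rewrite exprS ler_piMl ?exprn_ge0 ?powR_ge0// ltW// two_powRN_lt1.
  by apply: lerXn2r; rewrite ?nnegrE ?powR_ge0// le_max lexx orbT.
Qed.

End riesz.

(** * The covariance as an integral over time and frequency *)

Section covariance.
Context {R : realType} (k : nat) (beta T : R).
Hypothesis beta_gt0 : 0 < beta.
Hypothesis beta_lt2 : beta < 2.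
Hypothesis beta_ltk : beta < k%:R.
Hypothesis T_gt0 : 0 < T.
Notation mu := (@lebesgue_measure R).
Notation nu := (@lebesgue_rV R k).
Notation RX := (measurableTypeR R * borel R k)%type.
Notation m := (lebesgue_measure \x @lebesgue_rV R k)%E.

(** The truncation makes the propagator vanish for [r >= t], so that the time
    integral of the covariance extends to all of [0, T]; the denominators
    [|xi|] are collected in [spectral]. *)
Definition propagator (t r : R) (xi : 'rV[R]_k) : R :=
  sin (Num.max (t - r) 0 * enorm xi).

Definition spectral (t s : R) (z : 'rV[R]_k) (p : RX) : R :=
  \1_(`[0, T]%classic : set (measurableTypeR R)) p.1 *
  (cos (dotv p.2 z) * (propagator t p.1 p.2 * propagator s p.1 p.2 / enorm p.2 ^+ 2) *
   weight beta p.2).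

Definition envelope (delta : R) (p : RX) : R :=
  \1_(`[0, T]%classic : set (measurableTypeR R)) p.1 * riesz beta delta p.2.

Let mI : measurable_fun setT (fun p : RX => \1_(`[0, T]%classic : set (measurableTypeR R)) p.1 : R).
Proof.
rewrite (_ : (fun p : RX => _) = \1_(`[0, T]%classic `*` setT : set RX)).
  by apply: measurable_indic; apply: measurableX => //; exact: measurable_itv.
apply/funext => p; rewrite !indicE; congr ((nat_of_bool _)%:R); apply/idP/idP.
  by rewrite !inE => ?; split.
by rewrite !inE => -[].
Qed.

Lemma measurable_propagator t :
  measurable_fun setT (fun p : RX => propagator t p.1 p.2).
Proof.
apply: (@measurableT_comp _ _ _ _ _ _ sin).
  by apply: continuous_measurable_fun; exact: continuous_sin.
apply: measurable_funM.
  by apply: measurable_maxr => //; apply: measurable_funB.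
apply: (@measurableT_comp _ _ _ _ _ _ (fun x : borel R k => enorm x)).
  exact: measurable_enorm.
exact: measurable_snd.
Qed.

Let msnd (f : borel R k -> R) : measurable_fun setT f ->
  measurable_fun setT (fun p : RX => f p.2).
Proof. by move=> mf; apply: measurableT_comp => //; exact: measurable_snd. Qed.

Lemma measurable_spectral t s z : measurable_fun setT (spectral t s z).
Proof.
apply: measurable_funM; first exact: mI.
apply: measurable_funM; last by apply: (@msnd (weight beta)); exact: measurable_weight.
apply: measurable_funM.
  apply: measurable_cosT; apply: (@msnd (fun x => dotv x z)).
  exact: measurable_dotv.
apply: measurable_funM; last by apply: (@msnd (fun x => (enorm x ^+ 2)^-1)); exact: measurable_enorm_sqrV.
by apply: measurable_funM; exact: measurable_propagator.
Qed.

Lemma measurable_envelope delta : measurable_fun setT (envelope delta).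
Proof. by apply: measurable_funM; [exact: mI|apply: (@msnd (riesz beta delta)); exact: measurable_riesz]. Qed.

Lemma envelope_ge0 delta p : 0 <= envelope delta p.
Proof. by rewrite mulr_ge0 ?riesz_ge0// indicE; case: (_ \in _). Qed.

Lemma integral_envelope delta : 0 < delta ->
  (\int[m]_p (envelope delta p)%:E <=
   (T * (riesz_const k beta * delta `^ (2 - beta)))%:E)%E.
Proof.
move=> d0; rewrite fubini_tonelli1//; last 2 first.
- by apply/measurable_EFinP; exact: measurable_envelope.
- by move=> p; rewrite lee_fin envelope_ge0.
rewrite /fubini_F /envelope /=.
set K := riesz_const k beta * delta `^ (2 - beta).
apply: (@le_trans _ _ (\int[mu]_r (K%:E * (\1_(`[0, T]%classic : set (measurableTypeR R)) r)%:E))%E).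
  apply: ge0_le_integral => //.
  - by move=> x _; apply: integral_ge0 => y _; rewrite lee_fin (envelope_ge0 delta (x, y)).
  - apply: (@measurable_fun_fubini_tonelli_F _ _ _ _ _ nu (fun p => (envelope delta p)%:E)).
      by apply/measurable_EFinP; exact: measurable_envelope.
    by move=> p; rewrite lee_fin envelope_ge0.
  - under eq_fun do rewrite -EFinM.
    apply/measurable_EFinP; apply: measurable_funM => //.
  - move=> r _; under eq_integral do rewrite EFinM.
    rewrite ge0_integralZl//.
    + by rewrite muleC lee_wpmul2r ?lee_fin// integral_riesz_le.
    + by apply/measurable_EFinP; exact: measurable_riesz.
    + by move=> x _; rewrite lee_fin riesz_ge0.
rewrite ge0_integralZl//; last 2 first.
- by apply/measurable_EFinP; apply: measurable_indic; exact: measurable_itv.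
- by rewrite lee_fin mulr_ge0 ?powR_ge0 ?riesz_const_ge0.
have L : (lebesgue_measure (`[0%R, T]%classic : set (measurableTypeR R)) = T%:E)%E.
  by rewrite lebesgue_measure_itv/= lte_fin T_gt0 oppr0 adde0.
rewrite integral_indic// setIT (mulrC T K) (EFinM K) lee_wpmul2l//.
  by rewrite lee_fin mulr_ge0 ?powR_ge0 ?riesz_const_ge0.
by rewrite le_eqVlt; apply/orP; left; apply/eqP; exact: L.
Qed.

Lemma integrable_envelope delta : 0 < delta -> m.-integrable setT (EFin \o envelope delta).
Proof.
move=> d0; apply/integrableP; split.
  by apply/measurable_EFinP; exact: measurable_envelope.
under eq_integral do rewrite /= ger0_norm ?envelope_ge0//.
exact: le_lt_trans (integral_envelope d0) (ltry _).
Qed.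

Lemma normr_propagator_le1 t r xi : `|propagator t r xi| <= 1.
Proof. exact: sin_max. Qed.

Lemma normr_propagator_le t r xi : 0 <= r -> 0 <= t <= T ->
  `|propagator t r xi| <= T * enorm xi.
Proof.
move=> r0 /andP[t0 tT]; have := sin_lipschitz (Num.max (t - r) 0 * enorm xi) 0.
rewrite sin0 !subr0 => /le_trans; apply.
rewrite normrM (ger0_norm (enorm_ge0 _)) ler_wpM2r ?enorm_ge0// ger0_norm ?le_max ?lexx ?orbT//.
by rewrite ge_max (ltW T_gt0) andbT; lra.
Qed.

(** One integrable majorant for all times and positions, since
    [|sin y| <= min 1 |y|]. *)
Lemma spectral_le t s z p : 0 <= t <= T -> 0 <= s <= T ->
  `|spectral t s z p| <= envelope T p.
Proof.
move=> tT sT; rewrite /spectral /envelope normrM indicE.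
have [|_] := boolP (_ \in _); last by rewrite normr0 !mul0r.
rewrite inE /= in_itv /= => /andP[r0 _]; rewrite normr1 !mul1r.
rewrite normrM /riesz (ger0_norm (powR_ge0 _ _)) ler_wpM2r ?powR_ge0//.
rewrite normrM -[leRHS]mul1r ler_pM ?normr_cos_le1//.
rewrite normrM [`|_^-1|]ger0_norm ?invr_ge0 ?sqr_ge0// ler_wpM2r ?invr_ge0 ?sqr_ge0//.
rewrite normrM le_min; apply/andP; split.
  by rewrite -[leRHS]mulr1 ler_pM ?normr_propagator_le1.
by rewrite -exprMn expr2 ler_pM ?normr_propagator_le.
Qed.

Lemma integrable_spectral t s z : 0 <= t <= T -> 0 <= s <= T ->
  m.-integrable setT (EFin \o spectral t s z).
Proof.
move=> tT sT; apply: ler_integrable (integrable_envelope T_gt0).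
  exact: measurable_spectral.
by move=> p; exact: spectral_le.
Qed.

(** Extending the time integral by zero and applying Fubini turns covariances at
    different points into integrals against one measure, where they can be
    combined linearly. *)
Lemma wave_covarianceE t s x y : 0 <= t <= T -> 0 <= s <= T ->
  wave_covariance beta t s x y = (\int[m]_p spectral t s (x - y) p)%:E.
Proof.
move=> tT sT; have := integrable_spectral (x - y) tT sT => iS.
rewrite /Rintegral fineK; last exact: integrable_fin_num.
rewrite -(integral12_prod_meas1 iS) /wave_covariance integral_mkcond.
apply: eq_integral => r _; rewrite patchE /fubini_F /=.
case: ifPn => [|rts].
  rewrite inE /= in_itv/= le_min => /and3P[r0 rt rs].
  apply: eq_integral => xi _; congr EFin; rewrite /spectral /propagator /=.
  rewrite indicE mem_set; last first.
    by rewrite /= in_itv/= r0 (le_trans rt)//; case/andP: tT.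
  by rewrite mul1r !max_l ?subr_ge0.
rewrite integral0_eq// => xi _; congr EFin; rewrite /spectral /propagator /=.
rewrite indicE; have [|_] := boolP (_ \in _); last by rewrite mul0r.
rewrite inE /= in_itv /= => /andP[r0 rT].
have [rt|tr] := leP r t; last first.
  by rewrite (max_r (y := 0)) ?subr_le0 ?(ltW tr)// mul0r sin0 !(mul0r, mulr0).
have [rs|sr] := leP r s; last first.
  by rewrite [Num.max (s - r) 0]max_r ?subr_le0 ?(ltW sr)// mul0r sin0 !(mul0r, mulr0).
exfalso; move/negP: rts; apply; rewrite inE /= in_itv/= r0 le_min rt rs//.
Qed.

End covariance.

(** * Regularity and nondegeneracy of the covariance *)

Section covariance_bounds.
Context {R : realType} (k : nat) (beta T : R).
Hypothesis beta_gt0 : 0 < beta.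
Hypothesis beta_lt2 : beta < 2.
Hypothesis beta_ltk : beta < k%:R.
Hypothesis T_gt0 : 0 < T.
Notation RX := (measurableTypeR R * borel R k)%type.
Notation m := (lebesgue_measure \x @lebesgue_rV R k)%E.
Notation S := (@spectral R k beta T).

Definition spectral_int (t s : R) (z : 'rV[R]_k) : R := \int[m]_p S t s z p.

Lemma normr_propagator_sub t s r (xi : 'rV[R]_k) :
  `|propagator t r xi - propagator s r xi| <= `|t - s| * enorm xi.
Proof.
rewrite (le_trans (sin_lipschitz _ _))// -mulrBl normrM (ger0_norm (enorm_ge0 _)).
rewrite ler_wpM2r ?enorm_ge0//.
rewrite (_ : t - s = (t - r) - (s - r)); last by ring.
move: (t - r) (s - r) => a b; rewrite ler_norml !maxEle.
have := ler_norm (a - b); have := ler_norm (b - a); rewrite distrC.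
by case: (lerP a 0); case: (lerP b 0) => ? ? ? ?; apply/andP; split; lra.
Qed.

(** With [a] and [b] the propagators and [c] the cosine, the integrand is a
    multiple of [a^2 + b^2 - 2abc = (a - b)^2 + 2ab(1 - c)], and each of these two
    terms is at most [4 * min 1 (delta^2 |xi|^2)]. *)
Lemma spectral_increment_le t s (z : 'rV[R]_k) delta p :
  `|t - s| <= delta -> \sum_(i < k) `|z ord0 i| <= delta ->
  S t t 0 p + S s s 0 p <= 2 * S t s z p + 8 * envelope beta T delta p.
Proof.
move=> tsd zd; rewrite /spectral /envelope /riesz.
set a := propagator t _ _; set b := propagator s _ _.
set e := enorm p.2; set W := weight beta p.2.
have -> : cos (dotv p.2 (0 : 'rV[R]_k)) = 1.
  by rewrite /dotv big1 ?cos0// => i _; rewrite mxE mulr0.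
set c := cos _; set M := Num.min _ _; set X := (\1__ _).
have d0 : 0 <= delta by exact: le_trans tsd.
have e0 : 0 <= e by exact: enorm_ge0.
have key : a ^+ 2 + b ^+ 2 - 2 * (c * (a * b)) <= 8 * M.
  have a1 : `|a| <= 1 by exact: sin_max.
  have b1 : `|b| <= 1 by exact: sin_max.
  have c1 : -1 <= c <= 1 by rewrite cos_geN1 cos_le1.
  have sub1 : (a - b) ^+ 2 <= 4 * M.
    rewrite -ler_pdivrMl// le_min; apply/andP; split.
      rewrite ler_pdivrMl// mulr1 -real_normK ?num_real//.
      rewrite (_ : 4 = 2 ^+ 2); last by rewrite expr2; ring.
      apply: lerXn2r; rewrite ?nnegrE// (le_trans (ler_normB _ _))//.
      by have := lerD a1 b1.
    rewrite ler_pdivrMl// -exprMn.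
    have : (a - b) ^+ 2 <= (delta * e) ^+ 2.
      rewrite -real_normK ?num_real//; apply: lerXn2r; rewrite ?nnegrE ?mulr_ge0//.
      by rewrite (le_trans (normr_propagator_sub _ _ _ _))// ler_wpM2r.
    by have := sqr_ge0 (delta * e); lra.
  have ab : a * b <= 1.
    by rewrite (le_trans (ler_norm _))// normrM -[leRHS]mulr1 ler_pM.
  have sub2 : 2 * (1 - c) <= 4 * M.
    rewrite -ler_pdivrMl// le_min; apply/andP; split; first by lra.
    have := onem_cos_le (dotv p.2 z); rewrite -/c.
    have : dotv p.2 z ^+ 2 <= delta ^+ 2 * e ^+ 2.
      rewrite -exprMn -real_normK ?num_real//; apply: lerXn2r; rewrite ?nnegrE ?mulr_ge0//.
      by rewrite (le_trans (normr_dotv_le _ _))// mulrC ler_wpM2r.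
    by have := mulr_ge0 (sqr_ge0 delta) (sqr_ge0 e); lra.
  have : 2 * ((a * b) * (1 - c)) <= 2 * (1 - c).
    by rewrite ler_wpM2l// ler_piMl// subr_ge0; case/andP: c1.
  have -> : a ^+ 2 + b ^+ 2 - 2 * (c * (a * b)) = (a - b) ^+ 2 + 2 * ((a * b) * (1 - c)) by ring.
  by lra.
have X0 : 0 <= X / e ^+ 2 * W.
  by rewrite mulr_ge0 ?powR_ge0// divr_ge0 ?sqr_ge0// /X indicE.
rewrite -subr_ge0.
have -> : 2 * (X * (c * (a * b / e ^+ 2) * W)) + 8 * (X * (M / e ^+ 2 * W)) -
    (X * (1 * (a * a / e ^+ 2) * W) + X * (1 * (b * b / e ^+ 2) * W)) =
    (X / e ^+ 2 * W) * (8 * M - (a ^+ 2 + b ^+ 2 - 2 * (c * (a * b)))) by ring.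
by rewrite mulr_ge0// subr_ge0.
Qed.

Let intZ c (f : RX -> R) : m.-integrable setT (EFin \o f) ->
  m.-integrable setT (EFin \o (fun p => c * f p)).
Proof. by move=> fi; rewrite /comp; under eq_fun do rewrite EFinM; exact: integrableZl. Qed.

Lemma spectral_int_increment_le t s (z : 'rV[R]_k) delta :
  0 <= t <= T -> 0 <= s <= T -> 0 < delta ->
  `|t - s| <= delta -> \sum_(i < k) `|z ord0 i| <= delta ->
  spectral_int t t 0 + spectral_int s s 0 - 2 * spectral_int t s z <=
  8 * (T * (riesz_const k beta * delta `^ (2 - beta))).
Proof.
move=> tT sT d0 tsd zd; rewrite lerBlDl.
have iS t1 s1 z1 := @integrable_spectral R k beta T beta_gt0 beta_lt2 beta_ltk T_gt0 t1 s1 z1.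
have iE := integrable_envelope beta_gt0 beta_lt2 beta_ltk T_gt0 d0.
apply: (@le_trans _ _ (2 * spectral_int t s z + 8 * \int[m]_p envelope beta T delta p)).
  rewrite /spectral_int -!RintegralZl//; last exact: iS.
  rewrite -!RintegralD//; first apply: le_Rintegral => //.
  - by apply: integrable_add; exact: iS.
  - by apply: integrable_add; apply: intZ => //; exact: iS.
  - by move=> p _; exact: spectral_increment_le.
  - by apply: intZ; exact: iS.
  - exact: intZ.
  - exact: iS.
  - exact: iS.
rewrite lerD2l ler_wpM2l// -lee_fin /Rintegral fineK; last exact: integrable_fin_num.
exact: integral_envelope.
Qed.

(** The integrand is nonnegative.  For times [r <= t0 / 2] and frequencies with
    [|xi| <= 1 / T], the arguments of the sines lie in [0, 1], where the sine is
    at least half its argument; there the integrand is bounded below. *)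
Lemma spectral_int_gt0 t0 : 0 < t0 -> t0 < T -> exists2 tau2, 0 < tau2 &
  forall t, t0 <= t <= T -> tau2 <= spectral_int t t 0.
Proof.
move=> t00 t0T; have k0 : 0 < k%:R :> R by exact: lt_trans beta_ltk.
have kn0 : (k != 0)%N by move: k0; rewrite ltr0n lt0n.
(* Then [2 * a * k = 1 / T] bounds the norm on the box [B]. *)
pose a := (2 * k%:R * T)^-1.
have a0 : 0 < a by rewrite invr_gt0 !mulr_gt0.
pose E := `[0, t0 / 2]%classic : set (measurableTypeR R).
pose B := rbox a (2 * a) : set (borel R k).
pose c := t0 ^+ 2 / 16 * T^-1 `^ (- k%:R + beta).
have c0 : 0 < c by rewrite mulr_gt0 ?powR_gt0 ?invr_gt0// divr_gt0 ?exprn_gt0.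
have mE : measurable E by exact: measurable_itv.
have mB : measurable B by exact: measurable_rbox.
exists (c * (t0 / 2 * a ^+ k)); first by apply: mulr_gt0 => //; apply: mulr_gt0; [rewrite divr_gt0|rewrite exprn_gt0].
move=> t /andP[t0t tT]; have tT' : 0 <= t <= T by rewrite tT (le_trans (ltW t00)).
have iS := @integrable_spectral R k beta T beta_gt0 beta_lt2 beta_ltk T_gt0 t t 0 tT' tT'.
have S0 p : 0 <= S t t 0 p.
  rewrite /spectral -expr2 mulr_ge0 ?indicE//; apply: mulr_ge0; last exact: powR_ge0.
  rewrite mulr_ge0 ?divr_ge0 ?sqr_ge0//.
  by rewrite /dotv big1 ?cos0// => i _; rewrite mxE mulr0.
have le p : c * \1_(E `*` B) p <= S t t 0 p.
  rewrite indicE; have [|_] := boolP (_ \in _); last by rewrite mulr0; exact: S0.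
  rewrite inE mulr1 => -[]; rewrite /E /= in_itv/= => /andP[r0 rt0] xB.
  rewrite /spectral indicE mem_set ?mul1r; last first.
    by rewrite /= in_itv/= r0 (le_trans rt0)//; lra.
  have -> : cos (dotv p.2 (0 : 'rV[R]_k)) = 1.
    by rewrite /dotv big1 ?cos0// => i _; rewrite mxE mulr0.
  rewrite mul1r /propagator max_l; last by lra.
  set e := enorm p.2; set r := p.1 in r0 rt0 *.
  have e0 : 0 < e.
    have [i] : exists i : 'I_k, true.
      by case: (k) kn0 => // n _; exists ord0.
    by move=> _; apply: lt_le_trans (coord_le_enorm p.2 i); have := xB i; have := ler_norm (p.2 ord0 i); lra.
  have eT : e <= T^-1.
    rewrite (le_trans (enorm_le_sum _))//.
    apply: (@le_trans _ _ (\sum_(i < k) (2 * a))).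
      by apply: ler_sum => i _; have := xB i; rewrite ler_norml; lra.
    rewrite sumr_const card_ord -mulr_natr /a le_eqVlt; apply/orP; left; apply/eqP.
    by field; rewrite (gt_eqF k0) (gt_eqF T_gt0).
  rewrite /c /weight -/e ler_pM ?powR_ge0//.
  - by rewrite divr_ge0 ?sqr_ge0.
  - have h : t0 / 4 * e <= sin ((t - r) * e).
      have : (t - r) * e / 2 <= sin ((t - r) * e).
        apply: sin_ge_half; rewrite mulr_ge0 ?(ltW e0)//=; last by lra.
        by rewrite -(mulfV (lt0r_neq0 T_gt0)) ler_pM ?(ltW e0)//; lra.
      apply: le_trans; rewrite (mulrAC (t - r)) ler_wpM2r ?(ltW e0)//; lra.
    rewrite ler_pdivlMr ?exprn_gt0//.
    apply: (@le_trans _ _ ((t0 / 4 * e) * (t0 / 4 * e))).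
      by rewrite le_eqVlt; apply/orP; left; apply/eqP; field.
    by rewrite ler_pM// mulr_ge0 ?(ltW e0)// divr_ge0 ?(ltW t00).
  - apply: powR_le_neg => //.
    by rewrite addrC subr_le0 ltW.
have mS : measurable_fun setT (fun p : RX => c * \1_(E `*` B) p).
  by apply: measurable_funM => //; apply: measurable_indic; exact: measurableX.
have vE : (lebesgue_measure E = (t0 / 2)%:E)%E.
  by rewrite lebesgue_measure_itv/= lte_fin divr_gt0// oppr0 adde0.
have vB : lebesgue_rV B = (a ^+ k)%:E.
  rewrite lebesgue_rV_rbox; first by congr ((_ ^+ k)%:E); ring.
  by rewrite mulr2n mulrDl mul1r lerDl ltW.
have vm : (m (E `*` B) = (t0 / 2 * a ^+ k)%:E)%E.
  rewrite product_measure1E// EFinM; congr (_ * _)%E; [exact: vE|exact: vB].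
have intE : \int[m]_p (c * \1_(E `*` B) p) = c * (t0 / 2 * a ^+ k).
  rewrite /Rintegral; under eq_integral do rewrite EFinM.
  rewrite ge0_integralZl//.
  - rewrite integral_indic//; last exact: measurableX.
    rewrite setIT (_ : (c%:E * _)%E = (c * (t0 / 2 * a ^+ k))%:E)// (EFinM c).
    congr (_ * _)%E; exact: vm.
  - by apply/measurable_EFinP; apply: measurable_indic; exact: measurableX.
  - by rewrite lee_fin ltW.
rewrite -intE; apply: le_Rintegral => //.
apply: ler_integrable iS => // p.
by rewrite ger0_norm// mulr_ge0 ?(ltW c0)// indicE.
Qed.

End covariance_bounds.

(** * Decoupling the solution *)

Section solution.
Context {R : realType} (k d : nat) (T beta : R) (sigma : 'M[R]_d).
Context dO (Omega : measurableType dO) (P : probability Omega R).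
Variable u : R -> 'rV[R]_k -> Omega -> 'rV[R]_d.
Hypothesis u_sol : is_wave_solution T beta sigma P u.
Hypothesis beta_gt0 : 0 < beta.
Hypothesis beta_lt2 : beta < 2.
Hypothesis beta_ltk : beta < k%:R.
Hypothesis T_gt0 : 0 < T.

Lemma solution_gaussian2 t s x y (a b : 'rV[R]_d) : 0 <= t <= T -> 0 <= s <= T ->
  exists v, gaussian P (fun w => dotv a (u t x w) + dotv b (u s y w)) v.
Proof.
move=> tT sT; have [cg _ _] := u_sol; apply: centered_gaussian_gaussian.
have := cg 2 (fun l => if l == ord0 then t else s) (fun l => if l == ord0 then x else y)
  (fun l => if l == ord0 then a else b).
under [X in centered_gaussian P X]eq_fun do rewrite !big_ord_recl big_ord0 addr0 /=.
by apply => l; case: ifP.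
Qed.

Lemma dotv0l n (y : 'rV[R]_n) : dotv 0 y = 0.
Proof. by rewrite /dotv big1// => i _; rewrite mxE mul0r. Qed.

Lemma dotv_delta n (j : 'I_n) (y : 'rV[R]_n) : dotv (delta_mx ord0 j) y = y ord0 j.
Proof.
rewrite /dotv (bigD1 j)//= mxE !eqxx mul1r big1 ?addr0// => i ij.
by rewrite mxE (negbTE ij) andbF mul0r.
Qed.

Lemma solution_sqint t x j : 0 <= t <= T -> sqint P (fun w => u t x w ord0 j).
Proof.
move=> tT; have [v gv] := solution_gaussian2 x x (delta_mx ord0 j) 0 tT tT.
have := gaussian_sqint gv.
by under eq_fun do rewrite dotv_delta dotv0l addr0.
Qed.

Lemma solution_ip t s x y i j : 0 <= t <= T -> 0 <= s <= T ->
  ip P (fun w => u t x w ord0 i) (fun w => u s y w ord0 j) =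
  (sigma *m sigma^T) i j * spectral_int beta T t s (x - y).
Proof.
move=> tT sT; have [_ cov _] := u_sol.
have := cov t s x y i j tT sT; rewrite unlock (@wave_covarianceE R k beta T)// -EFinM => H.
by rewrite /ip /Rintegral H.
Qed.

Lemma ip_dotv (U V : Omega -> 'rV[R]_d) (a b : 'rV[R]_d) :
  (forall i, sqint P (fun w => U w ord0 i)) -> (forall i, sqint P (fun w => V w ord0 i)) ->
  ip P (fun w => dotv a (U w)) (fun w => dotv b (V w)) =
  \sum_(i < d) \sum_(j < d)
    a ord0 i * b ord0 j * ip P (fun w => U w ord0 i) (fun w => V w ord0 j).
Proof.
move=> sU sV; have sZ c (X : Omega -> R) := @sqintZ R _ _ P c X.
rewrite ip_suml; last 2 first.
- by move=> i; exact: sZ.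
- by apply: sqint_sum => i; exact: sZ.
apply: eq_bigr => i _; rewrite ipZl//; last by apply: sqint_sum => j; exact: sZ.
rewrite ipC ip_suml//; last by move=> j; exact: sZ.
rewrite mulr_sumr; apply: eq_bigr => j _.
by rewrite ipZl// ipC mulrA.
Qed.

Lemma ip_sub_sqr (X Y : Omega -> R) : sqint P X -> sqint P Y ->
  ip P (fun w => X w - Y w) (fun w => X w - Y w) = ip P X X + ip P Y Y - 2 * ip P X Y.
Proof.
move=> sX sY; have sY1 := sqintZ (-1) sY; have sXY := sqintD sX sY1.
transitivity (ip P (fun w => X w + -1 * Y w) (fun w => X w + -1 * Y w)).
  by apply: eq_Rintegral => w _; rewrite mulN1r.
rewrite ipDl// !ipDr// !ipZl// !ipZr// (ipC _ Y X); ring.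
Qed.

(** The components of [sigma^-1 u]. *)
Definition decoupled t x (i : 'I_d) w := dotv (row i (invmx sigma)) (u t x w).

Hypothesis sigma_unit : sigma \in unitmx.

(** [sigma^-1 (sigma sigma^T) sigma^-T] is the identity. *)
Lemma decoupled_ip t s x y i j : 0 <= t <= T -> 0 <= s <= T ->
  ip P (decoupled t x i) (decoupled s y j) =
  if i == j then spectral_int beta T t s (x - y) else 0.
Proof.
move=> tT sT; rewrite ip_dotv; try by move=> l; exact: solution_sqint.
pose I := spectral_int beta T t s (x - y).
transitivity ((invmx sigma *m (sigma *m sigma^T) *m (invmx sigma)^T) i j * I).
  rewrite [in RHS]mxE mulr_suml exchange_big /=; apply: eq_bigr => b _.
  rewrite [in RHS]mxE !mulr_suml; apply: eq_bigr => a _.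
  by rewrite solution_ip// !mxE /I; ring.
rewrite mulmxA mulVmx// mul1mx -trmx_mul mulVmx// trmx1 mxE /I.
by case: eqP => _; rewrite ?mul1r ?mul0r.
Qed.

Lemma decoupled_sqint t x i : 0 <= t <= T -> sqint P (decoupled t x i).
Proof. by move=> tT; apply: sqint_sum => j; apply: sqintZ; exact: solution_sqint. Qed.

Lemma decoupled_gaussian t s x y (a b : 'I_d -> R) : 0 <= t <= T -> 0 <= s <= T ->
  exists v, gaussian P (fun w => \sum_(i < d) a i * decoupled t x i w +
                                 \sum_(i < d) b i * decoupled s y i w) v.
Proof.
move=> tT sT; have E (c : 'I_d -> R) (z : 'rV[R]_d) :
    \sum_(i < d) c i * dotv (row i (invmx sigma)) z =
    dotv (\row_j \sum_(i < d) c i * invmx sigma i j) z.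
  rewrite /dotv; under eq_bigr do rewrite mulr_sumr.
  rewrite exchange_big; apply: eq_bigr => j _; rewrite mxE mulr_suml.
  by apply: eq_bigr => i _; rewrite mxE mulrA.
have [v gv] := solution_gaussian2 x y (\row_j \sum_(i < d) a i * invmx sigma i j)
  (\row_j \sum_(i < d) b i * invmx sigma i j) tT sT.
by exists v; under eq_fun do rewrite !E.
Qed.

Lemma decoupled_continuous w i t (x : 'rV[R]_k) e : 0 <= t <= T -> 0 < e ->
  exists2 delta, 0 < delta & forall s (y : 'rV[R]_k), 0 <= s <= T -> `|s - t| < delta ->
    (forall j, `|y ord0 j - x ord0 j| < delta) ->
    `|decoupled s y i w - decoupled t x i w| < e.
Proof.
move=> tT e0; have [_ _ /(_ w) /subspace_continuousP cu] := u_sol.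
pose a := row i (invmx sigma); pose K := 1 + \sum_(j < d) `|a ord0 j|.
have K1 : 1 <= K by rewrite lerDl sumr_ge0.
have K0 : 0 < K by exact: lt_le_trans K1.
have := cu (t, x); have inA s y : 0 <= s <= T ->
    (`[0, T]%classic `*` [set: 'rV[R]_k]) (s, y) by move=> sT; split; rewrite //= in_itv.
move=> /(_ (inA t x tT)) /cvg_ballP.
have eK : 0 < e / K by rewrite divr_gt0.
move=> /(_ _ eK) /= /nbhs_ballP[delta /= d0 H]; exists delta => // s y sT st yx.
have /= := H (s, y).
have B : ball (t, x) delta (s, y).
  split; first by rewrite /ball/= distrC.
  by split => // l j; rewrite /ball /= ord1 distrC.
move=> /(_ B (inA s y sT)) [_ Hj].
rewrite /decoupled /dotv -sumrB (le_lt_trans (ler_norm_sum _ _ _))//.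
apply: (@le_lt_trans _ _ (\sum_(j < d) `|a ord0 j| * (e / K))).
  apply: ler_sum => j _; rewrite -mulrBr normrM ler_wpM2l//.
  by have := Hj ord0 j; rewrite /ball /= distrC => /ltW.
rewrite -mulr_suml mulrA ltr_pdivrMr// mulrC ltr_pM2l//.
by rewrite /K ltrDr.
Qed.

End solution.

(** * Lipschitz images of cubes in space-time *)

Section parametrized.
Context {R : realType} (k d m : nat) (t0 T beta : R) (sigma : 'M[R]_d).
Hypothesis beta_gt0 : 0 < beta.
Hypothesis beta_lt2 : beta < 2.
Hypothesis beta_ltk : beta < k%:R.
Hypothesis t0_gt0 : 0 < t0.
Hypothesis t0_ltT : t0 < T.
Hypothesis sigma_unit : sigma \in unitmx.
Variables (tp : ('I_m -> R) -> R) (xp : ('I_m -> R) -> 'rV[R]_k) (L : R).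
Hypothesis L_gt0 : 0 < L.
Hypothesis tp_range : forall p, cube p -> t0 <= tp p <= T.
Hypothesis param_lipschitz : forall l p q, cube p -> cube q ->
  (forall i, `|p i - q i| <= 2 ^- l) ->
  `|tp p - tp q| <= L * 2 ^- l /\ \sum_(j < k) `|(xp p - xp q) ord0 j| <= L * 2 ^- l.

Let T_gt0 : 0 < T. Proof. exact: lt_trans t0_ltT. Qed.
Let tpT p : cube p -> 0 <= tp p <= T.
Proof. by move=> /tp_range/andP[? ->]; rewrite (le_trans (ltW t0_gt0)). Qed.

Notation H := ((2 - beta) / 2).
Notation C := (8 * (T * (riesz_const k beta * L `^ (2 - beta)))).

Lemma exponent_gt0 : 0 < H.
Proof. by rewrite divr_gt0// subr_gt0. Qed.

Lemma increment_scale l :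
  8 * (T * (riesz_const k beta * (L * 2 ^- l) `^ (2 - beta))) =
  C * ((2 `^ (- H)) ^+ 2) ^+ l.
Proof.
rewrite powRM ?(ltW L_gt0) ?invr_ge0 ?exprn_ge0//.
have -> : (2 ^- l : R) `^ (2 - beta) = ((2 `^ (- H)) ^+ 2) ^+ l; last by ring.
rewrite -exprVn powR_exp ?invr_ge0//; congr (_ ^+ l).
rewrite -[X in X `^ _ = _]powR_inv1// -powRrM -powR_mulrn ?powR_ge0// -powRrM; congr (_ `^ _).
by field.
Qed.

Lemma spectral_int_ge : exists2 tau2, 0 < tau2 &
  forall p, cube p -> tau2 <= spectral_int beta T (tp p) (tp p) (0 : 'rV[R]_k).
Proof.
have [tau2 tau0 H] := @spectral_int_gt0 R k beta T beta_gt0 beta_lt2 beta_ltk T_gt0 t0 t0_gt0 t0_ltT.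
by exists tau2 => // p /tp_range/H.
Qed.

Lemma decoupled_regular tau2 dO (Omega : measurableType dO) (P : probability Omega R)
    (u : R -> 'rV[R]_k -> Omega -> 'rV[R]_d) :
  is_wave_solution T beta sigma P u ->
  (forall p, cube p -> tau2 <= spectral_int beta T (tp p) (tp p) (0 : 'rV[R]_k)) ->
  regular_gaussian P (fun p i => decoupled sigma u (tp p) (xp p) i) tau2 C (2 `^ (- H)).
Proof.
move=> us lb.
have dip := @decoupled_ip R k d T beta sigma dO Omega P u us beta_gt0 beta_lt2 beta_ltk T_gt0 sigma_unit.
split.
- by move=> p q cp cq a b; apply: (decoupled_gaussian us); exact: tpT.
- move=> p cp; exists (spectral_int beta T (tp p) (tp p) (0 : 'rV[R]_k)); first exact: lb.
  by move=> i j; rewrite dip ?tpT// subrr.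
- by move=> p q cp cq i j ij; rewrite dip ?tpT// (negbTE ij).
- move=> l p q cp cq pq i; have [h1 h2] := param_lipschitz cp cq pq.
  rewrite ip_sub_sqr; try by apply: (decoupled_sqint us); exact: tpT.
  rewrite !dip ?tpT// eqxx !subrr -increment_scale.
  apply: spectral_int_increment_le => //; try exact: tpT.
  by rewrite mulr_gt0// invr_gt0 exprn_gt0.
- move=> w p cp i e e0.
  have [delta d0 Hd] := decoupled_continuous us w i (xp p) (tpT cp) e0.
  have [N HN] : exists N, L * 2 ^- N < delta.
    have [||N HN] := @small_power R 2^-1 (delta / (2 * L)); first by lra.
      by rewrite divr_gt0// mulr_gt0.
    exists N; rewrite -exprVn; apply: (@le_lt_trans _ _ (delta / 2)); last by lra.
    rewrite mulrC -ler_pdivlMr// (le_trans HN)// le_eqVlt; apply/orP; left; apply/eqP.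
    by field; rewrite gt_eqF.
  exists N => l q Nl cq qp.
  have pq : forall j, `|q j - p j| <= 2 ^- N.
    by move=> j; rewrite (le_trans (qp j))// lef_pV2 ?posrE ?exprn_gt0// ler_weXn2l// ler1n.
  have [h1 h2] := param_lipschitz cq cp pq.
  apply: Hd; first exact: tpT.
    exact: le_lt_trans HN.
  move=> j; apply: le_lt_trans HN; apply: le_trans h2.
  rewrite (bigD1 j)//= !mxE lerDl; exact: sumr_ge0.
Qed.

(** [sigma^-1] maps a ball of radius [r] into a sup-norm ball of radius [K * r]. *)
Lemma hits_decoupled dO (Omega : measurableType dO) (u : R -> 'rV[R]_k -> Omega -> 'rV[R]_d)
    (S : set (R * 'rV[R]_k)) (K : R) (y : 'rV[R]_d) r :
  (forall z, S z -> exists2 p, cube p & z = (tp p, xp p)) ->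
  (forall i, \sum_(j < d) `|row i (invmx sigma) ord0 j| <= K) -> 0 < K ->
  hits u S (eball y r) `<=`
  hit_event (fun p i => decoupled sigma u (tp p) (xp p) i)
    (fun i => dotv (row i (invmx sigma)) y) (K * r).
Proof.
move=> Sp HK K0 w [_ [[z Sz <-]]]; rewrite /eball /= => zr.
have [p cp ze] := Sp _ Sz; rewrite ze /= in zr; exists p => // i.
set a := row i _ in HK *.
have -> : decoupled sigma u (tp p) (xp p) i w - dotv a y = dotv (u (tp p) (xp p) w - y) a.
  rewrite /decoupled /dotv -sumrB; apply: eq_bigr => j _; rewrite !mxE; ring.
rewrite (le_lt_trans (normr_dotv_le _ _))// mulrC.
apply: (@le_lt_trans _ _ (K * enorm (u (tp p) (xp p) w - y))).
  by rewrite ler_wpM2r ?enorm_ge0// HK.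
by rewrite ltr_pM2l.
Qed.

(** The common form of the three bounds: [tp] and [xp] parametrize a piece of
    space-time by a cube whose dimension [m] determines the exponent. *)
Lemma hitting_parametrized : exists c : R, 0 < c /\
  forall dO (Omega : measurableType dO) (P : probability Omega R)
    (u : R -> 'rV[R]_k -> Omega -> 'rV[R]_d),
  is_wave_solution T beta sigma P u ->
  forall S : set (R * 'rV[R]_k),
  (forall z, S z -> exists2 p, cube p & z = (tp p, xp p)) ->
  forall A : set 'rV[R]_d,
  (hitting_probability P u S A <=
   c%:E * hausdorff_measure (d%:R - 2 * m%:R / (2 - beta)) A)%E.
Proof.
have [tau2 tau0 lb] := spectral_int_ge.
have C0 : 0 <= C.
  apply: mulr_ge0 => //; apply: mulr_ge0; first exact: ltW.
  by apply: mulr_ge0; [exact: riesz_const_ge0|exact: powR_ge0].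
have [c c0 Hc] := hit_ball_bound m d tau0 C0 exponent_gt0.
have eE : d%:R - m%:R / H = d%:R - 2 * m%:R / (2 - beta).
  by congr (_ - _); field; rewrite gt_eqF// subr_gt0.
set g := d%:R - 2 * m%:R / (2 - beta) in eE *; rewrite eE in Hc.
pose K := 1 + \sum_(i < d) \sum_(j < d) `|row i (invmx sigma) ord0 j|.
have K1 : 1 <= K by rewrite lerDl sumr_ge0// => i _; exact: sumr_ge0.
have K0 : 0 < K by exact: lt_le_trans K1.
have HK i : \sum_(j < d) `|row i (invmx sigma) ord0 j| <= K.
  rewrite /K [X in _ <= 1 + X](bigD1 i)//= addrCA lerDl addr_ge0// sumr_ge0// => l _.
  exact: sumr_ge0.
exists (c * K `^ g); split; first by rewrite mulr_gt0 ?powR_gt0.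
move=> dO Omega P u us S Sp A.
apply: (@hitting_hausdorff _ _ _ _ _ _ _ _ _ _ K^-1).
- by rewrite mulr_gt0 ?powR_gt0.
- by rewrite invr_gt0.
move=> y r /andP[r0 rK].
apply: (@le_trans _ _ (mu_ext P (hit_event (fun p i => decoupled sigma u (tp p) (xp p) i)
    (fun i => dotv (row i (invmx sigma)) y) (K * r)))).
  by apply: le_outer_measure; exact: hits_decoupled.
apply: (le_trans (Hc _ _ _ _ (decoupled_regular us lb) _ _ _)).
  by rewrite mulr_gt0//= -ler_pdivlMl// mulr1.
by rewrite (@powRM _ K r g (ltW K0) (ltW r0)) (mulrA c).
Qed.

End parametrized.

(** * Affine parametrizations and the three bounds *)

Lemma compact_rbox (R : realType) n (J : set 'rV[R]_n) : compact J ->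
  exists2 M, 0 < M & J `<=` rbox (- M) M.
Proof.
move=> /compact_bounded[N [_ HN]]; exists (`|N| + 1); first by rewrite ltr_wpDl.
move=> x /HN /= H i; rewrite -ler_norml.
have Nlt : N < `|N| + 1 by rewrite (le_lt_trans (ler_norm N))// ltrDl.
apply: (le_trans _ (H _ Nlt)).
by rewrite /Num.Def.normr /= mx_normrE (le_bigmax _ (fun ij => `|x ij.1 ij.2|) (ord0, i)).
Qed.

Section affine.
Context {R : realType}.

Definition lerp (a b s : R) := a + (b - a) * s.

Lemma lerp_range a b s : a <= b -> 0 <= s <= 1 -> a <= lerp a b s <= b.
Proof.
move=> ab /andP[s0 s1]; rewrite /lerp lerDl mulr_ge0 ?subr_ge0//=.
by rewrite -lerBrDl ler_piMr// subr_ge0.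
Qed.

Lemma lerp_dist a b s s' e : a <= b -> `|s - s'| <= e ->
  `|lerp a b s - lerp a b s'| <= (b - a) * e.
Proof.
move=> ab se; rewrite /lerp opprD addrACA subrr add0r -mulrBr normrM.
by rewrite ger0_norm ?subr_ge0// ler_wpM2l// subr_ge0.
Qed.

Lemma lerpK a b x : a < b -> lerp a b ((x - a) / (b - a)) = x.
Proof. by move=> ab; rewrite /lerp mulrC divfK ?subr_eq0 ?gt_eqF// addrC subrK. Qed.

Lemma lerp_inv01 (a b x : R) : a < b -> a <= x <= b -> 0 <= (x - a) / (b - a) <= 1.
Proof.
move=> ab /andP[ax xb]; rewrite divr_ge0 ?subr_ge0 ?(ltW ab)//=.
by rewrite ler_pdivrMr ?subr_gt0// mul1r lerD2r.
Qed.

Lemma sum_lerp_dist a b e n (s s' : 'I_n -> R) : a <= b ->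
  (forall j, `|s j - s' j| <= e) ->
  \sum_(j < n) `|((\row_j lerp a b (s j) : 'rV[R]_n) - \row_j lerp a b (s' j)) ord0 j| <=
  n%:R * (b - a) * e.
Proof.
move=> ab ss; apply: (@le_trans _ _ (\sum_(j < n) (b - a) * e)).
  by apply: ler_sum => j _; rewrite !mxE; exact: lerp_dist.
by rewrite sumr_const card_ord -[leLHS]mulr_natl mulrA.
Qed.

End affine.

Theorem theorem4p5 (R : realType) (k d : nat) (t0 T beta : R)
    (sigma : 'M[R]_d) (I : set R) (J : set 'rV[R]_k)
    (k_ge1 : (1 <= k)%N) (d_ge1 : (1 <= d)%N)
    (t0_gt0 : 0 < t0) (t0_ltT : t0 < T)
    (beta_gt0 : 0 < beta) (beta_lt : beta < Num.min 2 k%:R)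
    (sigma_inv : sigma \in unitmx)
    (I_compact : compact I) (I_sub : I `<=` `[t0, T]%classic)
    (I_pos : (0 < lebesgue_measure I)%E)
    (J_compact : compact J) (J_pos : (0 < lebesgue_rV J)%E) :
  [/\ exists c : R, 0 < c /\
        forall (dO : measure_display) (Omega : measurableType dO)
          (P : probability Omega R)
          (u : R -> 'rV[R]_k -> Omega -> 'rV[R]_d),
        is_wave_solution T beta sigma P u ->
        forall A : set (borel R d), measurable A ->
        (hitting_probability P u (I `*` J) A <=
         c%:E * hausdorff_measure (d%:R - 2 * (k%:R + 1) / (2 - beta)) A)%E,
      forall t : R, I t -> exists c : R, 0 < c /\
        forall (dO : measure_display) (Omega : measurableType dO)
          (P : probability Omega R)
          (u : R -> 'rV[R]_k -> Omega -> 'rV[R]_d),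
        is_wave_solution T beta sigma P u ->
        forall A : set (borel R d), measurable A ->
        (hitting_probability P u ([set t] `*` J) A <=
         c%:E * hausdorff_measure (d%:R - 2 * k%:R / (2 - beta)) A)%E &
      forall x : 'rV[R]_k, J x -> exists c : R, 0 < c /\
        forall (dO : measure_display) (Omega : measurableType dO)
          (P : probability Omega R)
          (u : R -> 'rV[R]_k -> Omega -> 'rV[R]_d),
        is_wave_solution T beta sigma P u ->
        forall A : set (borel R d), measurable A ->
        (hitting_probability P u (I `*` [set x]) A <=
         c%:E * hausdorff_measure (d%:R - 2 / (2 - beta)) A)%E].
Proof.
move: beta_lt; rewrite lt_min => /andP[b2 bk].
have [M M0 JM] := compact_rbox J_compact.
have MM : - M < M by lra.
have t0T := ltW t0_ltT; have T0 : 0 < T by exact: lt_trans t0_ltT.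
have k0 : 0 < k%:R :> R by rewrite ltr0n.
have IT t : I t -> t0 <= t <= T by move=> /I_sub; rewrite /= in_itv.
pose unit x := (x - - M) / (M - - M).
have unit01 x (j : 'I_k) : J x -> 0 <= unit (x ord0 j) <= 1.
  by move=> Jx; apply: lerp_inv01 => //; exact: JM.
have unitK (x : 'rV[R]_k) : \row_j lerp (- M) M (unit (x ord0 j)) = x.
  by apply/rowP => j; rewrite mxE lerpK.
(* A common Lipschitz constant for the parametrizations of [t0, T] and of the
   cube [-M, M]^k, which contain [I] and [J]. *)
pose L := T + k%:R * (M - - M).
have kM0 : 0 < k%:R * (M - - M) by rewrite mulr_gt0// subr_gt0.
have L0 : 0 < L by rewrite addr_gt0.
have TL e : 0 <= e -> (T - t0) * e <= L * e.
  by move=> e0; rewrite ler_wpM2r// /L lerD// (le_trans _ (ltW kM0))// oppr_le0 ltW.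
have kML e : 0 <= e -> k%:R * (M - - M) * e <= L * e.
  by move=> e0; rewrite ler_wpM2r// /L lerDr ltW.
have e0 l : 0 <= 2 ^- l :> R by rewrite invr_ge0 exprn_ge0.
split.
- pose tp (p : 'I_k.+1 -> R) := lerp t0 T (p ord0).
  pose xp (p : 'I_k.+1 -> R) : 'rV[R]_k := \row_j lerp (- M) M (p (lift ord0 j)).
  have [||c [c0 Hc]] := @hitting_parametrized R k d k.+1 t0 T beta sigma beta_gt0 b2 bk
    t0_gt0 t0_ltT sigma_inv tp xp L L0.
  + by move=> p cp; exact: lerp_range.
  + move=> l p q cp cq pq; split; first by apply: le_trans (TL _ (e0 l)); exact: lerp_dist.
    by apply: le_trans (kML _ (e0 l)); apply: sum_lerp_dist (ltW MM) _ => j.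
  exists c; split => // dO Omega P u us A _.
  have -> : k%:R + 1 = k.+1%:R :> R by rewrite -natr1.
  apply: Hc => // -[t x] [/= It Jx].
  exists (fun i => if unlift ord0 i is Some j then unit (x ord0 j) else (t - t0) / (T - t0)).
    move=> i; case: unliftP => [j _|_]; first exact: unit01.
    by apply: lerp_inv01 => //; exact: IT.
  rewrite /tp /xp unlift_none lerpK//; congr pair.
  by rewrite -[LHS]unitK; apply/rowP => j; rewrite !mxE liftK.
- move=> t It; pose xp (p : 'I_k -> R) : 'rV[R]_k := \row_j lerp (- M) M (p j).
  have [||c [c0 Hc]] := @hitting_parametrized R k d k t0 T beta sigma beta_gt0 b2 bk
    t0_gt0 t0_ltT sigma_inv (fun=> t) xp L L0.
  + by move=> p cp; exact: IT.
  + move=> l p q cp cq pq; split; first by rewrite subrr normr0 mulr_ge0// ltW.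
    by apply: le_trans (kML _ (e0 l)); exact: sum_lerp_dist (ltW MM) _.
  exists c; split => // dO Omega P u us A _; apply: Hc => // -[s x] [/= -> Jx].
  by exists (fun j => unit (x ord0 j)); [move=> j; exact: unit01|rewrite /xp unitK].
- move=> x Jx; pose tp (p : 'I_1 -> R) := lerp t0 T (p ord0).
  have [||c [c0 Hc]] := @hitting_parametrized R k d 1 t0 T beta sigma beta_gt0 b2 bk
    t0_gt0 t0_ltT sigma_inv tp (fun=> x) L L0.
  + by move=> p cp; exact: lerp_range.
  + move=> l p q cp cq pq; split; first by apply: le_trans (TL _ (e0 l)); exact: lerp_dist.
    by rewrite big1 ?mulr_ge0// ?ltW// => j _; rewrite subrr mxE normr0.
  rewrite mulr1 in Hc; exists c; split => // dO Omega P u us A _.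
  apply: Hc => // -[t y] [/= It ->].
  exists (fun=> (t - t0) / (T - t0)); first by move=> i; apply: lerp_inv01 => //; exact: IT.
  by rewrite /tp lerpK.
Qed.
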